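(* Let $\lambda,\mu\in C^\infty(\mathbb R^2,\mathbb R)$ and $c>0$ satisfy $\mu(u,v)\le -c<0<c\le\lambda(u,v)$ for all $(u,v)\in\mathbb R^2$, and let $(K,\gamma)\in(0,+\infty)\times(0,1)$. Let $C_1>0$ and $C_2>0$, and let $$T=\frac1c+\frac{C_1^{1-\gamma}}{(1-\gamma)K},$$ $$M_1=\max\big(\|\lambda\|_{C^0([-C_1,C_1]^2)},\|\mu\|_{C^0([-C_1,C_1]^2)}\big),$$ $$M_2=\max\big(\|\partial_u\mu\|_{C^0([-C_1,C_1]^2)},\|\partial_v\mu\|_{C^0([-C_1,C_1]^2)},\|\partial_u\lambda\|_{C^0([-C_1,C_1]^2)},\|\partial_v\lambda\|_{C^0([-C_1,C_1]^2)}\big),$$ where $M_2>0$. Assume that $$T M_2\max(1,M_1)\max\Big(\frac{KC_1^\gamma}{c},C_2\Big)\le\frac1{2e},$$ and let $C_3=(2TM_2)^{-1}$. Let $\mathcal D$ be the set of pairs $(u,v)\in \mathrm{Lip}([0,T]\times[0,1])^2$ such that $\max(\|u\|_\infty,\|v\|_\infty)\le C_1$ and $u$ and $v$ are $C_3$-Lipschitz. Then for any pair $(u_0,v_0)\in\mathrm{Lip}([0,1])^2$ with $\max(\|u_0\|_\infty,\|v_0\|_\infty)\le C_1$ and $\max(\|u_0'\|_\infty,\|v_0'\|_\infty)\le C_2$, there exists a unique solution $(u,v)$ in the class $\mathcal D$ of the system $$\partial_t u+\lambda(u,v)\partial_x u=0,\qquad \partial_t v+\mu(u,v)\partial_x v=0,$$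 $$\frac{d}{dt}u(t,0)=-K\,\mathrm{sgn}(u(t,0))|u(t,0)|^\gamma,\qquad \frac{d}{dt}v(t,1)=-K\,\mathrm{sgn}(v(t,1))|v(t,1)|^\gamma,$$ $$u(0,x)=u_0(x),\qquad v(0,x)=v_0(x).$$ Furthermore, the solution is global in time (it extends to a solution on $[0,+\infty)\times[0,1]$), with $u(t,\cdot)=v(t,\cdot)=0$ for $t\ge T$. Finally, the equilibrium state $(0,0)$ is stable in $\mathrm{Lip}([0,1])^2$ for this system; that is, $$\|(u,v)\|_{L^\infty(\mathbb R^+;\mathrm{Lip}([0,1])^2)}\to0\quad\text{as}\quad\|(u_0,v_0)\|_{\mathrm{Lip}([0,1])^2}\to0.$$
   Context: $\mathrm{Lip}([0,1])=W^{1,\infty}(0,1)$ is the space of Lipschitz continuous functions on $[0,1]$, with norm $\|u\|_{\mathrm{Lip}([0,1])}=\|u\|_\infty+\|u'\|_\infty$; similarly for $\mathrm{Lip}([0,T]\times[0,1])$. A function $u$ on $[0,T]\times[0,1]$ is $M$-Lipschitz if $|u(t_1,x_1)-u(t_2,x_2)|\le M(|t_1-t_2|+|x_1-x_2|)$ for all points. By a solution of the system is meant a pair $(u,v)$ of Lipschitz functions such that the two partial differential equations hold in the distributional sense (on $(0,T)\times(0,1)$, resp. on $(0,+\infty)\times(0,1)$ for global solutions), while the boundary ordinary differential equations (for $t>0$) and the initial conditions hold pointwise. *)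

(* Defs.v *)
From HB Require Import structures.
From mathcomp Require Import all_boot all_order all_algebra.
From mathcomp Require Import all_classical all_reals all_analysis.
Set Implicit Arguments.
Unset Strict Implicit.
Unset Printing Implicit Defensive.
Import Order.TTheory GRing.Theory Num.Theory.
Import numFieldNormedType.Exports.
Local Open Scope classical_set_scope.
Local Open Scope ring_scope.

(* Functions on a subset of R or R^2 are represented by total functions; only
   their values on that subset are ever constrained or compared. *)

Section Norms.
Context {R : realType}.
Implicit Types (u v : R -> R) (w : R * R -> R).

Definition sup_norm {T : Type} (A : set T) (f : T -> R) : \bar R :=
  ereal_sup [set `|f x|%:E | x in A].

(* L^oo(A) norm: the library's L^oo norm of the extension by 0 outside A. *)
Definition Linfty_norm {d} {T : measurableType d}
    (mu : {measure set T -> \bar R}) (A : set T) (f : T -> \bar R) : \bar R :=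
  'N[mu]_+oo [patch (cst 0%E) A f]%E.

Definition leb2 := ((@lebesgue_measure R) \x (@lebesgue_measure R))%E.

(* ||u'||_oo, with u' the almost everywhere defined derivative. At the (null
   set of) points where u is not differentiable, derive1 u is an irrelevant default
   value. *)
Definition deriv_norm u : \bar R :=
  Linfty_norm (@lebesgue_measure R) `]0, 1[ (EFin \o derive1 u).

Definition is_Lip01 u : Prop := [lipschitz u x | x in `[0, 1]].

Definition Lip_norm u : \bar R := (sup_norm `[0%R, 1%R] u + deriv_norm u)%E.

Definition Lip2_norm u v : \bar R := (Lip_norm u + Lip_norm v)%E.

(* Meaningful (finite) for f continuous on [-C, C]^2, where it is the C^0 norm. *)
Definition C0_norm (C : R) (f : R * R -> R) : R :=
  fine (sup_norm (`[- C, C] `*` `[- C, C]) f).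

(* Lipschitz condition for the l^1 distance; the library's k.-lipschitz_A on
   R * R uses the max distance. *)
Definition M_Lipschitz (M : R) (A : set (R * R)) w : Prop :=
  forall p q, A p -> A q -> `|w p - w q| <= M * (`|p.1 - q.1| + `|p.2 - q.2|).

End Norms.

Section SmoothFunctions.
Context {R : realType}.

Definition dir (i : bool) : R * R := if i then (0, 1) else (1, 0).

(* partial false = derivative in the first variable,
   partial true = derivative in the second variable. *)
Definition partial (i : bool) (f : R * R -> R) : R * R -> R :=
  fun p => 'D_(dir i) f p.

(* C^oo(R^2): all iterated partial derivatives exist and are continuous. *)
Definition smooth (f : R * R -> R) : Prop :=
  forall s : seq bool,
    continuous (foldr partial f s) /\
    forall i p, derivable (foldr partial f s) p (dir i).

(* C_c^oo(Om) *)
Definition test_function (Om : set (R * R)) (phi : R * R -> R) : Prop :=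
  [/\ smooth phi,
      compact (closure [set p | phi p != 0]) &
      closure [set p | phi p != 0] `<=` Om].

End SmoothFunctions.

Section Solutions.
Context {R : realType}.
Implicit Types (a u v w : R * R -> R) (Om : set (R * R)).

(* The L^oo function w is the i-th partial derivative of u in the sense of
   distributions on Om. *)
Definition weak_partial (i : bool) Om u w : Prop :=
  [/\ measurable_fun Om w,
      (Linfty_norm leb2 Om (EFin \o w) < +oo)%E &
      forall phi, test_function Om phi ->
        \int[leb2]_(p in Om) (u p * partial i phi p) =
        - \int[leb2]_(p in Om) (w p * phi p)].

(* d_t u + a d_x u = 0 in D'(Om), for a continuous coefficient a and u in
   W^{1,oo}; the points of R * R are (t, x). *)
Definition transport_eq Om a u : Prop :=
  exists ut ux,
    [/\ weak_partial false Om u ut,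
        weak_partial true Om u ux &
        forall phi, test_function Om phi ->
          \int[leb2]_(p in Om) ((ut p + a p * ux p) * phi p) = 0].

(* (0, T) x (0, 1) and [0, T] x [0, 1]; T = +oo gives (0, +oo) x (0, 1) and
   [0, +oo) x [0, 1]. *)
Definition open_strip (T : \bar R) : set (R * R) :=
  [set p | [/\ 0 < p.1, (p.1%:E < T)%E, 0 < p.2 & p.2 < 1]].
Definition closed_strip (T : \bar R) : set (R * R) :=
  [set p | [/\ 0 <= p.1, (p.1%:E <= T)%E, 0 <= p.2 & p.2 <= 1]].

Definition feedback (K gamma y : R) : R :=
  - K * Num.sg y * `|y| `^ gamma.

Definition is_solution (lambda mu : R * R -> R) (K gamma : R) (T : \bar R)
    (u0 v0 : R -> R) (u v : R * R -> R) : Prop :=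
  [/\ exists M, M_Lipschitz M (closed_strip T) u /\
                M_Lipschitz M (closed_strip T) v,
      transport_eq (open_strip T) (fun p => lambda (u p, v p)) u /\
      transport_eq (open_strip T) (fun p => mu (u p, v p)) v,
      forall t : R, 0 < t -> (t%:E < T)%E ->
        is_derive t (1 : R) (fun s : R => u (s, 0)) (feedback K gamma (u (t, 0))) /\
        is_derive t (1 : R) (fun s : R => v (s, 1)) (feedback K gamma (v (t, 1))) &
      forall x : R, 0 <= x <= 1 -> u (0, x) = u0 x /\ v (0, x) = v0 x].

Definition class_D (T C1 C3 : R) (u v : R * R -> R) : Prop :=
  [/\ (maxe (sup_norm (closed_strip T%:E) u) (sup_norm (closed_strip T%:E) v)
        <= C1%:E)%E,
      M_Lipschitz C3 (closed_strip T%:E) u &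
      M_Lipschitz C3 (closed_strip T%:E) v].

(* Norm in L^oo(R^+; Lip([0,1])^2). *)
Definition Linfty_Lip2_norm (u v : R * R -> R) : \bar R :=
  Linfty_norm (@lebesgue_measure R) `[0, +oo[
    (fun t : R => Lip2_norm (fun x => u (t, x)) (fun x => v (t, x))).

End Solutions.

(* Main.v *)
Require Import Defs.
From HB Require Import structures.
From mathcomp Require Import all_boot all_order all_algebra.
From mathcomp Require Import all_classical all_reals all_analysis.
From mathcomp Require Import measurable_realfun ess_sup_inf ring lra.
Import Order.TTheory GRing.Theory Num.Theory.
Import numFieldNormedType.Exports.
Local Open Scope classical_set_scope.
Local Open Scope ring_scope.

(** The proof trades the distributional equation for a finite difference
    estimate.  Say that w is transported with speed a if
      |w(t, x) - w(t - h, x - h b)| <= A h (h + |b - a(t, x)|)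
    for every segment of the strip whose slope b lies in [c, M].  This makes w
    nearly constant along segments, the defect being of second order in h when
    the slope is the speed at the end point.  For Lipschitz w and a the estimate
    is equivalent to d_t w + a d_x w = 0 in the sense of distributions
    ([transport_eqI] and [strip_semilag]).  It is pointwise and stable under
    uniform limits, and all the rest of the argument rests on it:
    characteristics are never constructed.

    The second component is reflected, x -> 1 - x, so that both components enter
    at x = 0 and move to the right with a speed in [c, M].  Their boundary values
    solve y' = - K sgn(y) |y|^gamma, which is solved explicitly
    ([feedback_flow]); the right-hand side is nonincreasing in y, whence
    uniqueness ([feedback_unique]), and y vanishes after a finite time.

    Comparison.  Two transported pairs with the same data are followed back along
    the same segment.  The slope mismatch of the second pair is a difference of
    speeds, which the distance of the two pairs controls, and a Gronwall argument
    bounds that distance ([compare]).  This gives uniqueness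
    ([solution_unique]), and makes approximate solutions a Cauchy sequence.

    Existence.  Cut [0, T] into n steps and, during a step, let every point move
    with the speed computed from the state at the beginning of the step.  A
    spatial Lipschitz constant at most e L0 grows by a factor 1 + 1/n at most
    during a step, as soon as 2 M2 e L0 <= 1/T; hence it goes from L0 to at most
    (1 + 1/n)^n L0 <= e L0.  That is the smallness condition, with
    L0 = max(K C1^gamma / c, C2): the initial data have slope C2, and boundary
    data that vary at rate K C1^gamma and enter with speed at least c have slope
    K C1^gamma / c.  The limit is a transported pair ([transported_existence]).

    Extinction and stability.  The boundary values vanish from the time
    C1^(1 - gamma) / ((1 - gamma) K) on; 1/c later the zero state has invaded
    [0, 1] ([extinct]), so that the solution extends by 0 beyond T
    ([solution_exists]).  If the data are small the scheme may be started with a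
    small L0, and produces a solution of sup norm at most that of the data and of
    slope at most e L0; by uniqueness it is the given one.

    Two pieces of analysis are needed.  Lipschitz functions of one variable are
    almost everywhere differentiable and controlled by the essential supremum of
    their derivative ([lip_derivable], [lip_le_ae_derive]); this follows from the
    Radon-Nikodym theorem, as x + f(x) and x - f(x) are nondecreasing if f is
    1-Lipschitz.  And the passage from the weak equation to the estimate is a
    mollification by products of bumps P(x) (1 - x^2)^-k exp(-1 / (1 - x^2)), a
    family that is stable under differentiation ([bump], [interior_semilag]). *)

Set Implicit Arguments.
Unset Strict Implicit.
Unset Printing Implicit Defensive.
Set SsrOldRewriteGoalsOrder.

(** * Lipschitz functions of one variable *)

Section aeS.
Context d (T : measurableType d) (R : realType) (mu : {measure set T -> \bar R}).
Let F := ae_filter_ringOfSetsType mu.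
Lemma aeS (P Q : T -> Prop) : (forall x, P x -> Q x) ->
  {ae mu, forall x, P x} -> {ae mu, forall x, Q x}.
Proof. by move=> PQ; apply: filterS. Qed.
Lemma aeS2 (P P' Q : T -> Prop) : (forall x, P x -> P' x -> Q x) ->
  {ae mu, forall x, P x} -> {ae mu, forall x, P' x} -> {ae mu, forall x, Q x}.
Proof. by move=> PQ; apply: filterS2. Qed.
Lemma aeS3 (P P' P'' Q : T -> Prop) : (forall x, P x -> P' x -> P'' x -> Q x) ->
  {ae mu, forall x, P x} -> {ae mu, forall x, P' x} -> {ae mu, forall x, P'' x} -> {ae mu, forall x, Q x}.
Proof. by move=> PQ; apply: filterS3. Qed.
End aeS.

Section OneVariable.
Context {R : realType}.
Notation mu := (@lebesgue_measure R).

Section Lip1.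
Variable f : R -> R.
Hypothesis f_lip1 : forall x y, `|f x - f y| <= `|x - y|.
(** With f 1-Lipschitz, (x + f x) / 2 and (x - f x) / 2 are nondecreasing, and
    they add up to x. *)
Definition half_sum (x : R) := (x + f x) / 2.
Definition half_diff (x : R) := (x - f x) / 2.
Lemma half_sum_nd : {homo half_sum : x y / x <= y}.
Proof.
move=> x y xy; rewrite /half_sum; have := f_lip1 x y; rewrite (distrC x y) (@ger0_norm _ (y - x)) ?subr_ge0// ler_norml.
lra.
Qed.
Lemma half_diff_nd : {homo half_diff : x y / x <= y}.
Proof.
move=> x y xy; rewrite /half_diff; have := f_lip1 x y; rewrite (distrC x y) (@ger0_norm _ (y - x)) ?subr_ge0// ler_norml.
lra.
Qed.
Lemma lip1_continuous : continuous f.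
Proof.
move=> x; apply/cvgrPdist_le => e e0; near=> y.
apply: (le_trans (f_lip1 x y)); near: y; move: e e0.
by apply/cvgrPdist_le; exact: cvg_id.
Unshelve. all: by end_near. Qed.
Lemma half_sum_rc : right_continuous half_sum.
Proof.
apply/right_continuousW => x; apply: cvgMl; apply: cvgD; [exact: cvg_id|exact: lip1_continuous].
Qed.
Lemma half_diff_rc : right_continuous half_diff.
Proof.
apply/right_continuousW => x; apply: cvgMl; apply: cvgB; [exact: cvg_id|exact: lip1_continuous].
Qed.
HB.instance Definition _ := isCumulative.Build R _ R half_sum half_sum_nd half_sum_rc.
HB.instance Definition _ := isCumulative.Build R _ R half_diff half_diff_nd half_diff_rc.

Let nu_sum := lebesgue_stieltjes_measure (half_sum : cumulative R R).
Let nu_diff := lebesgue_stieltjes_measure (half_diff : cumulative R R).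

Lemma nu_sum_oc (a b : R) : a <= b -> nu_sum `]a, b]%classic = (half_sum b - half_sum a)%:E.
Proof.
move=> ab; rewrite /nu_sum /lebesgue_stieltjes_measure/= /measure_extension/=.
rewrite measurable_mu_extE/=; last exact: is_ocitv.
by rewrite wlength_itv_bnd.
Qed.
Lemma nu_diff_oc (a b : R) : a <= b -> nu_diff `]a, b]%classic = (half_diff b - half_diff a)%:E.
Proof.
move=> ab; rewrite /nu_diff /lebesgue_stieltjes_measure/= /measure_extension/=.
rewrite measurable_mu_extE/=; last exact: is_ocitv.
by rewrite wlength_itv_bnd.
Qed.
(** The Stieltjes measures of the two functions are nonnegative and their sum is
    Lebesgue measure. This domination is what makes absolute continuity
    immediate. *)
Lemma nu_sum_le A : measurable A -> (nu_sum A <= mu A)%E.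
Proof.
move=> mA.
pose M : {measure set (measurableTypeR R) -> \bar R} := measure_add nu_sum nu_diff.
have mE B : M B = (nu_sum B + nu_diff B)%E by exact: measure_addE.
rewrite (@lebesgue_measure_unique R M) //.
  by rewrite mE leeDl.
move=> X [[a b] _ <-]/=; have [ab|ba] := leP a b.
  rewrite mE nu_sum_oc// nu_diff_oc// lebesgue_measure_itv/= lte_fin.
  case: ltP => ab'; rewrite -EFinD; congr (_%:E); rewrite /half_sum /half_diff.
    lra.
  have -> : a = b by apply/eqP; rewrite eq_le ab.
  by rewrite !subrr addr0.
by rewrite set_itv_ge ?bnd_simp -?leNgt ?(ltW ba)// !measure0.
Qed.

(** Radon-Nikodym theorem, on a bounded interval since it needs a finite
    measure. *)
Lemma half_sum_density (N : nat) : exists g : R -> R, [/\ mu.-integrable setT (EFin \o g), (forall x, 0 <= g x) &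
  forall a b : R, - N%:R <= a -> a <= b -> b <= N%:R -> half_sum b - half_sum a = \int[mu]_(x in `]a, b]) g x].
Proof.
pose D : set R := `]- N%:R, N%:R]%classic.
have NN : - N%:R <= N%:R :> R by rewrite (@le_trans _ _ 0)// oppr_le0.
have mD : measurable D by exact: measurable_itv.
have Doo : (nu_sum D < +oo)%E by rewrite /D nu_sum_oc// ltry.
pose nu : {finite_measure set (measurableTypeR R) -> \bar R} :=
  @mfrestr _ (measurableTypeR R) R D nu_sum mD Doo.
have numu : nu `<< mu.
  apply/null_content_dominatesP => A mA A0.
  apply/eqP; rewrite eq_le measure_ge0 andbT -A0 /= /mfrestr /mrestr.
  apply: le_trans (nu_sum_le (measurableI _ _ mA mD)) _.
  by rewrite le_measure// ?inE//; exact: measurableI.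
pose g := Radon_Nikodym_SigmaFinite.f nu mu.
have gE : EFin \o (fine \o g) = g.
  by apply/funext => x /=; rewrite fineK// Radon_Nikodym_SigmaFinite.f_fin_num.
exists (fine \o g); split.
- by rewrite gE; exact: Radon_Nikodym_SigmaFinite.f_integrable.
- by move=> x /=; rewrite fine_ge0// Radon_Nikodym_SigmaFinite.f_ge0.
move=> a b Na ab bN.
transitivity (fine (nu `]a, b]%classic)); last first.
  rewrite (Radon_Nikodym_SigmaFinite.f_integral numu (measurable_itv `]a, b])).
  by rewrite /Rintegral -[in LHS]/g -{1}gE.
rewrite /= /mfrestr /mrestr setIidl.
  by have := nu_sum_oc ab; rewrite /nu_sum => ->.
move=> x; rewrite /D /= !in_itv/= => /andP[ax xb].
by rewrite (le_lt_trans Na ax) (le_trans xb).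
Qed.

(** By Lebesgue differentiation, the density gives the derivative of f almost
    everywhere. *)
Lemma ae_is_derive_density (N : nat) : exists g : R -> R, [/\ mu.-integrable setT (EFin \o g), (forall x, 0 <= g x),
  (forall a b : R, - N%:R <= a -> a <= b -> b <= N%:R -> f b - f a + (b - a) = 2 * \int[mu]_(x in `]a, b]) g x)
  & {ae mu, forall x : R, - N%:R < x < N%:R -> is_derive x 1 f (2 * g x - 1)}].
Proof.
have [g [gi g0 gE]] := half_sum_density N.
have gE' a b : - N%:R <= a -> a <= b -> b <= N%:R -> f b - f a + (b - a) = 2 * \int[mu]_(x in `]a, b]) g x.
  by move=> Na ab bN; rewrite -gE// /half_sum; field.
exists g; split => //.
have gi' y : mu.-integrable `]-oo, y] (EFin \o g) by exact: integrableS gi.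
have gl : locally_integrable setT g by apply: open_integrable_locally => //; exact: openT.
have := FTC1Ny gi' gl; rewrite /=; set G := (fun y : R => \int[mu]_(t in `]-oo, y]) g t).
apply: aeS => x [dG GE] /andP[Nx xN].
have fE : \forall y \near x, f y = f (- N%:R) + 2 * (G y - G (- N%:R)) - (y + N%:R).
  have : \forall y \near x, - N%:R < y < N%:R.
    by near=> y; apply/andP; split; near: y; [exact: lt_nbhsr|exact: lt_nbhsl].
  apply: filterS => y /andP[Ny yN].
  have := gE' _ _ (lexx _) (ltW Ny) (ltW yN).
  rewrite /G Rintegral_itvB//; first by move=> <-; ring.
  by rewrite bnd_simp ltW.
have dGx : is_derive x (1 : R) G (g x).
  apply: DeriveDef.
    exact: dG.
  rewrite -derive1E.
  exact: GE.
(* f is twice a primitive of the density minus the identity, on ]-N, N[. *)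
apply: (@near_eq_is_derive _ _ _ (fun y => f (- N%:R) + 2 * (G y - G (- N%:R)) - (y + N%:R))).
- by apply: filterS fE => y ->.
- have -> : 2 * g x - 1 = 0 + (2 * (g x - 0)) - (1 + 0) :> R by rewrite subr0 add0r addr0.
  exact: is_deriveB.
Unshelve. all: by end_near. Qed.

Lemma lip1_derivable : {ae mu, forall x : R, derivable f x 1}.
Proof.
have H (N : nat) : {ae mu, forall x : R, - N%:R < x < N%:R -> derivable f x 1}.
  have [g [_ _ _]] := ae_is_derive_density N; apply: aeS => x h /h.
  by case.
have : mu.-negligible (\bigcup_N ~` [set x : R | - N%:R < x < N%:R -> derivable f x 1]).
  by apply: negligible_bigcup => N; exact: H.
apply: negligibleS => x /= nd.
have [N xN] : exists N : nat, `|x| < N%:R.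
  by exists (Num.bound `|x|); exact: archi_boundP.
by exists N => //= h; apply: nd; apply: h; rewrite -ltr_norml.
Qed.

(** f b - f a + (b - a) is twice the integral of the density, and the density is
    almost everywhere at most (C + 1) / 2. *)
Lemma lip1_le (C a b : R) : 0 <= C -> a <= b -> {ae mu, forall x : R, a < x < b -> derive1 f x <= C} -> f b - f a <= C * (b - a).
Proof.
move=> C0 ab aeC.
pose N := Num.bound (Num.max `|a| `|b|).
have : Num.max `|a| `|b| < N%:R by apply: archi_boundP; rewrite le_max normr_ge0.
rewrite gt_max => /andP[]; rewrite !ltr_norml => /andP[Na aN] /andP[Nb bN].
have [g [gi g0 gE gae]] := ae_is_derive_density N.
suff : \int[mu]_(x in `]a, b]) g x <= (C + 1) / 2 * (b - a).
  have := gE a b (ltW Na) ab (ltW bN); lra.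
have -> : (C + 1) / 2 * (b - a) = \int[mu]_(x in `]a, b]) ((C + 1) / 2).
  rewrite Rintegral_cst//= lebesgue_measure_itv/= lte_fin.
  case: ltP => //= ba; congr (_ * _).
  have -> : a = b by apply/eqP; rewrite eq_le ab.
  by rewrite subrr.
have ig : mu.-integrable `]a, b] (EFin \o g) by exact: integrableS gi.
have ic : mu.-integrable `]a, b] (EFin \o cst ((C + 1) / 2)).
  apply: measurable_bounded_integrable => //=.
    by rewrite lebesgue_measure_itv/=; case: ifP => // _; rewrite -EFinB ltry.
  by exists `|(C + 1) / 2|; split => // M CM x _ /=; exact: ltW.
rewrite /Rintegral fine_le//.
- by apply: integrable_fin_num => //; exact: ig.
- by apply: integrable_fin_num => //; exact: ic.
apply: ae_ge0_le_integral => //.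
- by move=> x _; rewrite lee_fin.
- by apply: (measurable_int mu); exact: ig.
- by move=> x _; rewrite lee_fin divr_ge0// addr_ge0.
have aeb : {ae mu, forall x : R, x != b}.
  exists [set b]; split => //; first exact: lebesgue_measure_set1.
  by move=> x /= /negP; rewrite negbK => /eqP.
apply: aeS3 aeC gae aeb => x h1 h2 h3 /=.
rewrite in_itv/= => /andP[ax xb].
have xb' : x < b by rewrite lt_neqAle h3.
rewrite lee_fin.
have := h1; rewrite ax xb' => /(_ isT).
have : - N%:R < x < N%:R by rewrite (lt_trans Na ax) (lt_trans xb' bN).
move=> /h2 dx; rewrite derive1E derive_val; lra.
Qed.
End Lip1.

Lemma lip_rescale (M : R) (f : R -> R) : (forall x y, `|f x - f y| <= M * `|x - y|) ->
  forall x y, `|f x / (`|M| + 1) - f y / (`|M| + 1)| <= `|x - y|.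
Proof.
move=> fM x y; have k0 : 0 < `|M| + 1 by rewrite ltr_pwDr.
rewrite -mulrBl normrM [`|(_ + _)^-1|]ger0_norm ?invr_ge0 ?(ltW k0)// ler_pdivrMr// mulrC.
apply: le_trans (fM x y) _; apply: ler_wpM2r => //.
by rewrite (le_trans (ler_norm M))// lerDl.
Qed.

(** Rademacher's theorem on the line, by rescaling to a 1-Lipschitz function. *)
Lemma lip_derivable (M : R) (f : R -> R) : (forall x y, `|f x - f y| <= M * `|x - y|) ->
  {ae mu, forall x : R, derivable f x 1}.
Proof.
move=> fM; pose k := `|M| + 1; have k0 : 0 < k by rewrite ltr_pwDr.
have fk := lip_rescale fM; rewrite -/k in fk.
have := lip1_derivable fk; apply: aeS => x dx.
rewrite (_ : f = k \*: (fun x => f x / k)); first exact: derivableZ.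
by apply/funext => y /=; rewrite /GRing.scale/= mulrC divfK// gt_eqF.
Qed.

(** A Lipschitz function is the integral of its derivative, so that an essential
    bound of the derivative is a Lipschitz constant. The norms of the initial
    data enter the estimates through this lemma. *)
Lemma lip_le_ae_derive (M : R) (f : R -> R) (C a b : R) : (forall x y, `|f x - f y| <= M * `|x - y|) ->
  0 <= C -> a <= b -> {ae mu, forall x : R, a < x < b -> `|derive1 f x| <= C} -> `|f b - f a| <= C * (b - a).
Proof.
move=> fM; pose k := `|M| + 1; have k0 : 0 < k by rewrite ltr_pwDr.
have fk := lip_rescale fM; rewrite -/k in fk.
have fk' x y : `|- (f x / k) - - (f y / k)| <= `|x - y| by rewrite -opprD normrN.
move=> C0 ab aeC.
have Ck0 : 0 <= C / k by rewrite divr_ge0// ltW.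
have d1 x : derivable f x 1 -> is_derive x (1 : R) (fun x => f x / k) (derive1 f x / k).
  move=> dx; rewrite (_ : (fun x => f x / k) = k^-1 \*: f); last first.
    by apply/funext => y /=; rewrite /GRing.scale/= mulrC.
  rewrite mulrC; apply: is_deriveZ; apply: DeriveDef; first exact: dx.
  by rewrite derive1E.
(* The one-sided bound [lip1_le] is applied to f and to - f. *)
have key s : s = 1 \/ s = -1 -> s * (f b - f a) <= C * (b - a).
  move=> s1.
  have sk x y : `|s * (f x / k) - s * (f y / k)| <= `|x - y|.
    by case: s1 => ->; rewrite ?mul1r ?mulN1r.
  have : s * (f b / k) - s * (f a / k) <= C / k * (b - a).
    apply: (lip1_le sk Ck0 ab).
    apply: aeS2 (lip_derivable fM) aeC => x dx Cx /Cx {}Cx.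
    have dsx : is_derive x (1 : R) (fun x => s * (f x / k)) (s * (derive1 f x / k)).
      by apply: (@is_deriveZ _ _ _ (fun x => f x / k)); exact: d1.
    rewrite derive1E derive_val mulrA ler_pM2r ?invr_gt0//.
    move: Cx; rewrite ler_norml => /andP[? ?]; case: s1 => ->; lra.
  rewrite -mulrBr -mulrBl [leRHS]mulrAC mulrA.
  by rewrite ler_pM2r// invr_gt0.
rewrite ler_norml; have := key 1 (or_introl erefl); have := key (-1) (or_intror erefl).
lra.
Qed.
End OneVariable.

(** * Elementary estimates *)

Section Elementary.
Context {R : realType}.
Implicit Types (a b k x y : R).

Lemma le_archi a b k : (forall n : nat, a <= b + k / n.+1%:R) -> a <= b.
Proof.
move=> H; rewrite leNgt; apply/negP => ba.
have [k0|k0] := lerP k 0.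
  by have := H 0%N; rewrite divr1; lra.
have ab0 : 0 < a - b by rewrite subr_gt0.
have := H (Num.bound (k / (a - b))).
have := archi_boundP (ltW (divr_gt0 k0 ab0)).
set N := Num.bound _ => kN.
have : k / (a - b) < N.+1%:R by rewrite (lt_trans kN)// ltr_nat.
rewrite ltr_pdivrMr// => kN' ; rewrite -lerBlDl ler_pdivlMr// mulrC.
by rewrite leNgt kN'.
Qed.

Lemma segment_itv m x d : 0 <= d -> 0 <= x - d -> x <= m -> 0 <= x <= m /\ 0 <= x - d <= m.
Proof. by move=> *; split; lra. Qed.

Lemma reflect01 x : 0 <= x <= 1 -> 0 <= 1 - x <= 1.
Proof. by move=> *; lra. Qed.

Lemma max0_lip x y : `|Num.max 0 x - Num.max 0 y| <= `|x - y|.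
Proof.
have := ler_norm (x - y); have := ler_norm (y - x); rewrite (distrC y).
by move: `|x - y| => r h1 h2; rewrite ler_norml /Num.max; do ! case: ifP; lra.
Qed.

(** For x = 1 this is the source of the factor e in the smallness condition. *)
Lemma expX_le (x : R) n : 0 <= x -> (1 + x / n.+1%:R) ^+ n.+1 <= expR x.
Proof.
move=> x0; have -> : expR x = expR (x / n.+1%:R) ^+ n.+1.
  by rewrite -expRM_natl mulrC divfK ?pnatr_eq0.
by rewrite lerXn2r ?nnegrE ?expR_ge0 ?addr_ge0 ?divr_ge0//; exact: expR_ge1Dx.
Qed.

Definition clip a b x := Num.max a (Num.min b x).

Lemma clip_itv a b x : a <= b -> a <= clip a b x <= b.
Proof. by move=> ab; rewrite /clip le_max lexx/= ge_max ab ge_min lexx. Qed.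

Lemma clip_id a b x : a <= x <= b -> clip a b x = x.
Proof. by move=> /andP[ax xb]; rewrite /clip min_r// max_r. Qed.

Lemma clip_lip a b x y : `|clip a b x - clip a b y| <= `|x - y|.
Proof.
rewrite /clip /Num.max /Num.min; have := ler_norm (x - y); have := ler_norm (y - x).
rewrite (distrC y); move: `|x - y| => r h1 h2; rewrite ler_norml.
by do ! case: ifP; lra.
Qed.

Definition clamp := clip 0 1.

Lemma clamp01 x : 0 <= clamp x <= 1.
Proof. exact: clip_itv. Qed.
Lemma clamp_ge0 x : 0 <= clamp x. Proof. by case/andP: (clamp01 x). Qed.

Lemma clamp_id x : 0 <= x -> x <= 1 -> clamp x = x.
Proof. by move=> x0 x1; apply: clip_id; rewrite x0. Qed.
Lemma clamp_lip x y : `|clamp x - clamp y| <= `|x - y|.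
Proof. exact: clip_lip. Qed.

(** The formula of the scheme changes from one time step to the next; a segment
    is cut at the grid times it crosses. *)
Lemma lip_cells (f : R -> R) (eta al om kap : R) :
  0 < eta -> 0 <= al ->
  (forall (k : nat) s t, al <= s -> s <= t -> t <= om -> k%:R * eta <= s -> t <= k.+1%:R * eta ->
     `|f t - f s| <= kap * (t - s)) ->
  forall s t, al <= s -> s <= t -> t <= om -> `|f t - f s| <= kap * (t - s).
Proof.
move=> eta0 al0 H s t als st tom.
have [N tN] : exists N : nat, t <= N%:R * eta.
  exists (Num.bound (t / eta)); rewrite -ler_pdivrMr//.
  by rewrite ltW// archi_boundP// divr_ge0 ?(ltW eta0)// (le_trans al0)// (le_trans als).
elim: N s t als st tom tN => [|N IH] s t als st tom tN.
  apply: (H 0%N) => //; first by rewrite mul0r (le_trans al0).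
  by rewrite (le_trans tN)// mul0r mulr_ge0// ltW.
have [tN'|Nt] := lerP t (N%:R * eta); first exact: IH.
have [Ns|sN] := lerP (N%:R * eta) s; first exact: (H N).
apply: (le_trans (ler_distD (f (N%:R * eta)) _ _)).
rewrite (_ : kap * (t - s) = kap * (t - N%:R * eta) + kap * (N%:R * eta - s)); last by ring.
apply: lerD.
  by apply: (H N); rewrite ?lexx// ?(ltW Nt)// (le_trans als) ?ltW.
by apply: IH; rewrite ?lexx// ?(ltW sN)// (le_trans (ltW Nt)).
Qed.
End Elementary.

(** * Transport along segments *)

Section System.
Context {R : realType}.
Variables (Lam : bool -> R -> R -> R) (c M M2 : R).
Hypothesis c0 : 0 < c.
Hypothesis Lamc : forall b p q, c <= Lam b p q.
Hypothesis LamM : forall b p q, Lam b p q <= M.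
Hypothesis M20 : 0 <= M2.
Hypothesis Lamlip : forall b p q p' q', `|Lam b p q - Lam b p' q'| <= M2 * (`|p - p'| + `|q - q'|).

Let M0 : 0 < M. Proof. by apply: (lt_le_trans c0); apply: le_trans (Lamc true 0 0) (LamM _ _ _). Qed.

(** The second component is reflected, so the place x of one component is the
    place 1 - x of the other. *)
Definition speed (w : bool -> R -> R -> R) b t x := Lam b (w b t x) (w (~~ b) t (1 - x)).

(** The defect on a segment of slope [be] has the slope mismatch as a factor; it
    is of order h^2 along the exact direction. The slack [del] accommodates
    approximate solutions, whose speed lags by one time step. *)
Definition transported (c M T A del : R) (a w : R -> R -> R) :=
  forall t x h be, 0 <= h -> h <= t -> t <= T -> x <= 1 -> 0 <= x - h * be -> c <= be <= M ->
   `|w t x - w (t - h) (x - h * be)| <= A * h * (h + del + `|be - a t x|).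

Definition lip2 (T Lt Lx : R) (w : R -> R -> R) :=
  forall t t' x x', 0 <= t <= T -> 0 <= t' <= T -> 0 <= x <= 1 -> 0 <= x' <= 1 ->
   `|w t x - w t' x'| <= Lt * `|t - t'| + Lx * `|x - x'|.

Section Compare.
Variables (T A Lt Lx Lt' Lx' del del' : R) (w w' : bool -> R -> R -> R).
Hypothesis A0 : 0 <= A.
Hypothesis Lt0 : 0 <= Lt.
Hypothesis Lt0' : 0 <= Lt'.
Hypothesis del0 : 0 <= del.
Hypothesis del0' : 0 <= del'.
Hypothesis wl : forall b, lip2 T Lt Lx (w b).
Hypothesis wl' : forall b, lip2 T Lt' Lx' (w' b).
Hypothesis wt : forall b, transported c M T A del (speed w b) (w b).
Hypothesis wt' : forall b, transported c M T A del' (speed w' b) (w' b).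
Hypothesis ini : forall b x, 0 <= x <= 1 -> w b 0 x = w' b 0 x.
Hypothesis bnd : forall b t, 0 <= t <= T -> w b t 0 = w' b t 0.

Let B := A * (2 + 2 * M2 * (1 + Lt + Lt')).
Let B0 : 0 <= B.
Proof. by rewrite mulr_ge0// addr_ge0// mulr_ge0 ?mulr_ge0 ?addr_ge0. Qed.

(** Both pairs are followed back along one segment, whose slope is the speed of
    the first pair at its end point. For the second pair the mismatch is a
    difference of speeds, hence controlled by the distance of the pairs. *)
Lemma compare_step t h E : 0 <= t -> 0 <= h -> t + h <= T -> 0 <= E ->
  (forall b x, 0 <= x <= 1 -> `|w b t x - w' b t x| <= E) ->
  forall b x, 0 <= x <= 1 -> `|w b (t + h) x - w' b (t + h) x| <= E + B * h * (h + (del + del') + E).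
Proof.
move=> t0 h0 thT E0 H b x x01.
have tT : 0 <= t <= T by lra.
have thT' : 0 <= t + h <= T by lra.
have late b' z : 0 <= z <= 1 -> `|w b' (t + h) z - w' b' (t + h) z| <= E + (Lt + Lt') * h.
  move=> z01; have := @wl b' _ _ _ _ thT' tT z01 z01; have := @wl' b' _ _ _ _ tT thT' z01 z01.
  rewrite !subrr !normr0 !mulr0 !addr0 (_ : t - (t + h) = - h); last by ring.
  rewrite (_ : t + h - t = h); last by ring.
  rewrite normrN (ger0_norm h0) => e1 e2.
  apply: (le_trans (ler_distD (w b' t z) _ _)).
  have := ler_distD (w' b' t z) (w b' t z) (w' b' (t + h) z).
  have := H b' z z01; lra.
set be := speed w b (t + h) x; set be' := speed w' b (t + h) x.
have bec : c <= be <= M by rewrite Lamc LamM.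
have be0 : 0 < be by rewrite (lt_le_trans c0)//; case/andP: bec.
have bebe : `|be - be'| <= 2 * M2 * (E + (Lt + Lt') * h).
  apply: le_trans (Lamlip _ _ _ _ _) _; rewrite (mulrC 2) -mulrA ler_wpM2l//.
  have x01' : 0 <= 1 - x <= 1 by lra.
  have := late b x x01; have := late (~~ b) (1 - x) x01'; lra.
pose h1 := Num.min h (x / be).
(* The segment is cut where it meets x = 0, on which the pairs agree. *)
have xb0 : 0 <= x / be by rewrite divr_ge0 ?(ltW be0)//; lra.
have h10 : 0 <= h1 by rewrite le_min h0.
have h1h : h1 <= h by rewrite ge_min lexx.
have h1x : h1 * be <= x by rewrite -ler_pdivlMr// ge_min lexx orbT.
have e1 : `|w b (t + h) x - w b (t + h - h1) (x - h1 * be)| <= A * h1 * (h1 + del + `|be - be|).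
  by apply: wt => //; lra.
have e2 : `|w' b (t + h) x - w' b (t + h - h1) (x - h1 * be)| <= A * h1 * (h1 + del' + `|be - be'|).
  by apply: wt' => //; lra.
have e3 : `|w b (t + h - h1) (x - h1 * be) - w' b (t + h - h1) (x - h1 * be)| <= E.
  rewrite /h1; case: (leP h (x / be)) => hx.
    rewrite addrK; apply: H; move: h1x; rewrite /h1 min_l//.
    have := mulr_ge0 h0 (ltW be0); lra.
  rewrite divfK ?gt_eqF// subrr bnd ?subrr ?normr0//; lra.
rewrite subrr normr0 addr0 in e1.
have e4 : A * h1 * (h1 + del) <= A * h * (h + del).
  by rewrite ler_pM ?mulr_ge0 ?addr_ge0 ?ler_wpM2l// lerD2r.
have e5 : A * h1 * (h1 + del' + `|be - be'|) <= A * h * (h + del' + 2 * M2 * (E + (Lt + Lt') * h)).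
  by rewrite ler_pM ?mulr_ge0 ?addr_ge0 ?ler_wpM2l// !lerD.
have e6 : A * h * (h + del) + A * h * (h + del' + 2 * M2 * (E + (Lt + Lt') * h)) <= B * h * (h + (del + del') + E).
  rewrite -subr_ge0 /B.
  have -> : A * (2 + 2 * M2 * (1 + Lt + Lt')) * h * (h + (del + del') + E)
   - (A * h * (h + del) + A * h * (h + del' + 2 * M2 * (E + (Lt + Lt') * h)))
   = A * h * ((2 * M2 * (1 + Lt + Lt')) * (del + del') + 2 * M2 * h + 2 * M2 * (Lt + Lt') * E + (del + del') + 2 * E) by ring.
  by rewrite mulr_ge0 ?mulr_ge0 ?addr_ge0 ?mulr_ge0 ?addr_ge0.
have := ler_distD (w b (t + h - h1) (x - h1 * be)) (w b (t + h) x) (w' b (t + h) x).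
have := ler_distD (w' b (t + h - h1) (x - h1 * be)) (w b (t + h - h1) (x - h1 * be)) (w' b (t + h) x).
rewrite (distrC (w' b (t + h - h1) (x - h1 * be)) (w' b (t + h) x)).
lra.
Qed.

(** Gronwall's inequality, over n equal steps and then n to infinity. *)
Lemma compare t : 0 <= t <= T -> forall b x, 0 <= x <= 1 ->
  `|w b t x - w' b t x| <= (del + del') * expR (B * T).
Proof.
move=> /andP[t0 tT] b x x01.
apply: (@le_archi _ _ _ (t * expR (B * T))) => n.
pose h := t / n.+1%:R.
have h0 : 0 <= h by rewrite divr_ge0.
have nh : n.+1%:R * h = t by rewrite mulrC divfK// pnatr_eq0.
have key k : (k <= n.+1)%N -> forall b x, 0 <= x <= 1 ->
  `|w b (k%:R * h) x - w' b (k%:R * h) x| <= (h + (del + del')) * ((1 + B * h) ^+ k - 1).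
  elim: k => [_ b' x' x01'|k IH kn b' x' x01'].
    by rewrite mul0r ini// subrr normr0 expr0 subrr mulr0.
  have := @compare_step (k%:R * h) h ((h + (del + del')) * ((1 + B * h) ^+ k - 1)).
  rewrite (_ : k%:R * h + h = k.+1%:R * h); last by rewrite -(natr1 k); ring.
  have q1 : 1 <= 1 + B * h by rewrite lerDl mulr_ge0.
  have := exprn_ege1 k q1.
  set q := (1 + B * h) ^+ k => q1'.
  move=> /(_ _ _ _ _ _ _ _ x01') H'.
  apply: le_trans (H' _ _ _ _ _ b') _.
  - by rewrite mulr_ge0.
  - exact: h0.
  - by rewrite (le_trans _ tT)// -nh ler_wpM2r// ler_nat.
  - by apply: mulr_ge0; [rewrite !addr_ge0|rewrite subr_ge0].
  - exact: (IH (ltnW kn)).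
  by rewrite exprS -/q le_eqVlt; apply/orP; left; apply/eqP; ring.
have := key n.+1 (leqnn _) b x x01; rewrite nh => /le_trans; apply.
have qe : (1 + B * h) ^+ n.+1 <= expR (B * T).
  rewrite /h mulrA; apply: le_trans (@expX_le _ (B * t) n _) _; first by rewrite mulr_ge0.
  by rewrite ler_expR ler_wpM2l.
apply: (@le_trans _ _ ((h + (del + del')) * expR (B * T))).
  by rewrite ler_wpM2l ?addr_ge0//; lra.
by rewrite mulrDl addrC /h (mulrAC t).
Qed.
End Compare.

(** Go back from (t, x) in steps of duration at most h, each along the speed at
    its end point. A step moves by at least h c to the left and loses at most A
    h^2, so that after total duration at most x / c the boundary is reached, at
    a time when it carries the value 0, with total loss at most A h x / c. *)
Lemma extinct (T A ts : R) (a w : R -> R -> R) : 0 <= A -> 0 <= ts ->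
  (forall t x, c <= a t x <= M) ->
  transported c M T A 0 a w -> (forall t, ts <= t -> t <= T -> w t 0 = 0) ->
  forall t x, 0 <= x <= 1 -> ts + x / c <= t -> t <= T -> w t x = 0.
Proof.
move=> A0 ts0 aM wt w0 t x x01 tsx tT.
have key (h : R) (n : nat) : 0 < h -> forall t x, 0 <= x -> x <= 1 -> x <= n%:R * (h * c) -> ts + x / c <= t -> t <= T -> `|w t x| <= A * h * (x / c).
  move=> h0; elim: n => [|n IH] {t x x01 tsx tT} t x x0 x1 xn tsx tT.
    have -> : x = 0 by apply/eqP; rewrite eq_le x0 andbT (le_trans xn)// mul0r.
    by rewrite w0// ?normr0 ?mul0r ?mulr0//; move: tsx; have := divr_ge0 x0 (ltW c0); lra.
  set be := a t x; have bec : c <= be <= M := aM t x.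
  have be0 : 0 < be by rewrite (lt_le_trans c0)//; case/andP: bec.
  pose h1 := Num.min h (x / be).
  have xb0 : 0 <= x / be by rewrite divr_ge0 ?(ltW be0)//; lra.
  have h10 : 0 <= h1 by rewrite le_min ltW.
  have h1h : h1 <= h by rewrite ge_min lexx.
  have h1x : h1 * be <= x by rewrite -ler_pdivlMr// ge_min lexx orbT.
  have hbe : h1 * c <= h1 * be by rewrite ler_wpM2l//; case/andP: bec.
  have hb0 : 0 <= h1 * be by rewrite mulr_ge0 ?(ltW be0).
  have hx : h1 <= x / c by rewrite ler_pdivlMr//; lra.
  have step : `|w t x - w (t - h1) (x - h1 * be)| <= A * h1 * (h1 + 0 + `|be - be|).
    by apply: wt => //; lra.
  rewrite subrr normr0 !addr0 in step.
  have E : x / c = h1 + (x - h1 * c) / c by rewrite mulrBl mulfK ?gt_eqF//; ring.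
  have cc : (x - h1 * be) / c <= (x - h1 * c) / c by rewrite ler_pM2r ?invr_gt0//; lra.
  have rest : `|w (t - h1) (x - h1 * be)| <= A * h * ((x - h1 * be) / c).
    have [hx'|hx'] := lerP h (x / be).
      apply: IH; try lra.
      move: xn; rewrite -(natr1 n) mulrDl mul1r.
      have -> : h1 = h by rewrite /h1 min_l.
      have : h * c <= h * be by rewrite ler_wpM2l ?(ltW h0)//; case/andP: bec.
      lra.
    have xx : x - h1 * be = 0 by rewrite /h1 min_r ?(ltW hx')// divfK ?subrr// gt_eqF.
    rewrite xx w0 ?normr0 ?mul0r ?mulr0//; lra.
  have : A * h1 * h1 <= A * h * h1 by rewrite ler_wpM2r ?ler_wpM2l.
  have : A * h * ((x - h1 * be) / c) <= A * h * ((x - h1 * c) / c).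
    by rewrite ler_wpM2l ?mulr_ge0 ?(ltW h0).
  have := ler_normD (w t x - w (t - h1) (x - h1 * be)) (w (t - h1) (x - h1 * be)).
  rewrite subrK; rewrite E mulrDr; lra.
apply/normr0_eq0/eqP; rewrite eq_le normr_ge0 andbT.
apply: (@le_archi _ _ _ (A * (x / c))) => n; rewrite add0r.
have h0 : 0 < n.+1%:R^-1 :> R by rewrite invr_gt0 ltr0n.
have hc0 : 0 < n.+1%:R^-1 * c by rewrite mulr_gt0.
rewrite mulrAC; apply: (key _ (Num.bound (x / (n.+1%:R^-1 * c)))) => //; try lra.
rewrite -ler_pdivrMr// ltW// archi_boundP// divr_ge0 ?(ltW hc0)//; lra.
Qed.

End System.

(** * The semi-Lagrangian scheme *)

Section Scheme.
Context {R : realType}.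
Variables (Lam : bool -> R -> R -> R) (c M M2 : R).
Hypothesis c0 : 0 < c.
Hypothesis Lamc : forall b p q, c <= Lam b p q.
Hypothesis LamM : forall b p q, Lam b p q <= M.
Hypothesis M20 : 0 <= M2.
Hypothesis Lamlip : forall b p q p' q', `|Lam b p q - Lam b p' q'| <= M2 * (`|p - p'| + `|q - q'|).
Let M0 : 0 < M. Proof. by apply: (lt_le_trans c0); apply: le_trans (Lamc true 0 0) (LamM _ _ _). Qed.

(** The profile g at time tau and the boundary values y, moved with the constant
    speed be, evaluated at the time tau + s and the place x. *)
Definition trace (y g : R -> R) (tau s x be : R) : R :=
  if x <= s * be then y (tau + s - x / be) else g (x - s * be).

Section Trace.
Variables (y g : R -> R) (tau L0 Lg : R).
Hypothesis L00 : 0 <= L0.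
Hypothesis L0g : L0 <= Lg.
Hypothesis yl : forall t t', `|y t - y t'| <= c * L0 * `|t - t'|.
Hypothesis gl : forall x x', `|g x - g x'| <= Lg * `|x - x'|.
Hypothesis gy : g 0 = y tau.

Lemma trace_shift s r x be : 0 < be -> trace y g tau s x be = trace y g tau (s - r) (x - r * be) be.
Proof.
move=> be0; rewrite /trace.
have -> : (x - r * be <= (s - r) * be) = (x <= s * be) by rewrite mulrBl lerD2r.
case: ifP => _; first by congr y; field; rewrite gt_eqF.
by congr g; ring.
Qed.

(** A displacement of x changes the time of entry by |x - x'| / be, and be >= c
    while y is c L0-Lipschitz: this is why the boundary creates slopes L0 and no
    larger. The compatibility g 0 = y tau joins the two regimes. *)
Lemma trace_lipx s x x' be : c <= be -> `|trace y g tau s x be - trace y g tau s x' be| <= Lg * `|x - x'|.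
Proof.
move=> cbe; have be0 : 0 < be by exact: lt_le_trans cbe.
have Lg0 : 0 <= Lg by exact: le_trans L0g.
have yl' t t' : `|y t - y t'| <= Lg * (be * `|t - t'|).
  apply: le_trans (yl t t') _; rewrite -mulrA (mulrCA c); apply: ler_pM => //; first by rewrite mulr_ge0// ltW.
  by rewrite ler_wpM2r.
have bem (z : R) : be * `|z| = `|be * z| by rewrite normrM (gtr0_norm be0).
wlog xx : x x' / x <= x'.
  by move=> H; case/orP: (le_total x x') => /H //; rewrite distrC (distrC x).
rewrite /trace; have [xs|sx] := leP x (s * be); have [xs'|sx'] := leP x' (s * be).
- apply: (le_trans (yl' _ _)); rewrite ler_wpM2l// bem distrC le_eqVlt; apply/orP; left; apply/eqP.
  by congr (`|_|); field; rewrite gt_eqF.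
- apply: (le_trans (ler_distD (y tau) _ _)); rewrite -{2}gy.
  have := yl' (tau + s - x / be) tau; have := gl 0 (x' - s * be).
  rewrite bem sub0r normrN (gtr0_norm (x := x' - s * be)) ?subr_gt0//.
  rewrite (_ : be * _ = s * be - x); last by field; rewrite gt_eqF.
  rewrite (ger0_norm (x := s * be - x)) ?subr_ge0//.
  have -> : `|x - x'| = x' - x by rewrite distrC ger0_norm ?subr_ge0.
  by rewrite [X in _ -> _ -> _ <= X]mulrBr !mulrBr distrC; lra.
- by have := le_lt_trans (le_trans xx xs') sx; rewrite ltxx.
- apply: (le_trans (gl _ _)); rewrite le_eqVlt; apply/orP; left; apply/eqP.
  by congr (_ * `|_|); ring.
Qed.

(** A change of speed displaces the foot of the line by s times that change. *)
Lemma trace_lipb s x be be' : 0 <= s -> 0 <= x -> c <= be -> c <= be' ->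
  `|trace y g tau s x be - trace y g tau s x be'| <= Lg * s * `|be - be'|.
Proof.
move=> s0 x0; wlog bb : be be' / be <= be'.
  by move=> H h1 h2; case/orP: (le_total be be') => /H; [|rewrite distrC (distrC be)]; exact.
move=> cbe cbe'; have be0 : 0 < be by exact: lt_le_trans cbe.
have be0' : 0 < be' by exact: lt_le_trans cbe'.
have Lg0 : 0 <= Lg by exact: le_trans L0g.
have yl' t t' : `|y t - y t'| <= Lg * (be' * `|t - t'|).
  apply: le_trans (yl t t') _; rewrite -mulrA (mulrCA c); apply: ler_pM => //; first by rewrite mulr_ge0// ltW.
  by rewrite ler_wpM2r.
have bem (z : R) : be' * `|z| = `|be' * z| by rewrite normrM (gtr0_norm be0').
have sbb : s * be <= s * be' by rewrite ler_wpM2l.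
have -> : `|be - be'| = be' - be by rewrite distrC ger0_norm ?subr_ge0.
rewrite distrC -mulrA.
rewrite /trace; have [xs'|sx'] := leP x (s * be'); have [xs|sx] := leP x (s * be).
- apply: (le_trans (yl' _ _)); rewrite ler_wpM2l// bem.
  rewrite (_ : be' * _ = (x / be) * (be' - be)); last by field; rewrite !gt_eqF.
  rewrite ger0_norm ?mulr_ge0 ?invr_ge0 ?subr_ge0 ?(ltW be0)//.
  by rewrite ler_wpM2r ?subr_ge0// ler_pdivrMr.
- apply: (le_trans (ler_distD (y tau) _ _)); rewrite -{2}gy.
  have := yl' (tau + s - x / be') tau; have := gl 0 (x - s * be).
  rewrite bem sub0r normrN (gtr0_norm (x := x - s * be)) ?subr_gt0//.
  rewrite (_ : be' * _ = s * be' - x); last by field; rewrite gt_eqF.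
  rewrite (ger0_norm (x := s * be' - x)) ?subr_ge0//.
  by rewrite !mulrBr; lra.
- by have := le_lt_trans (le_trans xs sbb) sx'; rewrite ltxx.
- apply: (le_trans (gl _ _)); rewrite ler_wpM2l// (_ : _ - _ = s * (be - be')); last by ring.
  by rewrite normrM (ger0_norm s0) ler_wpM2l// distrC ger0_norm ?subr_ge0.
Qed.
End Trace.

Variables (T L0 m : R) (y w0 : bool -> R -> R).
Hypothesis T0 : 0 < T.
Hypothesis L00 : 0 <= L0.
Let L := expR 1 * L0.
Hypothesis LT : 2 * M2 * L <= T^-1.
Hypothesis yl : forall b t t', `|y b t - y b t'| <= c * L0 * `|t - t'|.
Hypothesis wl : forall b x x', `|w0 b x - w0 b x'| <= L0 * `|x - x'|.
Hypothesis yw : forall b, w0 b 0 = y b 0.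
Hypothesis ym : forall b t, `|y b t| <= m.
Hypothesis wm : forall b x, `|w0 b x| <= m.

Section Steps.
Variable n : nat.
Let eta := T / n.+1%:R.
Let q := 1 + 1 / n.+1%:R : R.
Let eta0 : 0 < eta. Proof. by rewrite divr_gt0. Qed.
Let q1 : 1 <= q. Proof. by rewrite lerDl divr_ge0. Qed.
Let q0 : 0 < q. Proof. exact: lt_le_trans q1. Qed.
(* The Lipschitz constant allowed after k steps. *)
Let LL k := L0 * q ^+ k.
Let LL0 k : L0 <= LL k. Proof. by rewrite ler_peMr// exprn_ege1. Qed.
Let LLpos k : 0 <= LL k. Proof. exact: le_trans (LL0 k). Qed.
Let LLle k : (k <= n.+1)%N -> LL k <= L.
Proof.
move=> kn; rewrite /L mulrC; apply: ler_wpM2l => //.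
by apply: le_trans (@expX_le _ 1 n ler01); rewrite ler_weXn2l.
Qed.
Let L0' : 0 <= L. Proof. by rewrite mulr_ge0// expR_ge0. Qed.

(** During a step a point x moves with the speed computed at x itself from the
    values at the beginning of the step. *)
Definition step (k : nat) (G : bool -> R -> R) (s : R) b x :=
  trace (y b) (G b) (k%:R * eta) s x (Lam b (G b x) (G (~~ b) (1 - x))).
(** The place is clamped so that the grid functions are Lipschitz on the whole
    line. *)
Fixpoint grid k b x : R :=
  match k with 0%N => w0 b (clamp x) | k'.+1 => step k' (grid k') eta b (clamp x) end.

Definition good k :=
  [/\ forall b x x', `|grid k b x - grid k b x'| <= LL k * `|x - x'|,
      forall b x, `|grid k b x| <= m & forall b, grid k b 0 = y b (k%:R * eta)].

(** Two points move with two speeds that differ by at most 2 M2 L |x - x'|, that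
    is by |x - x'| / T under the smallness condition; with [trace_lipb] this
    accounts for the growth factor. *)
Lemma step_lipx k s b x x' : (k <= n.+1)%N -> good k -> 0 <= s -> 0 <= x -> 0 <= x' ->
  `|step k (grid k) s b x - step k (grid k) s b x'| <= LL k * (1 + s / T) * `|x - x'|.
Proof.
move=> kn [gl gm g0] s0 x0 x0'; rewrite /step.
set be := Lam _ _ _; set be' := Lam _ _ _.
apply: (le_trans (ler_distD (trace (y b) (grid k b) (k%:R * eta) s x' be) _ _)).
have e1 := @trace_lipx (y b) (grid k b) (k%:R * eta) L0 (LL k) L00 (LL0 k) (yl b) (gl b) (g0 b) s x x' be (Lamc _ _ _).
have e2 := @trace_lipb (y b) (grid k b) (k%:R * eta) L0 (LL k) L00 (LL0 k) (yl b) (gl b) (g0 b) s x' be be' s0 x0' (Lamc _ _ _) (Lamc _ _ _).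
have e3 : `|be - be'| <= T^-1 * `|x - x'|.
  apply: le_trans (Lamlip _ _ _ _ _) _.
  have := gl b x x'; have := gl (~~ b) (1 - x) (1 - x').
  rewrite (_ : 1 - x - (1 - x') = - (x - x')) ?normrN; last by ring.
  move=> h1 h2; apply: (@le_trans _ _ (M2 * (2 * (L * `|x - x'|)))).
    rewrite ler_wpM2l//; have : LL k * `|x - x'| <= L * `|x - x'| by rewrite ler_wpM2r// LLle.
    lra.
  have : 2 * M2 * L * `|x - x'| <= T^-1 * `|x - x'| by rewrite ler_wpM2r.
  lra.
have e4 : LL k * s * `|be - be'| <= LL k * s * (T^-1 * `|x - x'|) by apply: ler_wpM2l => //; apply: mulr_ge0.
rewrite mulrDr mulrDl mulr1; lra.
Qed.

(** Waiting amounts to moving upstream. *)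
Lemma step_time k s s' b x : good k ->
  `|step k (grid k) s b x - step k (grid k) s' b x| <= LL k * M * `|s - s'|.
Proof.
move=> [gl gm g0]; rewrite /step.
set be := Lam _ _ _.
have be0 : 0 < be by exact: lt_le_trans (Lamc _ _ _).
rewrite (@trace_shift _ _ _ s (s - s') x be be0) (_ : s - (s - s') = s'); last by ring.
apply: (le_trans (@trace_lipx (y b) (grid k b) (k%:R * eta) L0 (LL k) L00 (LL0 k) (yl b) (gl b) (g0 b) s' _ _ be (Lamc _ _ _))).
rewrite (_ : _ - x = - ((s - s') * be)); last by ring.
rewrite normrN normrM (gtr0_norm be0) -mulrA ler_wpM2l// mulrC ler_wpM2r//.
exact: LamM.
Qed.

Lemma gridP k : (k <= n.+1)%N -> good k.
Proof.
elim: k => [_|k IH kn].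
  split => [b x x'|b x|b] /=.
  - by rewrite /LL expr0 mulr1; apply: le_trans (wl _ _ _) _; rewrite ler_wpM2l// clamp_lip.
  - exact: wm.
  - by rewrite clamp_id// mul0r yw.
have gk := IH (ltnW kn); have [gl gm g0] := gk.
split => [b x x'|b x|b] /=.
- apply: le_trans (step_lipx b (ltnW kn) gk (ltW eta0) (clamp_ge0 x) (clamp_ge0 x')) _.
  have -> : LL k * (1 + eta / T) = LL k.+1.
    by rewrite /LL exprSr -mulrA /q /eta; congr (_ * (_ * (1 + _))); rewrite mulrAC divff ?gt_eqF.
  by rewrite ler_wpM2l// clamp_lip.
- by rewrite /step /trace; case: ifP.
- rewrite clamp_id// /step /trace.
  rewrite mulr_ge0 ?(ltW eta0) ?(le_trans (ltW c0))// mul0r subr0.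
  by congr (y _ _); rewrite -(natr1 k); ring.
Qed.

Definition approx b t x := let k := Num.truncn (t / eta) in step k (grid k) (t - k%:R * eta) b x.

(** At a grid time the formula of the new cell agrees with that of the old one,
    which allows closed cells. *)
Lemma approx_cell k t b x : k%:R * eta <= t -> t <= k.+1%:R * eta -> 0 <= x <= 1 -> (k <= n)%N ->
  approx b t x = step k (grid k) (t - k%:R * eta) b x.
Proof.
move=> kt tk /andP[x0 x1] kn; rewrite /approx.
have t0 : 0 <= t by apply: le_trans kt; rewrite mulr_ge0// ltW.
move: tk; rewrite le_eqVlt => /orP[/eqP tE|tk].
  have -> : Num.truncn (t / eta) = k.+1 by rewrite tE mulfK ?gt_eqF// Num.Theory.natrK.
  rewrite tE subrr.
  rewrite {1}/step /trace mul0r subr0; case: ifP => [x0'|_].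
    have -> : x = 0 by apply/eqP; rewrite eq_le x0 x0'.
    rewrite mul0r subr0 addr0 /step /trace ifT.
      by rewrite mul0r subr0 addrC subrK.
    apply: mulr_ge0; last by apply: le_trans (ltW c0) _.
    by rewrite -mulrBl; apply: mulr_ge0; rewrite ?(ltW eta0)// subr_ge0 ler_nat.
  rewrite /= clamp_id//; congr (step _ _ _ _ _).
  by rewrite -(natr1 k); ring.
have -> // : Num.truncn (t / eta) = k.
apply/eqP; rewrite Num.Theory.truncn_eq; last by rewrite divr_ge0// ltW.
by rewrite ler_pdivlMr// kt/= ltr_pdivrMr.
Qed.

Lemma cellP t : 0 <= t <= T -> exists k, [/\ (k <= n)%N, k%:R * eta <= t & t <= k.+1%:R * eta].
Proof.
move=> /andP[t0 tT].
have nT : n.+1%:R * eta = T by rewrite /eta mulrC divfK// pnatr_eq0.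
have tn : 0 <= t / eta by rewrite divr_ge0// ltW.
have [tlt|] := ltP t T; last first.
  move=> Tt; exists n; split => //; last by rewrite nT.
  by rewrite (le_trans _ Tt)// -nT ler_wpM2r ?(ltW eta0)// ler_nat.
have /andP[h1 h2] := Num.Theory.truncn_itv tn.
exists (Num.truncn (t / eta)); split.
- rewrite -ltnS -(ltr_nat R) (le_lt_trans h1)// ltr_pdivrMr// nT //.
- by rewrite -ler_pdivlMr.
- by rewrite -ler_pdivrMr// ltW.
Qed.

Lemma cell_lt (k : nat) (t : R) : k%:R * eta <= t -> t <= T -> t < T -> (k <= n)%N.
Proof.
move=> kt _ tT; have nT : n.+1%:R * eta = T by rewrite /eta mulrC divfK// pnatr_eq0.
by rewrite -ltnS -(ltr_nat R) -(ltr_pM2r eta0) nT (le_lt_trans kt).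
Qed.

Lemma approx_lipx b t x x' : 0 <= t <= T -> 0 <= x <= 1 -> 0 <= x' <= 1 ->
  `|approx b t x - approx b t x'| <= L * `|x - x'|.
Proof.
move=> tT x01 x01'; have [k [kn kt tk]] := cellP tT.
rewrite !(approx_cell b kt tk)//.
have /andP[x0 x1] := x01; have /andP[x0' x1'] := x01'.
apply: le_trans (step_lipx b _ (gridP _) _ _ _) _ => //; try exact: leqW.
  by rewrite subr_ge0.
rewrite ler_wpM2r//; apply: (@le_trans _ _ (LL k.+1)); last exact: LLle.
have -> : LL k.+1 = LL k * q by rewrite /LL exprSr mulrA.
apply: ler_wpM2l; first exact: LLpos.
apply: lerD => //.
have := tk; rewrite -(natr1 k) mulrDl mul1r => tk'.
rewrite ler_pdivrMr// (_ : 1 / _ * T = eta); first by lra.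
by rewrite /eta mulrC mul1r.
Qed.

Lemma approx_lipt b x t' t : 0 <= x <= 1 -> 0 <= t' -> t' <= t -> t <= T ->
  `|approx b t x - approx b t' x| <= L * M * (t - t').
Proof.
move=> x01; apply: (@lip_cells _ (fun t => approx b t x) eta 0 T) => //.
move=> k s u s0 su uT ks uk.
have [kn|nk] := leqP k n; last first.
  have nT : n.+1%:R * eta = T by rewrite /eta mulrC divfK// pnatr_eq0.
  have Ts : T <= s by rewrite (le_trans _ ks)// -nT ler_wpM2r ?(ltW eta0)// ler_nat.
  have -> : u = s by apply/eqP; rewrite eq_le su (le_trans uT).
  by rewrite !subrr normr0 mulr0.
rewrite !(@approx_cell k)//; [|by rewrite (le_trans su)|by rewrite (le_trans ks)].
apply: le_trans (step_time _ _ _ _ (gridP (leqW kn))) _.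
rewrite (_ : _ - _ = u - s); last by ring.
rewrite ger0_norm ?subr_ge0// ler_wpM2r ?subr_ge0//.
by apply: ler_wpM2r; [exact: ltW|apply: LLle; exact: leqW].
Qed.

Lemma approx_lip2 b : lip2 T (L * M) L (approx b).
Proof.
move=> t t' x x' tT tT' x01 x01'.
apply: (le_trans (ler_distD (approx b t' x) _ _)).
apply: lerD; last exact: approx_lipx.
have /andP[t0 tT1] := tT; have /andP[t0' tT1'] := tT'.
case/orP: (le_total t t') => tt.
  by rewrite distrC (distrC t) (ger0_norm (x := t' - t)) ?subr_ge0//; exact: approx_lipt.
by rewrite (ger0_norm (x := t - t')) ?subr_ge0//; exact: approx_lipt.
Qed.

Lemma approx_le b t x : 0 <= t <= T -> `|approx b t x| <= m.
Proof.
move=> tT; rewrite /approx /step /trace; case: ifP => _; first exact: ym.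
(* At t = T the index of the cell is n + 1, one more than in the open cells.
   *)
have [|tT'] := ltP t T.
  move=> tT'; case: (@gridP (Num.truncn (t / eta))) => //.
  apply: leqW; apply: (@cell_lt _ t) => //; last by case/andP: tT.
  have /andP[t0 _] := tT.
  have /andP[h1 h2] := Num.Theory.truncn_itv (divr_ge0 t0 (ltW eta0)).
  by rewrite -ler_pdivlMr.
have -> : t = T by apply/eqP; rewrite eq_le tT' andbT; case/andP: tT.
have -> : T / eta = n.+1%:R by rewrite /eta invf_div mulrCA divff ?mulr1// gt_eqF.
by rewrite Num.Theory.natrK; case: (@gridP n.+1).
Qed.

Lemma approx_bnd b t : 0 <= t <= T -> approx b t 0 = y b t.
Proof.
move=> tT; have [k [kn kt tk]] := cellP tT.
rewrite (approx_cell b kt tk) ?lexx//= /step /trace.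
rewrite mulr_ge0 ?subr_ge0// ?(le_trans (ltW c0))//.
by congr y; rewrite mul0r subr0; ring.
Qed.

Lemma approx_ini b x : 0 <= x <= 1 -> approx b 0 x = w0 b x.
Proof.
move=> x01; have /andP[x0 x1] := x01.
rewrite (@approx_cell 0%N)//; last 2 first.
- by rewrite mul0r.
- by rewrite mul1r ltW.
rewrite /step /trace mul0r subr0 mul0r subr0 addr0; case: ifP => [x0'|_].
  have -> : x = 0 by apply/eqP; rewrite eq_le x0 x0'.
  by rewrite mul0r subr0 yw.
by rewrite /= clamp_id.
Qed.

Definition scheme_const := L * (1 + 2 * M2 * (L * (1 + M)) * (1 + M) + M / T).

(** Inside a cell the approximation is transported exactly with the frozen
    speed. The latter is the speed at a point whose distance to (t, x) is of
    order h + T / n, and [lip_cells] adds up the cells met by the segment. *)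
Lemma approx_transported b : transported c M T scheme_const (T / n.+1%:R) (speed Lam approx b) (approx b).
Proof.
move=> t x h be h0 ht tT x1 xb cbe; rewrite -/eta.
have /andP[cbe1 beM] := cbe.
have be0 : 0 < be by exact: lt_le_trans cbe1.
set a := speed _ _ _ _ _.
pose f s := approx b s (x - (t - s) * be).
have -> : `|approx b t x - approx b (t - h) (x - h * be)| = `|f t - f (t - h)|.
  by rewrite /f subrr mul0r subr0; congr (`|_ - approx _ _ (_ - _ * _)|); ring.
have X01 s : t - h <= s -> s <= t -> 0 <= x - (t - s) * be <= 1.
  move=> s1 s2; have : 0 <= (t - s) * be by rewrite mulr_ge0 ?subr_ge0// ltW.
  have : (t - s) * be <= h * be by rewrite ler_pM2r// lerBlDl -lerBlDr.
  move=> dh d0; apply/andP; split; last by apply: le_trans x1; rewrite gerBl.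
  by rewrite subr_ge0 (le_trans dh)// -subr_ge0.
have Lt0 : 0 <= L * (1 + M) by rewrite mulr_ge0// addr_ge0// ltW.
have M0' := ltW M0.
have -> : scheme_const * h * (h + eta + `|be - a|) = (scheme_const * (h + eta + `|be - a|)) * (t - (t - h)) by ring.
apply: (@lip_cells _ f eta (t - h) t) => //; [by rewrite subr_ge0| |by rewrite gerBl].
move=> k s u s1 su ut ks uk.
have [->|sNu] := eqVneq u s; first by rewrite !subrr normr0 mulr0.
have kn : (k <= n)%N.
  by apply: (@cell_lt _ s) => //; [exact: le_trans (le_trans su ut) tT|rewrite (lt_le_trans _ (le_trans ut tT))// lt_neqAle eq_sym sNu].
have gk := gridP (leqW kn); have [gl gm g0] := gk.
set X := x - (t - u) * be; set X' := x - (t - s) * be.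
have u1 : t - h <= u := le_trans s1 su.
have X01u : 0 <= X <= 1 by exact: X01.
have X01s : 0 <= X' <= 1 by apply: X01 => //; exact: le_trans ut.
have s2 : s <= k.+1%:R * eta := le_trans su uk.
have u2 : k%:R * eta <= u := le_trans ks su.
rewrite /f -/X -/X' (approx_cell b u2 uk)// (approx_cell b ks s2)//.
rewrite /step; set bk := Lam _ _ _; set bk' := Lam _ _ _.
set g := grid k b; set tau := k%:R * eta.
have bk0 : 0 < bk by exact: lt_le_trans (Lamc _ _ _).
have us0 : 0 <= u - s by rewrite subr_ge0.
have LLk : LL k <= L by rewrite LLle// leqW.
rewrite (@trace_shift (y b) g tau (u - tau) (u - s) X bk bk0) (_ : u - tau - (u - s) = s - tau); last by ring.
have e1 := @trace_lipx (y b) g tau L0 (LL k) L00 (LL0 k) (yl b) (gl b) (g0 b) (s - tau) (X - (u - s) * bk) X' bk (Lamc _ _ _).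
have stau : 0 <= s - tau by rewrite subr_ge0.
have X0' : 0 <= X' by case/andP: X01s.
have e2 := @trace_lipb (y b) g tau L0 (LL k) L00 (LL0 k) (yl b) (gl b) (g0 b) (s - tau) X' bk bk' stau X0' (Lamc _ _ _) (Lamc _ _ _).
apply: (le_trans (ler_distD (trace (y b) g tau (s - tau) X' bk) _ _)).
have XX : X - X' = (u - s) * be by rewrite /X /X'; ring.
have e3 : `|bk - bk'| <= T^-1 * (M * (u - s)).
  apply: le_trans (Lamlip _ _ _ _ _) _.
  have := gl b X X'; have := gl (~~ b) (1 - X) (1 - X').
  rewrite (_ : 1 - X - (1 - X') = - (X - X')) ?normrN; last by ring.
  rewrite XX (ger0_norm (x := (u - s) * be)) ?mulr_ge0 ?(ltW be0)// => h1 h2.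
  have h3 : LL k * ((u - s) * be) <= L * ((u - s) * M).
    apply: ler_pM => //; first by apply: mulr_ge0 => //; exact: ltW.
    exact: ler_wpM2l.
  apply: (@le_trans _ _ (M2 * (2 * (L * ((u - s) * M))))).
    by rewrite ler_wpM2l// mulr2n mulrDl mul1r lerD//; [exact: le_trans h2 h3|exact: le_trans h1 h3].
  have : 2 * M2 * L * ((u - s) * M) <= T^-1 * ((u - s) * M) by rewrite ler_wpM2r// mulr_ge0.
  lra.
have tauT : tau <= t := le_trans u2 ut.
have tau01 : 0 <= tau <= T by rewrite mulr_ge0 ?(ltW eta0)// (le_trans tauT).
have gapp b' z : 0 <= z <= 1 -> grid k b' z = approx b' tau z.
  move=> z01; have /andP[z0 z1] := z01.
  have h1 : k%:R * eta <= tau by [].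
  have h2 : tau <= k.+1%:R * eta by apply: ler_wpM2r; [exact: ltW|rewrite ler_nat].
  rewrite (approx_cell b' h1 h2)//.
  rewrite subrr /step /trace mul0r subr0; case: ifP => // z0'.
  have -> : z = 0 by apply/eqP; rewrite eq_le z0 z0'.
  by rewrite g0 mul0r subr0 addr0.
have x0 : 0 <= x by rewrite (le_trans (mulr_ge0 h0 (ltW be0)))// -subr_ge0.
have e4 : `|bk - a| <= 2 * M2 * (L * (1 + M)) * ((1 + M) * (h + eta)).
  have X1' : 0 <= 1 - X <= 1 by exact: reflect01.
  rewrite /bk /a /speed (gapp b X)// (gapp (~~ b) (1 - X))//.
  apply: le_trans (Lamlip _ _ _ _ _) _.
  have t01 : 0 <= t <= T by rewrite (le_trans h0 ht).
  have x01 : 0 <= x <= 1 by rewrite x0.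
  have x01' : 0 <= 1 - x <= 1 by exact: reflect01.
  have := approx_lip2 b tau01 t01 X01u x01; have := approx_lip2 (~~ b) tau01 t01 X1' x01'.
  rewrite (_ : 1 - X - (1 - x) = - (X - x)) ?normrN; last by ring.
  have d1 : `|tau - t| <= h + eta.
    have := uk; rewrite -(natr1 k) mulrDl mul1r -/tau addrC => uk'.
    rewrite distrC ger0_norm ?subr_ge0// lerBlDr -addrA -lerBlDl.
    exact: le_trans u1 uk'.
  have d2 : `|X - x| <= M * (h + eta).
    rewrite /X (_ : _ - x = - ((t - u) * be)); last by ring.
    rewrite normrN ger0_norm ?mulr_ge0 ?subr_ge0 ?(ltW be0)// mulrC.
    apply: ler_pM => //; [exact: ltW|by rewrite subr_ge0|].
    by rewrite lerBlDl -lerBlDr opprD addrA (le_trans _ u1)// gerBl ltW.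
  have d3 : L * M * `|tau - t| + L * `|X - x| <= L * (1 + M) * ((1 + M) * (h + eta)).
    have heta : 0 <= h + eta by rewrite addr_ge0// ltW.
    have : L * M * `|tau - t| <= L * M * (h + eta) by rewrite ler_wpM2l// mulr_ge0.
    have : L * `|X - x| <= L * (M * (h + eta)) by rewrite ler_wpM2l.
    have : 0 <= L * (1 + M * M) * (h + eta) by rewrite mulr_ge0// mulr_ge0// addr_ge0// mulr_ge0.
    lra.
  move=> h1 h2; apply: (@le_trans _ _ (M2 * (2 * (L * (1 + M) * ((1 + M) * (h + eta)))))); last by rewrite le_eqVlt; apply/orP; left; apply/eqP; ring.
  by rewrite ler_wpM2l// mulr2n mulrDl mul1r lerD//; [exact: le_trans h2 d3|exact: le_trans h1 d3].
have e5 : `|bk - be| <= `|be - a| + 2 * M2 * (L * (1 + M)) * ((1 + M) * (h + eta)).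
  by apply: le_trans (ler_distD a bk be) _; rewrite (distrC a be) addrC lerD2l.
have XX' : X - (u - s) * bk - X' = (u - s) * (be - bk) by rewrite /X /X'; ring.
move: e1; rewrite XX' normrM (ger0_norm us0) (distrC be) => e1.
have f1 : LL k * ((u - s) * `|bk - be|) <= L * ((u - s) * (`|be - a| + 2 * M2 * (L * (1 + M)) * ((1 + M) * (h + eta)))).
  apply: ler_pM => //; first exact: mulr_ge0.
  exact: ler_wpM2l.
have seta : s - tau <= eta by move: s2; rewrite -(natr1 k) mulrDl mul1r -/tau addrC lerBlDr.
have f2 : LL k * (s - tau) * `|bk - bk'| <= L * (h + eta) * (T^-1 * (M * (u - s))).
  apply: ler_pM => //; first exact: mulr_ge0.
  by apply: ler_pM => //; apply: le_trans seta _; rewrite lerDr.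
have f3 : 0 <= L * (2 * M2 * (L * (1 + M)) * (1 + M) + M / T) * `|be - a| * (u - s).
  have ? : 0 <= T^-1 by rewrite invr_ge0 ltW.
  by rewrite !mulr_ge0// addr_ge0// ?mulr_ge0// ?addr_ge0.
have heta : 0 <= h + eta by rewrite addr_ge0// ltW.
have f4 : 0 <= L * (h + eta) * (u - s) by apply: mulr_ge0 => //; exact: mulr_ge0.
rewrite /scheme_const; lra.
Qed.
End Steps.
End Scheme.

(** * Existence and uniqueness of transported pairs *)

Section Limit.
Context {R : realType}.

Lemma cauchy_rate (u : nat -> R) (D : R) :
  (forall n k, `|u n - u k| <= D / n.+1%:R + D / k.+1%:R) -> exists l, forall n, `|u n - l| <= D / n.+1%:R.
Proof.
move=> H; pose E := [set u n - D / n.+1%:R | n in [set: nat]].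
have ub k : ubound E (u k + D / k.+1%:R).
  move=> _ [n _ <-]; have := H n k; rewrite ler_norml => /andP[_].
  move: (D / n.+1%:R) (D / k.+1%:R) => p q; lra.
have hs : has_sup E by split; [exists (u 0%N - D / 1%:R), 0%N|exists (u 0%N + D / 1%:R)].
exists (sup E) => n.
have h1 : u n - D / n.+1%:R <= sup E by apply: ub_le_sup; [case: hs|exists n].
have h2 : sup E <= u n + D / n.+1%:R by apply: ge_sup; [case: hs|exact: ub].
by rewrite ler_norml; move: h1 h2; move: (n.+1%:R^-1) => r; lra.
Qed.

Lemma transportedW c M T A A' del (a w : R -> R -> R) : 0 <= del -> A <= A' ->
  transported c M T A del a w -> transported c M T A' del a w.
Proof.
move=> d0 AA H t x h be h0 ht tT x1 xb cb; apply: le_trans (H t x h be h0 ht tT x1 xb cb) _.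
by rewrite ler_wpM2r ?addr_ge0// ler_wpM2r.
Qed.

Variables (Lam : bool -> R -> R -> R) (c M M2 : R).
Hypothesis c0 : 0 < c.
Hypothesis Lamc : forall b p q, c <= Lam b p q.
Hypothesis LamM : forall b p q, Lam b p q <= M.
Hypothesis M20 : 0 <= M2.
Hypothesis Lamlip : forall b p q p' q', `|Lam b p q - Lam b p' q'| <= M2 * (`|p - p'| + `|q - q'|).
Let M0 : 0 < M. Proof. by apply: (lt_le_trans c0); apply: le_trans (Lamc true 0 0) (LamM _ _ _). Qed.

Lemma transported_unique T A A' Lt Lx Lt' Lx' (w w' : bool -> R -> R -> R) :
  0 <= A -> 0 <= Lt -> 0 <= Lt' ->
  (forall b, lip2 T Lt Lx (w b)) -> (forall b, lip2 T Lt' Lx' (w' b)) ->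
  (forall b, transported c M T A 0 (speed Lam w b) (w b)) ->
  (forall b, transported c M T A' 0 (speed Lam w' b) (w' b)) ->
  (forall b x, 0 <= x <= 1 -> w b 0 x = w' b 0 x) ->
  (forall b t, 0 <= t <= T -> w b t 0 = w' b t 0) ->
  forall b t x, 0 <= t <= T -> 0 <= x <= 1 -> w b t x = w' b t x.
Proof.
move=> A0 Lt0 Lt0' wl wl' wt wt' ini bnd b t x t01 x01.
have AA : A <= Num.max A A' by rewrite le_max lexx.
have AA' : A' <= Num.max A A' by rewrite le_max lexx orbT.
have := @compare R Lam c M M2 c0 Lamc LamM M20 Lamlip T (Num.max A A') Lt Lx Lt' Lx' 0 0 w w' (le_trans A0 AA) Lt0 Lt0' (lexx _) (lexx _) wl wl' (fun b => transportedW (lexx _) AA (wt b)) (fun b => transportedW (lexx _) AA' (wt' b)) ini bnd t t01 b x x01.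
by rewrite addr0 mul0r normr_le0 subr_eq0 => /eqP.
Qed.

Variables (T L0 m : R) (y w0 : bool -> R -> R).
Hypothesis T0 : 0 < T.
Hypothesis L00 : 0 <= L0.
Let L := expR 1 * L0.
Hypothesis LT : 2 * M2 * L <= T^-1.
Hypothesis yl : forall b t t', `|y b t - y b t'| <= c * L0 * `|t - t'|.
Hypothesis wl : forall b x x', `|w0 b x - w0 b x'| <= L0 * `|x - x'|.
Hypothesis yw : forall b, w0 b 0 = y b 0.
Hypothesis ym : forall b t, `|y b t| <= m.
Hypothesis wm : forall b x, `|w0 b x| <= m.

Let LL0 : 0 <= L. Proof. by rewrite mulr_ge0// expR_ge0. Qed.
Let LLM : 0 <= L * M. Proof. by rewrite mulr_ge0// ltW. Qed.

Let u n := approx Lam T y w0 n.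
Let A := scheme_const M M2 T L0.
Let A0 : 0 <= A.
Proof. by rewrite /A /scheme_const -/L mulr_ge0// addr_ge0 ?divr_ge0 ?(ltW M0) ?(ltW T0)// addr_ge0// mulr_ge0 ?addr_ge0 ?(ltW M0)// mulr_ge0 ?mulr_ge0// addr_ge0// ltW. Qed.

(** The approximations with n and k steps are transported with slacks T / n and
    T / k, so [compare] makes them a Cauchy sequence with an explicit rate; all
    the estimates pass to the limit. *)
Lemma transported_existence : exists w : bool -> R -> R -> R,
  [/\ forall b, lip2 T (L * M) L (w b),
      forall b, transported c M T A 0 (speed Lam w b) (w b),
      forall b t x, 0 <= t <= T -> 0 <= x <= 1 -> `|w b t x| <= m,
      forall b t, 0 <= t <= T -> w b t 0 = y b t &
      forall b x, 0 <= x <= 1 -> w b 0 x = w0 b x].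
Proof.
have ul n b : lip2 T (L * M) L (u n b).
  exact: (approx_lip2 c0 Lamc LamM M20 Lamlip T0 L00 LT yl wl yw ym wm).
have ut n b : transported c M T A (T / n.+1%:R) (speed Lam (u n) b) (u n b).
  exact: (approx_transported c0 Lamc LamM M20 Lamlip T0 L00 LT yl wl yw ym wm).
have uini n b x : 0 <= x <= 1 -> u n b 0 x = w0 b x.
  by move=> h; apply: (@approx_ini R Lam c).
have ubnd n b t : 0 <= t <= T -> u n b t 0 = y b t.
  by move=> h; apply: (@approx_bnd R Lam c).
have um n b t x : 0 <= t <= T -> `|u n b t x| <= m.
  exact: (approx_le c0 Lamc M20 Lamlip T0 L00 LT yl wl yw ym wm).
pose B := A * (2 + 2 * M2 * (1 + L * M + L * M)).
pose D := T * expR (B * T).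
have D0 : 0 <= D by rewrite mulr_ge0 ?expR_ge0// ltW.
have uc b t x n k : 0 <= t <= T -> 0 <= x <= 1 -> `|u n b t x - u k b t x| <= D / n.+1%:R + D / k.+1%:R.
  move=> t01 x01.
  have Tn j : 0 <= T / j.+1%:R by rewrite divr_ge0// ltW.
  have ini b' x' : 0 <= x' <= 1 -> u n b' 0 x' = u k b' 0 x' by move=> h; rewrite !uini.
  have bnd b' t' : 0 <= t' <= T -> u n b' t' 0 = u k b' t' 0 by move=> h; rewrite !ubnd.
  have := @compare R Lam c M M2 c0 Lamc LamM M20 Lamlip T A (L * M) L (L * M) L _ _ (u n) (u k) A0 LLM LLM (Tn n) (Tn k) (ul n) (ul k) (ut n) (ut k) ini bnd t t01 b x x01.
  move=> /le_trans; apply; rewrite -/B /D le_eqVlt; apply/orP; left; apply/eqP; ring.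
have ex b t x : exists l, 0 <= t <= T -> 0 <= x <= 1 -> forall n, `|u n b t x - l| <= D / n.+1%:R.
  have [t01|nt] := boolP (0 <= t <= T); last by exists 0.
  have [x01|nx] := boolP (0 <= x <= 1); last by exists 0.
  by have [l lP] := cauchy_rate (fun n k => uc b t x n k t01 x01); exists l.
pose w b t x := projT1 (cid (ex b t x)).
have wP b t x n : 0 <= t <= T -> 0 <= x <= 1 -> `|u n b t x - w b t x| <= D / n.+1%:R.
  by move=> h1 h2; rewrite /w; case: cid => l /=; exact.
have wd b t x t' x' n : 0 <= t <= T -> 0 <= x <= 1 -> 0 <= t' <= T -> 0 <= x' <= 1 ->
  `|w b t x - w b t' x'| <= `|u n b t x - u n b t' x'| + (2 * D) / n.+1%:R.
  move=> h1 h2 h3 h4; have := wP b t x n h1 h2; have := wP b t' x' n h3 h4.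
  have := ler_distD (u n b t x) (w b t x) (w b t' x').
  have := ler_distD (u n b t' x') (u n b t x) (w b t' x').
  rewrite (distrC (w b t x) (u n b t x)); move: (n.+1%:R^-1) => r; lra.
exists w; split.
- move=> b t t' x x' h1 h2 h3 h4; apply: (@le_archi _ _ _ (2 * D)) => n.
  by apply: le_trans (wd _ _ _ _ _ n h1 h3 h2 h4) _; rewrite lerD2r; exact: ul.
- move=> b t x h be h0 ht tT x1 xb cb.
  have /andP[cb1 cb2] := cb; have be0 := lt_le_trans c0 cb1.
  have hb : 0 <= h * be by rewrite mulr_ge0// ltW.
  have t01 : 0 <= t <= T by lra.
  have t01' : 0 <= t - h <= T by lra.
  have x01 : 0 <= x <= 1 by lra.
  have x01' : 0 <= x - h * be <= 1 by lra.
  have x1x : 0 <= 1 - x <= 1 by lra.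
  apply: (@le_archi _ _ _ (2 * D + A * h * (T + 2 * M2 * D))) => n.
  apply: le_trans (wd _ _ _ _ _ n t01 x01 t01' x01') _.
  have := ut n b t x h be h0 ht tT x1 xb cb.
  have : `|speed Lam (u n) b t x - speed Lam w b t x| <= 2 * M2 * D / n.+1%:R.
    apply: le_trans (Lamlip _ _ _ _ _) _.
    have := wP b t x n t01 x01; have := wP (~~ b) t (1 - x) n t01 x1x => h1 h2.
    have : M2 * (`|u n b t x - w b t x| + `|u n (~~ b) t (1 - x) - w (~~ b) t (1 - x)|) <= M2 * (D / n.+1%:R + D / n.+1%:R).
      by rewrite ler_wpM2l// lerD.
    move: (n.+1%:R^-1) => r; lra.
  move=> h1 h2.
  have h3 : `|be - speed Lam (u n) b t x| <= `|be - speed Lam w b t x| + 2 * M2 * D / n.+1%:R.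
    have := ler_distD (speed Lam w b t x) be (speed Lam (u n) b t x).
    rewrite (distrC (speed Lam w b t x)); move: h1; move: (n.+1%:R^-1) => r; lra.
  have : A * h * (h + T / n.+1%:R + `|be - speed Lam (u n) b t x|) <= A * h * (h + T / n.+1%:R + (`|be - speed Lam w b t x| + 2 * M2 * D / n.+1%:R)).
    by apply: ler_wpM2l; [exact: mulr_ge0|rewrite lerD2l].
  move: h2; move: (n.+1%:R^-1) => r; lra.
- move=> b t x h1 h2; apply: (@le_archi _ _ _ D) => n.
  have := wP b t x n h1 h2; have := um n b t x h1.
  have := ler_normD (w b t x - u n b t x) (u n b t x).
  rewrite subrK distrC; move: (n.+1%:R^-1) => r; lra.
- move=> b t h1; apply/eqP; rewrite -subr_eq0 -normr_le0; apply: (@le_archi _ _ _ D) => n.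
  by rewrite add0r -(ubnd n b t h1) distrC; apply: wP => //; rewrite lexx ler01.
- move=> b x h1; apply/eqP; rewrite -subr_eq0 -normr_le0; apply: (@le_archi _ _ _ D) => n.
  by rewrite add0r -(uini n b x h1) distrC; apply: wP => //; rewrite lexx (ltW T0).
Qed.
End Limit.

(** * Integration on the plane *)

Section Plane.
Context {R : realType}.
Local Notation mu1 := (@lebesgue_measure R).
Implicit Types (f g : R * R -> R) (p q : R * R).

(** Boxes with rational corners form a countable base. *)
Lemma open_measurable2 (O : set (R * R)) : open O -> measurable O.
Proof.
move=> oO.
pose box (r1 r2 r3 r4 : rat) : set (R * R) := `]ratr r1, ratr r2[%classic `*` `]ratr r3, ratr r4[%classic.
pose F r1 r2 r3 r4 := if `[< box r1 r2 r3 r4 `<=` O >] then box r1 r2 r3 r4 else set0.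
have -> : O = \bigcup_r1 \bigcup_r2 \bigcup_r3 \bigcup_r4 F r1 r2 r3 r4.
  apply/seteqP; split => [[a b] Oab|p [r1 _ [r2 _ [r3 _ [r4 _]]]]]; last first.
    by rewrite /F; case: asboolP => // bO /bO.
  have : nbhs (a, b) O by exact: open_nbhs_nbhs.
  move=> [[A B]] /= [[e1 /= e10 Ae1] [e2 /= e20 Be2]] AB.
  have : a - e1 < a by rewrite ltrBlDr ltrDl.
  move=> /rat_in_itvoo[r1]; rewrite inE/= => r1h; have r1l : a - e1 < ratr r1 by rewrite (itvP r1h).
  have r1r : ratr r1 < a by rewrite (itvP r1h).
  have : a < a + e1 by rewrite ltrDl.
  move=> /rat_in_itvoo[r2]; rewrite inE/= => r2h; have r2l : a < ratr r2 by rewrite (itvP r2h).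
  have r2r : ratr r2 < a + e1 by rewrite (itvP r2h).
  have : b - e2 < b by rewrite ltrBlDr ltrDl.
  move=> /rat_in_itvoo[r3]; rewrite inE/= => r3h; have r3l : b - e2 < ratr r3 by rewrite (itvP r3h).
  have r3r : ratr r3 < b by rewrite (itvP r3h).
  have : b < b + e2 by rewrite ltrDl.
  move=> /rat_in_itvoo[r4]; rewrite inE/= => r4h; have r4l : b < ratr r4 by rewrite (itvP r4h).
  have r4r : ratr r4 < b + e2 by rewrite (itvP r4h).
  exists r1 => //; exists r2 => //; exists r3 => //; exists r4 => //.
  rewrite /F asboolT; first by split; rewrite /= in_itv/= ?r1r ?r3r ?r2l ?r4l.
  move=> [x y] [] /=; rewrite !in_itv/= => /andP[x1 x2] /andP[y1 y2].
  apply: (AB (x, y)); split => /=.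
    by apply: Ae1; rewrite /= ltr_norml; lra.
  by apply: Be2; rewrite /= ltr_norml; lra.
do 4 (apply: bigcupT_measurable_rat => ?).
rewrite /F; case: ifP => _; last exact: measurable0.
by apply: measurableX; exact: measurable_itv.
Qed.

Lemma continuous_measurable2 f : continuous f -> measurable_fun setT f.
Proof.
move=> cf _; apply: (measurability _ (measurable_realfun.RGenOInfty.measurableE R)) => //.
move=> _ [_ [a ->] <-]; rewrite setTI.
apply: open_measurable2.
have -> : `]a, +oo[%classic = [set x : R | a < x] by apply/seteqP; split => x /=; rewrite in_itv/= andbT.
by move: cf => /continuousP; apply; exact: open_gt.
Qed.

Lemma M_Lipschitz_continuous (L : R) f : M_Lipschitz L setT f -> continuous f.
Proof.
move=> fL [t x]; apply/cvgrPdist_le => e e0.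
pose d := e / (2 * (`|L| + 1)).
have L0 : 0 < 2 * (`|L| + 1) by rewrite mulr_gt0// ltr_pwDr.
have d0 : 0 < d by rewrite divr_gt0.
exists ([set y | `|t - y| < d], [set y | `|x - y| < d]); first by split; exists d.
move=> [t' x'] [/= h1 h2]; apply: le_trans (fL (t, x) (t', x') I I) _ => /=.
have : L <= `|L| + 1 by rewrite (le_trans (ler_norm _))// lerDl.
have dE : e = (`|L| + 1) * (d + d) by rewrite /d; field; rewrite gt_eqF// ltr_pwDr.
move=> LL; rewrite dE; apply: (@le_trans _ _ ((`|L| + 1) * (`|t - t'| + `|x - x'|))).
  by rewrite ler_wpM2r.
rewrite ler_wpM2l//; last by rewrite lerD// ltW.
Qed.

Definition square (N : R) : set (R * R) := `[- N, N]%classic `*` `[- N, N]%classic.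
Lemma measurable_square N : measurable (square N).
Proof. by apply: measurableX; exact: measurable_itv. Qed.
Lemma leb2_square N : (@leb2 R (square N) < +oo)%E.
Proof.
rewrite /leb2 product_measure1E; [|exact: measurable_itv|exact: measurable_itv].
have h : mu1 `[- N, N]%classic \is a fin_num.
  by rewrite lebesgue_measure_itv/=; case: ifP => _ //; rewrite -EFinB.
by move: h; rewrite ltey_eq => h; rewrite fin_numM.
Qed.

(** Functions of this class are integrable, and the class is stable under all
    the operations performed below, so that no separate integrability condition
    has to be carried along. *)
Definition bsq f := measurable_fun setT f /\ exists N B, forall p, `|f p| <= B * \1_(square N) p.

Lemma bsq_integrable0 f N B : measurable_fun setT f -> (forall p, `|f p| <= B * \1_(square N) p) ->
  (@leb2 R).-integrable setT (EFin \o f).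
Proof.
move=> mf fB.
have : (@leb2 R).-integrable (square N) (EFin \o f).
  apply: measurable_bounded_integrable; [exact: measurable_square|exact: leb2_square| |].
    exact: measurable_funS mf.
  exists `|B|; split => // M BM p /= sp; apply: le_trans (fB p) _.
  by rewrite indicE mem_set// mulr1 (le_trans (ler_norm _))// ltW.
have msq := measurable_square N.
move=> h; have := (@integrable_mkcond _ (measurableTypeR R * measurableTypeR R)%type R (@leb2 R) _ (EFin \o f) msq).1 h.
apply: eq_integrable => // p _; rewrite /= /restrict/=.
case: ifPn => // /negP pN; congr EFin; apply/esym/eqP; rewrite -normr_le0.
by have := fB p; rewrite indicE; move/negP/negbTE: pN => ->; rewrite mulr0.
Qed.

Lemma bsq_integrable f : bsq f -> (@leb2 R).-integrable setT (EFin \o f).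
Proof. by move=> [mf [N [B fB]]]; exact: bsq_integrable0 fB. Qed.

Lemma dct2 (F : nat -> R * R -> R) f N B :
  (forall n, measurable_fun setT (F n)) -> measurable_fun setT f ->
  (forall n p, `|F n p| <= B * \1_(square N) p) ->
  {ae @leb2 R, forall p, (F ^~ p) n @[n --> \oo] --> f p} ->
  \int[leb2]_(p in setT) F n p @[n --> \oo] --> \int[leb2]_(p in setT) f p.
Proof.
move=> mF mf FB Ff.
have ig : (@leb2 R).-integrable setT (EFin \o (fun p => B * \1_(square N) p)).
  apply: (@bsq_integrable0 _ N `|B|).
    by apply: measurable_funM => //; apply: measurable_indic; exact: measurable_square.
  by move=> p; rewrite normrM [X in _ * X]ger0_norm.
have := @dominated_convergence _ _ R (@leb2 R) setT measurableT (fun n => EFin \o F n) (EFin \o f) _ _ _ _ ig _.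
case.
- by move=> n; apply/measurable_EFinP; exact: mF.
- by apply/measurable_EFinP; exact: mf.
- apply: aeS Ff => p Fp _ /=; apply: cvg_comp; [exact: Fp|exact: cvg_refl].
- by apply/aeW => p n _ /=; rewrite lee_fin.
move=> fi _ c.
apply: fine_cvg; rewrite fineK.
  exact c.
exact: (@integrable_fin_num _ (measurableTypeR R * measurableTypeR R)%type R (@leb2 R) _ _ _ fi).
Qed.

Local Notation P2 := (measurableTypeR R * measurableTypeR R)%type.
Local Notation m2 := (@leb2 R).

Lemma leb_shift (h : R) (A : set R) : measurable A -> mu1 [set x | A (x + h)] = mu1 A.
Proof.
move=> mA; have mf : measurable_fun [set: R] (fun x : R => x + h).
  by apply: measurable_funD.
pose m : {measure set (measurableTypeR R) -> \bar R} :=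
  @measure_function_pushforward__canonical__measure_function_Measure _ _ (measurableTypeR R) (measurableTypeR R) R mu1 (fun x : R => x + h) mf.
rewrite [RHS](@lebesgue_measure_unique R m)// => X [[a b] _ <-].
rewrite /m /= /pushforward (_ : _ @^-1` _ = `]a - h, b - h]%classic); last first.
  by apply/seteqP; split => x /=; rewrite !in_itv/= ltrBlDr lerBrDr.
rewrite !lebesgue_measure_itv/= !lte_fin ltrD2r; case: ifP => // _.
by rewrite -!EFinB; congr EFin; ring.
Qed.

Lemma measurable_shift2 (v : R * R) : measurable_fun [set: R * R] (fun p : R * R => (p.1 + v.1, p.2 + v.2)).
Proof.
apply: measurable_fun_pair.
  exact: (measurable_funD measurable_fst (measurable_cst v.1)).
exact: (measurable_funD measurable_snd (measurable_cst v.2)).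
Qed.

Lemma leb2_shift (v : R * R) (A : set (R * R)) : measurable A -> m2 [set p | A (p.1 + v.1, p.2 + v.2)] = m2 A.
Proof.
move=> mA; pose sh (p : R * R) : R * R := (p.1 + v.1, p.2 + v.2).
have mf : measurable_fun [set: R * R] sh := measurable_shift2 v.
pose m : {measure set P2 -> \bar R} :=
  @measure_function_pushforward__canonical__measure_function_Measure _ _ P2 P2 R m2 sh mf.
rewrite [RHS](@product_measure_unique _ _ _ _ R mu1 mu1 m)// => X Y mX mY.
rewrite /m /= /pushforward.
rewrite (_ : _ @^-1` _ = [set x | X (x + v.1)] `*` [set x | Y (x + v.2)]); last first.
  by apply/seteqP; split => -[x y].
have ms (Z : set R) (h : R) : measurable Z -> measurable [set x | Z (x + h)].
  move=> mZ; rewrite -[X in measurable X]setTI.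
  have mh : measurable_fun [set: R] (fun x : R => x + h) by apply: measurable_funD.
  by apply: mh.
rewrite /leb2 product_measure1E; [|exact: (ms X)|exact: (ms Y)].
exact (congr2 (fun a b => a * b)%E (leb_shift v.1 mX) (leb_shift v.2 mY)).
Qed.

Definition line (i : bool) (p : R * R) (s : R) : R * R := if i then (p.1, s) else (s, p.2).

(** Tonelli's theorem. *)
Lemma null_lines i (N : set (R * R)) : measurable N ->
  (forall p, mu1.-negligible [set s | N (line i p s)]) -> m2 N = 0%E.
Proof.
move=> mN HN; case: i HN => HN.
  rewrite /leb2 /product_measure1 integral0_eq// => t _ /=.
  have := HN (t, 0); rewrite /line/= => -[B [mB B0 sB]].
  apply/eqP; rewrite eq_le measure_ge0 andbT -B0 le_measure ?inE//.
    exact: (@measurable_xsection _ _ (measurableTypeR R) (measurableTypeR R)).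
  by move=> x; rewrite /xsection/= inE => /sB.
rewrite /leb2 (@product_measure_unique _ _ _ _ R mu1 mu1 (@product_measure2 _ _ (measurableTypeR R) (measurableTypeR R) R mu1 mu1))//; last first.
  by move=> A B mA mB; exact: product_measure2E.
apply: integral0_eq => t _ /=.
have := HN (0, t); rewrite /line/= => -[B [mB B0 sB]].
apply/eqP; rewrite eq_le measure_ge0 andbT -B0 le_measure ?inE//.
  exact: (@measurable_ysection _ _ (measurableTypeR R) (measurableTypeR R)).
by move=> x; rewrite /ysection/= inE => /sB.
Qed.

(** Reduces an almost everywhere convergence in the plane to the lines parallel
    to an axis, where one-variable differentiation theorems apply. The
    exceptional set is measurable, being the set where a limsup does not vanish.
    *)
Lemma ae_lines i (F : nat -> R * R -> R) f :
  (forall n, measurable_fun setT (F n)) -> measurable_fun setT f ->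
  (forall p, {ae mu1, forall s : R, F n (line i p s) @[n --> \oo] --> f (line i p s)}) ->
  {ae m2, forall p, F n p @[n --> \oo] --> f p}.
Proof.
move=> mF mf H.
pose e n p := (`|F n p - f p|)%:E.
pose E p := limn_esup (e ^~ p).
have me n : measurable_fun setT (e n).
  apply/measurable_EFinP; apply: measurableT_comp; first exact: normr_measurable.
  exact: measurable_funB.
have mE : measurable_fun setT E by exact: measurable_fun_limn_esup.
have cE p : F n p @[n --> \oo] --> f p -> E p = 0%E.
  move=> c; have : e n p @[n --> \oo] --> 0%E.
    apply: cvg_EFin; first by apply: nearW.
    apply/norm_cvg0P; rewrite -(subrr (f p)).
    by apply: cvgB => //; exact: cvg_cst.
  move=> h; rewrite /E is_cvg_limn_esupE; first exact/cvg_lim.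
  by apply/cvg_ex; exists 0%E.
have Ec p : E p = 0%E -> F n p @[n --> \oo] --> f p.
  move=> E0; have : e n p @[n --> \oo] --> 0%E.
    apply: limn_esup_le_cvg; last by move=> n; rewrite /e lee_fin.
    by move: E0; rewrite /E => ->.
  move=> /fine_cvg h; apply/subr_cvg0/norm_cvg0P.
  exact: h.
have mN : measurable [set p | E p != 0%E].
  rewrite -[X in measurable X]setTI; apply: emeasurable_neq => //.
exists [set p | E p != 0%E]; split => //.
- apply: (null_lines mN) => p; have := H p; apply: negligibleS => s /= /eqP Es h.
  by apply: Es; exact: (cE _ h).
- by move=> p /= np; apply/eqP => Ep; apply: np; exact: Ec.
Qed.

Lemma bsqS f g : bsq f -> measurable_fun setT g -> (exists C, forall p, `|g p| <= C * `|f p|) -> bsq g.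
Proof.
move=> [mf [N [B fB]]] mg [C gC]; split => //; exists N, (`|C| * B) => p.
apply: le_trans (gC p) _; rewrite -mulrA; apply: le_trans (ler_wpM2l (normr_ge0 C) (fB p)).
by rewrite ler_wpM2r// ler_norm.
Qed.

Lemma square_sub (N N' : R) : N <= N' -> square N `<=` square N'.
Proof. by move=> NN [x y] []; rewrite /square /= ?in_itv/= => /andP[? ?] /andP[? ?]; split; rewrite /= ?in_itv/=; lra. Qed.

Lemma indic_sub (A B : set (R * R)) p : A `<=` B -> \1_A p <= \1_B p :> R.
Proof.
move=> AB; rewrite !indicE ler_nat; case: (boolP (p \in A)) => //.
by rewrite inE => /AB Bp; rewrite mem_set.
Qed.

Lemma bsqP f : bsq f <-> measurable_fun setT f /\ exists N B, [/\ 0 <= N, 0 <= B & forall p, `|f p| <= B * \1_(square N) p].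
Proof.
split; last by move=> [mf [N [B [_ _ fB]]]]; split => //; exists N, B.
move=> [mf [N [B fB]]]; split => //; exists `|N|, `|B|; split => // p.
apply: le_trans (fB p) _; apply: (@le_trans _ _ (`|B| * \1_(square N) p)).
  by rewrite ler_wpM2r ?ler_norm// indicE.
rewrite ler_wpM2l//; apply: indic_sub; apply: square_sub; exact: ler_norm.
Qed.

Lemma bsqD f g : bsq f -> bsq g -> bsq (f \+ g).
Proof.
move=> /bsqP[mf [N [B [N0 B0 fB]]]] /bsqP[mg [N' [B' [N0' B0' gB]]]]; split; first exact: measurable_funD.
exists (N + N'), (B + B') => p /=; apply: le_trans (ler_normD _ _) _.
have h1 : \1_(square N) p <= \1_(square (N + N')) p :> R by apply: indic_sub; apply: square_sub; lra.
have h2 : \1_(square N') p <= \1_(square (N + N')) p :> R by apply: indic_sub; apply: square_sub; lra.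
rewrite mulrDl; apply: lerD; [apply: le_trans (fB p) _|apply: le_trans (gB p) _]; exact: ler_wpM2l.
Qed.

Lemma bsqZ (k : R) f : bsq f -> bsq (fun p => k * f p).
Proof.
move=> bf; apply: (bsqS bf); first by apply: measurable_funM => //; case: bf.
by exists `|k| => p; rewrite normrM.
Qed.

Lemma bsq_shift v f : bsq f -> bsq (fun p => f (p.1 + v.1, p.2 + v.2)).
Proof.
move=> /bsqP[mf [N [B [N0 B0 fB]]]]; split.
  apply: (@measurable_comp _ _ _ _ _ _ setT f _ (fun p : R * R => (p.1 + v.1, p.2 + v.2))) => //.
  exact: measurable_shift2.
exists (N + `|v.1| + `|v.2|), B => p; apply: le_trans (fB _) _; apply: ler_wpM2l => //.
rewrite !indicE ler_nat; case: (boolP (_ \in square N)) => //; rewrite inE => -[/=].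
rewrite ?in_itv/= => /andP[h1 h2] /andP[h3 h4]; rewrite mem_set//.
have := ler_norm v.1; have := ler_norm (- v.1); have := ler_norm v.2; have := ler_norm (- v.2); rewrite !normrN.
have := normr_ge0 v.1; have := normr_ge0 v.2.
by split; rewrite /= ?in_itv/=; lra.
Qed.

Definition I2 f := \int[leb2]_(p in setT) f p.

Lemma I2D f g : bsq f -> bsq g -> I2 (f \+ g) = I2 f + I2 g.
Proof.
move=> bf bg; rewrite /I2; apply: (@RintegralD _ P2 R m2 setT f g measurableT); exact: bsq_integrable.
Qed.
Lemma I2Z (k : R) f : bsq f -> I2 (fun p => k * f p) = k * I2 f.
Proof.
move=> bf; rewrite /I2; apply: (@RintegralZl _ P2 R m2 setT f k measurableT); exact: bsq_integrable.
Qed.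
Lemma I2_le f g : bsq f -> bsq g -> (forall p, f p <= g p) -> I2 f <= I2 g.
Proof.
move=> bf bg fg; rewrite /I2; apply: (@le_Rintegral _ P2 R m2 setT f g measurableT) => //; exact: bsq_integrable.
Qed.
Lemma I2_norm f g : bsq f -> bsq g -> (forall p, `|f p| <= g p) -> `|I2 f| <= I2 g.
Proof.
move=> bf bg fg; rewrite ler_norml; apply/andP; split.
  rewrite -mulN1r -I2Z//; apply: I2_le => //; first exact: bsqZ.
  by move=> p; have := fg p; rewrite ler_norml mulN1r => /andP[].
by apply: I2_le => // p; apply: le_trans (fg p); exact: ler_norm.
Qed.
Lemma I2_shift v f : bsq f -> I2 (fun p => f (p.1 + v.1, p.2 + v.2)) = I2 f.
Proof.
move=> bf; have mf : measurable_fun setT (EFin \o f) by apply/measurable_EFinP; case: bf.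
pose sh (p : R * R) : R * R := (p.1 + v.1, p.2 + v.2).
have msh : measurable_fun [set: R * R] sh := measurable_shift2 v.
rewrite /I2 /Rintegral; congr fine.
have := @integral_pushforward _ _ P2 P2 R sh msh m2 setT (EFin \o f) mf (bsq_integrable (bsq_shift v bf)) measurableT.
move=> <-.
apply: eq_measure_integral => A mA _.
exact: leb2_shift.
Qed.
End Plane.

(** * Weak partial derivatives of Lipschitz functions *)

Section Weak.
Context {R : realType}.
Implicit Types (f g u phi : R * R -> R) (p q : R * R).

Lemma derive_seq (f : R -> R) (x d : R) (h : nat -> R) :
  is_derive x (1 : R) f d -> h n @[n --> \oo] --> 0 -> (forall n, h n != 0) ->
  (f (x + h n) - f x) / h n @[n --> \oo] --> d.
Proof.
move=> [df <-] h0 hn.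
have c : h^-1 *: (f (h *: 1 + x) - f x) @[h --> 0^'] --> 'D_1 f x by exact: df.
have hd : h n @[n --> \oo] --> 0^'.
  move=> A /= A0; have h1 : \forall n \near \oo, h n != 0 -> A (h n) := h0 _ A0.
  have : \forall n \near \oo, A (h n) by apply: filterS h1 => n; apply.
  exact.
have := cvg_comp _ _ hd c; apply: cvg_trans; apply: near_eq_cvg.
by apply: nearW => n /=; rewrite /GRing.scale/= mulr1 [x + _]addrC mulrC.
Qed.

Lemma cvg_invS : (n.+1%:R^-1 : R) @[n --> \oo] --> 0.
Proof. exact: cvg_harmonic. Qed.

Definition coord (i : bool) p := if i then p.2 else p.1.
Definition axis_vec i (h : R) : R * R := if i then (0, h) else (h, 0).
Definition shift2 p v : R * R := (p.1 + v.1, p.2 + v.2).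

Lemma line_coord i p : line i p (coord i p) = p.
Proof. by case: i; case: p. Qed.
Lemma line_shift i p h : line i p (coord i p + h) = shift2 p (axis_vec i h).
Proof. by case: i; rewrite /shift2 /line /= addr0. Qed.
Lemma line_line i p s s' : line i (line i p s) s' = line i p s'.
Proof. by case: i. Qed.
Lemma coord_line i p s : coord i (line i p s) = s.
Proof. by case: i. Qed.

Lemma line_quotient i f p : (fun h : R => h^-1 *: (f (h *: dir i + p) - f p)) =
   (fun h : R => h^-1 *: (f (line i p (h *: 1 + coord i p)) - f (line i p (coord i p)))).
Proof.
apply/funext => h; rewrite line_coord; congr (_ *: (f _ - _)).
rewrite [in RHS]addrC line_shift [LHS]surjective_pairing /shift2; congr pair.
  by case: i; rewrite /= /GRing.scale/= ?mulr1 ?mulr0 addrC.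
by case: i; rewrite /= /GRing.scale/= ?mulr1 ?mulr0 addrC.
Qed.

Lemma derive_line i f p : derivable f p (dir i) ->
  is_derive (coord i p) (1 : R) (fun s => f (line i p s)) (partial i f p).
Proof.
have E := line_quotient i f p.
move=> df; apply: DeriveDef.
  by move: df; rewrite /derivable E.
by rewrite /partial /derive E.
Qed.

Lemma line_derive i f p (d : R) : is_derive (coord i p) (1 : R) (fun s => f (line i p s)) d ->
  derivable f p (dir i) /\ partial i f p = d.
Proof.
have E := line_quotient i f p.
move=> [df <-]; split.
  by rewrite /derivable E.
by rewrite /partial /derive E.
Qed.

Lemma lip_line L i u p : M_Lipschitz L setT u -> forall s s', `|u (line i p s) - u (line i p s')| <= L * `|s - s'|.
Proof.
move=> uL s s'; apply: le_trans (uL _ _ I I) _.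
by case: i; rewrite /line /= subrr normr0 ?add0r ?addr0.
Qed.

Lemma lip_shift L i u p h : M_Lipschitz L setT u -> `|u (shift2 p (axis_vec i h)) - u p| <= L * `|h|.
Proof.
move=> uL; rewrite -line_shift; have := lip_line i p uL (coord i p + h) (coord i p).
by rewrite line_coord [coord i p + h - _]addrAC subrr add0r.
Qed.

Lemma square_shift i (h N : R) p : `|h| <= 1 -> square N (shift2 p (axis_vec i h)) -> square (N + 1) p.
Proof.
rewrite ler_norml => /andP[h1 h2] [] /=; rewrite ?in_itv/= => /andP[a1 a2] /andP[a3 a4].
by split; move: a1 a2 a3 a4; rewrite /= ?in_itv/=; case: i => /=; lra.
Qed.

Lemma shift2K i (h : R) p : shift2 (shift2 p (axis_vec i h)) (axis_vec i (- h)) = p.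
Proof. by case: p => a b; case: i; rewrite /shift2 /= ?oppr0 ?addr0 addrK. Qed.

Lemma lip_ge0 L u : M_Lipschitz L setT u -> 0 <= L.
Proof.
move=> uL; have := uL (0, 0) (1, 0) I I; rewrite /= subrr normr0 addr0 sub0r normrN1 mulr1.
exact: le_trans.
Qed.

Lemma lip_square L u N q : M_Lipschitz L setT u -> square N q -> `|u q| <= `|u (0, 0)| + L * (N + N).
Proof.
move=> uL [] /=; rewrite ?in_itv/= -!ler_norml => h1 h2; have L0 := lip_ge0 uL.
have := uL q (0, 0) I I; rewrite /= !subr0.
have := ler_normD (u q - u (0, 0)) (u (0, 0)); rewrite subrK.
have : L * (`|q.1| + `|q.2|) <= L * (N + N) by rewrite ler_wpM2l// lerD.
lra.
Qed.

(** The limsup of the difference quotients is measurable, and is the partial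
    derivative wherever the latter exists; it is truncated in order to be
    bounded everywhere. *)
Lemma partial_representative L i u : M_Lipschitz L setT u ->
  exists w : R * R -> R, [/\ measurable_fun setT w, forall p, `|w p| <= L &
    forall p s d, is_derive s (1 : R) (fun s => u (line i p s)) d -> w (line i p s) = d].
Proof.
move=> uL; have L0 := lip_ge0 uL.
have cu := M_Lipschitz_continuous uL.
have mu := continuous_measurable2 cu.
pose D n p := (u (shift2 p (axis_vec i n.+1%:R^-1)) - u p) / n.+1%:R^-1.
have DL n p : `|D n p| <= L.
  by rewrite /D normrM normfV ler_pdivrMr ?normr_gt0 ?invr_neq0//; exact: lip_shift.
have mD n : measurable_fun setT (D n).
  apply: measurable_funM => //; apply: measurable_funB => //.
  apply: (@measurable_comp _ _ _ _ _ _ setT u _ (fun p => shift2 p (axis_vec i n.+1%:R^-1))) => //.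
  exact: measurable_shift2.
(* Outside the set of differentiability this is some value in [-L, L]. *)
pose w0 p := limn_sup (D ^~ p).
have mw0 : measurable_fun setT w0.
  apply: measurable_fun_limn_sup => //.
  - by move=> p _; exists L => _ [n _ <-]; exact: le_trans (ler_norm _) (DL n p).
  - move=> p _; exists (- L) => _ [n _ <-]; have := DL n p.
    by rewrite ler_norml => /andP[].
exists (fun p => Num.max (- L) (Num.min L (w0 p))); split.
- apply: measurable_maxr => //; apply: measurable_minr => //.
- move=> p; rewrite ler_norml le_max lexx /= ge_max ge_min lexx andbT.
  by rewrite (@le_trans _ _ 0) ?oppr_le0.
move=> p s d ds.
have c : D n (line i p s) @[n --> \oo] --> d.
  have := @derive_seq _ _ _ (fun n => n.+1%:R^-1) ds cvg_invS (fun n => invr_neq0 (lt0r_neq0 (ltr0Sn _ n))).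
  rewrite /D; apply: cvg_trans; apply: near_eq_cvg; apply: nearW => n.
  by rewrite -line_shift coord_line line_line.
have -> : w0 (line i p s) = d by rewrite /w0 (cvg_limn_inf_sup c).
have dL : `|d| <= L.
  rewrite -(cvg_lim (@norm_hausdorff _ _) (cvg_norm c)).
  by apply: limr_le; [apply/cvg_ex; exists `|d|; exact: cvg_norm|apply: nearW => n; exact: DL].
move: dL; rewrite ler_norml => /andP[d1 d2].
by rewrite min_r// max_r.
Qed.

Lemma bsq_loc L u f : M_Lipschitz L setT u -> bsq f -> bsq (fun p => u p * f p).
Proof.
move=> uL /bsqP[mf [N [B [N0 B0 fB]]]].
have L0 := lip_ge0 uL.
split; first by apply: measurable_funM => //; exact: continuous_measurable2 (M_Lipschitz_continuous uL).
exists N, ((`|u (0, 0)| + L * (N + N)) * B) => p; rewrite normrM -mulrA.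
have := fB p; rewrite indicE; case: (boolP (p \in square N)); last first.
  by rewrite !mulr0 normr_le0 => _ /eqP->; rewrite normr0 mulr0.
by rewrite inE !mulr1 => sp fB'; apply: ler_pM => //; exact: lip_square.
Qed.

(** Integration by parts by translation: a change of variable moves the
    difference quotient from u to phi, and both sides converge by dominated
    convergence. *)
Lemma weak_by_parts (L : R) i u (w : R * R -> R) phi (dphi : R * R -> R) (B : R) : M_Lipschitz L setT u ->
  measurable_fun setT w -> (forall p, `|w p| <= L) ->
  (forall p s d, is_derive s (1 : R) (fun s => u (line i p s)) d -> w (line i p s) = d) ->
  bsq phi -> bsq dphi ->
  (forall p h, `|phi (shift2 p (axis_vec i h)) - phi p| <= B * `|h|) ->
  (forall p, is_derive (coord i p) (1 : R) (fun s => phi (line i p s)) (dphi p)) ->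
  I2 (fun p => u p * dphi p) = - I2 (fun p => w p * phi p).
Proof.
move=> uL mw wL wd bphi bdphi phiB dphiE.
have mdphi : measurable_fun setT dphi by case: bdphi.
have L0 := lip_ge0 uL.
have cu := M_Lipschitz_continuous uL.
have mu := continuous_measurable2 cu.
have [mphi [N [C [N0 C0 phiC]]]] := (bsqP phi).1 bphi.
pose h n : R := n.+1%:R^-1.
have hn0 n : h n != 0 by rewrite invr_neq0.
have hpos n : 0 < h n by rewrite invr_gt0.
have hle1 n : h n <= 1 by rewrite invf_le1// ler1n.
pose F n p := (u (shift2 p (axis_vec i (h n))) - u p) / h n * phi p.
pose G n p := u p * ((phi (shift2 p (axis_vec i (- h n))) - phi p) / h n).
have muh (k : R) : measurable_fun setT (fun p => u (shift2 p (axis_vec i k))).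
  apply: (@measurable_comp _ _ _ _ _ _ setT u _ (fun p => shift2 p (axis_vec i k))) => //.
  exact: measurable_shift2.
have mphih (k : R) : measurable_fun setT (fun p => phi (shift2 p (axis_vec i k))).
  apply: (@measurable_comp _ _ _ _ _ _ setT phi _ (fun p => shift2 p (axis_vec i k))) => //.
  exact: measurable_shift2.
have mF n : measurable_fun setT (F n).
  apply: measurable_funM => //; apply: measurable_funM => //; exact: measurable_funB.
have mG n : measurable_fun setT (G n).
  apply: measurable_funM => //; apply: measurable_funM => //; exact: measurable_funB.
have FC n p : `|F n p| <= (L * C) * \1_(square N) p.
  rewrite normrM -mulrA; apply: ler_pM => //.
  by rewrite normrM normfV ler_pdivrMr ?normr_gt0//; exact: lip_shift.
have c1 : I2 (F n) @[n --> \oo] --> I2 (fun p => w p * phi p).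
  apply: (dct2 mF _ FC); first exact: measurable_funM.
  apply: (@ae_lines _ i) => //; first exact: measurable_funM.
  move=> p; apply: aeS (lip_derivable (lip_line i p uL)) => s ds.
  have dsE : is_derive s (1 : R) (fun s => u (line i p s)) ('D_1 (fun s => u (line i p s)) s) by exact: DeriveDef.
  rewrite (wd _ _ _ dsE); apply: cvgM; last exact: cvg_cst.
  have := @derive_seq _ _ _ h dsE cvg_invS hn0.
  by apply: cvg_trans; apply: near_eq_cvg; apply: nearW => n; rewrite -line_shift coord_line line_line.
have sqsh n p : p \notin square (N + 1) -> phi (shift2 p (axis_vec i (- h n))) = 0 /\ phi p = 0.
  move=> pn; split; apply/eqP; rewrite -normr_le0.
    apply: le_trans (phiC _) _; rewrite indicE (_ : _ \in _ = false) ?mulr0//.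
    apply/negbTE; move: pn; apply: contra; rewrite !inE; apply: square_shift.
    by rewrite normrN ger0_norm ?hle1// ltW.
  apply: le_trans (phiC _) _; rewrite indicE (_ : _ \in _ = false) ?mulr0//.
  apply/negbTE; move: pn; apply: contra; rewrite !inE; apply: square_sub; lra.
have B0 : 0 <= B by have := phiB (0, 0) 1; rewrite normr1 mulr1; exact: le_trans.
have GC n p : `|G n p| <= ((`|u (0, 0)| + L * ((N + 1) + (N + 1))) * B) * \1_(square (N + 1)) p.
  rewrite indicE; case: (boolP (p \in square (N + 1))) => pN; last first.
    by rewrite /G; have [-> ->] := sqsh n p pN; rewrite subrr mul0r mulr0 normr0 mulr0.
  rewrite mulr1 normrM; apply: ler_pM => //; first by apply: (lip_square uL); rewrite inE in pN.
  rewrite normrM normfV ler_pdivrMr ?normr_gt0//.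
  by apply: le_trans (phiB _ _) _; rewrite normrN.
have c2 : I2 (G n) @[n --> \oo] --> I2 (fun p => - (u p * dphi p)).
  apply: (dct2 mG _ GC).
    by apply: measurableT_comp => //; exact: measurable_funM.
  apply: aeW => p; rewrite -mulrN; apply: cvgM; first exact: cvg_cst.
  have h0 : - h n @[n --> \oo] --> 0 by rewrite -oppr0; apply: cvgN; exact: cvg_invS.
  have hn0' n : - h n != 0 by rewrite oppr_eq0.
  have c3 := @derive_seq _ _ _ (fun n => - h n) (dphiE p) h0 hn0'.
  rewrite (_ : (fun n => _) = (fun n => - ((phi (line i p (coord i p - h n)) - phi (line i p (coord i p))) / - h n))).
    exact: cvgN c3.
  by apply/funext => n /=; rewrite line_shift line_coord invrN mulrN opprK.
have bu1 n : bsq (fun p => u (shift2 p (axis_vec i (h n))) * phi p).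
  have -> : (fun p => u (shift2 p (axis_vec i (h n))) * phi p) =
     (fun p => u (shift2 p (axis_vec i (h n))) * phi (shift2 (shift2 p (axis_vec i (h n))) (axis_vec i (- h n)))).
    by apply/funext => p; rewrite shift2K.
  have b1 := bsq_loc uL (bsq_shift (axis_vec i (- h n)) bphi).
  exact (bsq_shift (axis_vec i (h n)) b1).
have bu2 : bsq (fun p => u p * phi p) := bsq_loc uL bphi.
have bu3 n : bsq (fun p => u p * phi (shift2 p (axis_vec i (- h n)))).
  exact (bsq_loc uL (bsq_shift (axis_vec i (- h n)) bphi)).
have E n : I2 (F n) = I2 (G n).
  have -> : F n = (fun p => (h n)^-1 * ((fun p => u (shift2 p (axis_vec i (h n))) * phi p) \+ (fun p => -1 * (u p * phi p))) p).
    by apply/funext => p; rewrite /F /=; field.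
  have -> : G n = (fun p => (h n)^-1 * ((fun p => u p * phi (shift2 p (axis_vec i (- h n)))) \+ (fun p => -1 * (u p * phi p))) p).
    by apply/funext => p; rewrite /G /=; field.
  have bm := bsqZ (-1) bu2.
  rewrite !I2Z ?I2D//; [|exact: bsqD|exact: bsqD].
  congr (_ * (_ + _)).
  rewrite -(I2_shift (axis_vec i (h n)) (bu3 n)); congr I2; apply/funext => p.
  by congr (_ * phi _); apply/esym; exact: shift2K.
have : I2 (fun p => - (u p * dphi p)) = I2 (fun p => w p * phi p).
  have c2' : I2 (F n) @[n --> \oo] --> I2 (fun p => - (u p * dphi p)).
    by rewrite (_ : (fun n => I2 (F n)) = (fun n => I2 (G n))) //; apply/funext.
  exact: (cvg_unique _ c2' c1).
have bud : bsq (fun p => u p * dphi p).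
  exact: bsq_loc uL bdphi.
have -> : (fun p => - (u p * dphi p)) = (fun p => -1 * (u p * dphi p)).
  by apply/funext => p; rewrite mulN1r.
by rewrite I2Z// mulN1r => <-; rewrite opprK.
Qed.

End Weak.

(** * From the semi-Lagrangian estimate to the weak equation *)

Section Transport.
Context {R : realType}.
Implicit Types (f g u phi : R * R -> R) (p q : R * R).

Lemma cvg_time_shift (g : R * R -> R) (t x : R) (h : nat -> R) : continuous g ->
  h n @[n --> \oo] --> 0 -> g (t + h n, x + 0) @[n --> \oo] --> g (t, x).
Proof.
move=> cg h0.
have e1 : t + h n @[n --> \oo] --> t.
  by rewrite -[X in _ --> X]addr0; apply: cvgD => //; exact: cvg_cst.
have e2 : (x + 0 : R) @[n --> \oo] --> x by rewrite addr0; exact: cvg_cst.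
have e5 : (t + h n, x + 0) @[n --> \oo] --> ((t, x) : R * R) by exact: (cvg_pair e1 e2).
exact: (cvg_comp _ _ e5 (cg (t, x))).
Qed.

(** The increment of u along (h, h a(p)) is O(h^2). It splits into a time
    increment F1, whose quotient tends to u_t, and a space increment K. The
    latter is taken on the line of time t - h, which moves with h, so that
    differentiability along it is of no use; translating the integral by h in
    time carries the shift over to a and phi, which are continuous, and leaves
    the increment of u on the fixed line of time t (this is K'). *)
Lemma transport_weak (L M : R) u a (ut ux : R * R -> R) phi :
  M_Lipschitz L setT u -> continuous a -> (forall p, `|a p| <= M) -> (forall p, a p != 0) ->
  measurable_fun setT ut -> (forall p, `|ut p| <= L) ->
  (forall p s d, is_derive s (1 : R) (fun s => u (line false p s)) d -> ut (line false p s) = d) ->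
  measurable_fun setT ux -> (forall p, `|ux p| <= L) ->
  (forall p s d, is_derive s (1 : R) (fun s => u (line true p s)) d -> ux (line true p s) = d) ->
  continuous phi -> bsq phi ->
  (forall p, phi p != 0 -> exists A h0, 0 < h0 /\ forall h, 0 < h -> h < h0 ->
     `|u p - u (p.1 - h, p.2 - h * a p)| <= A * h ^+ 2) ->
  I2 (fun p => (ut p + a p * ux p) * phi p) = 0.
Proof.
move=> uL ca aM a0 mut utL utd mux uxL uxd cphi bphi H.
have L0 := lip_ge0 uL.
have cu := M_Lipschitz_continuous uL.
have mu := continuous_measurable2 cu.
have ma := continuous_measurable2 ca.
have M0 : 0 <= M by apply: le_trans (aM (0, 0)).
have [mphi [N [C [N0 C0 phiC]]]] := (bsqP phi).1 bphi.
pose h n : R := n.+1%:R^-1.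
have hn0 n : h n != 0 by rewrite invr_neq0.
have hpos n : 0 < h n by rewrite invr_gt0.
have hle1 n : h n <= 1 by rewrite invf_le1// ler1n.
have hcv : h n @[n --> \oo] --> 0 := @cvg_invS R.
have mtr (k : R * R) g : measurable_fun setT g -> measurable_fun setT (fun p => g (shift2 p k)).
  move=> mg; apply: (@measurable_comp _ _ _ _ _ _ setT g _ (fun p => shift2 p k)) => //.
  exact: measurable_shift2.
have mback n k : measurable_fun setT (fun p => u (p.1 - k, p.2 - h n * a (p.1 + (h n - k), p.2 + 0))).
  apply: (@measurable_comp _ _ _ _ _ _ setT u _ (fun p => (p.1 - k, p.2 - h n * a (p.1 + (h n - k), p.2 + 0)))) => //.
  apply: measurable_fun_pair; first exact: (measurable_funD measurable_fst (measurable_cst (- k))).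
  apply: measurable_funB => //.
  by apply: measurable_funM => //; apply: (mtr (h n - k, 0) a ma).
pose F1 n p := (u p - u (shift2 p (axis_vec false (- h n)))) / h n * phi p.
pose K n p := (u (shift2 p (axis_vec false (- h n))) - u (p.1 - h n, p.2 - h n * a p)) / h n * phi p.
pose K' n p := (u p - u (p.1, p.2 - h n * a (shift2 p (axis_vec false (h n))))) / h n * phi (shift2 p (axis_vec false (h n))).
have bh (z : R) n (B : R) : `|z| <= B * h n -> `|z / h n| <= B.
  by move=> zB; rewrite normrM normfV (gtr0_norm (hpos n)) ler_pdivrMr.
have F1C n p : `|F1 n p| <= (L * C) * \1_(square N) p.
  rewrite normrM -mulrA; apply: ler_pM => //; apply: bh; rewrite distrC.
  by apply: le_trans (lip_shift _ _ _ uL) _; rewrite normrN (gtr0_norm (hpos n)).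
have mF1 n : measurable_fun setT (F1 n).
  apply: measurable_funM => //; apply: measurable_funM => //; apply: measurable_funB => //; exact: mtr.
have mK n : measurable_fun setT (K n).
  apply: measurable_funM => //; apply: measurable_funM => //; apply: measurable_funB => //; first exact: mtr.
  have := mback n (h n); congr measurable_fun; apply/funext => p.
  by rewrite subrr !addr0; case: p.
have mK' n : measurable_fun setT (K' n).
  apply: measurable_funM => //; last exact: mtr.
  apply: measurable_funM => //; apply: measurable_funB => //.
  have := mback n 0; congr measurable_fun; apply/funext => p.
  by rewrite !subr0.
have KL n p : `|(u (shift2 p (axis_vec false (- h n))) - u (p.1 - h n, p.2 - h n * a p)) / h n| <= L * M.
  apply: bh; apply: le_trans (uL _ _ I I) _; rewrite /= subrr normr0 add0r -mulrA; apply: ler_wpM2l => //.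
  rewrite (_ : _ - _ = a p * h n); last by rewrite addr0; ring.
  by rewrite normrM (gtr0_norm (hpos n)) ler_wpM2r ?(ltW (hpos n)).
have KC n p : `|K n p| <= (L * M * C) * \1_(square N) p.
  by rewrite normrM -mulrA; apply: ler_pM.
have KK n p : K' n p = K n (shift2 p (axis_vec false (h n))).
  rewrite /K' /K; congr ((u _ - u _) / _ * _); first by rewrite shift2K.
  by rewrite /shift2 /= addrK addr0.
have bF1 n : bsq (F1 n) by split => //; exists N, (L * C).
have bK n : bsq (K n) by split => //; exists N, (L * M * C).
have IKK n : I2 (K' n) = I2 (K n).
  rewrite -(I2_shift (axis_vec false (h n)) (bK n)); congr I2; apply/funext => p; exact: KK.
have bsum n : bsq (F1 n \+ K n) := bsqD (bF1 n) (bK n).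
have c0 : I2 (F1 n \+ K n) @[n --> \oo] --> 0.
  have -> : 0 = I2 (fun=> 0) :> R by rewrite /I2 /Rintegral integral0_eq.
  apply: (@dct2 _ (fun n => F1 n \+ K n) (fun=> 0) N (L * C + L * M * C)).
  - by move=> n; case: (bsum n).
  - exact: measurable_cst.
  - by move=> n p; apply: le_trans (ler_normD _ _) _; rewrite mulrDl; apply: lerD.
  apply: aeW => p.
  have [p0|pn0] := eqVneq (phi p) 0.
    rewrite (_ : (fun n => _) = (fun=> 0)); first exact: cvg_cst.
    by apply/funext => n; rewrite /F1 /K /= p0 !mulr0 addr0.
  have [A [h0 [h00 Hh]]] := H p pn0.
  apply/norm_cvg0P; apply: (@squeeze_cvgr _ _ _ _ (cst 0) (fun n => `|A| * `|phi p| * h n)); last 2 first.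
  - exact: cvg_cst.
  - by rewrite -[X in _ --> X](mulr0 (`|A| * `|phi p|)); apply: cvgM => //; exact: cvg_cst.
  have : \forall n \near \oo, h n < h0.
    have /cvgrPdist_lt/(_ _ h00) := hcv.
    by apply: filterS => n; rewrite sub0r normrN gtr0_norm.
  apply: filterS => n hn; rewrite normr_ge0 /=.
  have -> : F1 n p + K n p = (u p - u (p.1 - h n, p.2 - h n * a p)) / h n * phi p.
    by rewrite /F1 /K; ring.
  rewrite normrM mulrAC; apply: ler_wpM2r => //; apply: bh.
  by rewrite -mulrA -expr2; apply: le_trans (Hh _ (hpos n) hn) _; rewrite ler_wpM2r ?ler_norm// sqr_ge0.
have c1 : I2 (F1 n) @[n --> \oo] --> I2 (fun p => ut p * phi p).
  apply: (dct2 mF1 _ F1C); first exact: measurable_funM.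
  apply: (@ae_lines _ false) => //; first exact: measurable_funM.
  move=> p; apply: aeS (lip_derivable (lip_line false p uL)) => s ds.
  have dsE : is_derive s (1 : R) (fun s => u (line false p s)) ('D_1 (fun s => u (line false p s)) s) by exact: DeriveDef.
  rewrite (utd _ _ _ dsE); apply: cvgM; last exact: cvg_cst.
  have hcvN : - h n @[n --> \oo] --> 0 by rewrite -oppr0; apply: cvgN.
  have hn0' n : - h n != 0 by rewrite oppr_eq0.
  have := @derive_seq _ _ _ _ (fun n => - h n) dsE hcvN hn0'.
  rewrite (_ : (fun n => (_ - _) / - h n) = (fun n => (u (line false p s) - u (shift2 (line false p s) (axis_vec false (- h n)))) / h n))//.
  by apply/funext => n; rewrite -line_shift coord_line line_line invrN mulrN -mulNr opprB.
have K'C n p : `|K' n p| <= (L * M * C) * \1_(square (N + 1)) p.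
  rewrite KK; apply: le_trans (KC _ _) _; apply: ler_wpM2l; first by rewrite !mulr_ge0.
  rewrite !indicE ler_nat; case: (boolP (_ \in square N)) => //; rewrite inE => sq.
  rewrite mem_set//; apply: square_shift sq; by rewrite gtr0_norm.
have c2 : I2 (K' n) @[n --> \oo] --> I2 (fun p => (a p * ux p) * phi p).
  have mf : measurable_fun setT (fun p => (a p * ux p) * phi p).
    by apply: measurable_funM => //; exact: measurable_funM.
  apply: (dct2 mK' mf K'C).
  apply: (@ae_lines _ true) => //.
  move=> p; apply: aeS (lip_derivable (lip_line true p uL)) => s ds.
  have dsE : is_derive s (1 : R) (fun s => u (line true p s)) ('D_1 (fun s => u (line true p s)) s) by exact: DeriveDef.
  rewrite (uxd _ _ _ dsE) /line /=.
  have htr n : h n @[n --> \oo] --> 0 by [].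
  have cpt g : continuous g -> g (p.1 + h n, s + 0) @[n --> \oo] --> g (p.1, s).
    by move=> cg; exact: cvg_time_shift.
  apply: cvgM; last exact: cpt.
  pose k n := - (h n * a (p.1 + h n, s + 0)).
  have k0 : k n @[n --> \oo] --> 0.
    have kc := cvgN (cvgM hcv (cpt a ca)); rewrite mul0r oppr0 in kc.
    exact: kc.
  have kn0 n : k n != 0 by rewrite oppr_eq0 mulf_neq0.
  have c3 := @derive_seq _ _ _ _ k dsE k0 kn0.
  rewrite (_ : (fun n => _) = (fun n => a (p.1 + h n, s + 0) * ((u (line true p (s + k n)) - u (line true p s)) / k n))).
    exact: cvgM (cpt a ca) c3.
  apply/funext => n; rewrite /= /line /shift2 /= /k.
  set z := a _; have z0 : z != 0 by exact: a0.
  by field; rewrite z0 hn0.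
have -> : (fun p => (ut p + a p * ux p) * phi p) = (fun p => ut p * phi p) \+ (fun p => a p * ux p * phi p).
  by apply/funext => p; rewrite mulrDl.
have b1 : bsq (fun p => ut p * phi p).
  apply: (bsqS bphi); first exact: measurable_funM.
  by exists L => p; rewrite normrM ler_wpM2r.
have b2 : bsq (fun p => a p * ux p * phi p).
  apply: (bsqS bphi); first by apply: measurable_funM => //; exact: measurable_funM.
  by exists (M * L) => p; rewrite normrM ler_wpM2r// normrM ler_pM.
rewrite I2D//.
have c3 : I2 (F1 n \+ K n) @[n --> \oo] --> I2 (fun p => ut p * phi p) + I2 (fun p => a p * ux p * phi p).
  rewrite (_ : (fun n => _) = (fun n => I2 (F1 n) + I2 (K' n))); first exact: cvgD.
  by apply/funext => n; rewrite I2D// IKK.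
exact/esym/(cvg_unique _ c0 c3).
Qed.
End Transport.

Section Test.
Context {R : realType}.
Implicit Types (f g u phi : R * R -> R) (p q : R * R).
Local Notation P2 := (measurableTypeR R * measurableTypeR R)%type.

Lemma mvt_itv (f df : R -> R) (a b B : R) : a <= b ->
  (forall x, a < x < b -> is_derive x (1 : R) f (df x)) ->
  {within `[a, b], continuous f} ->
  (forall x, a < x < b -> `|df x| <= B) -> `|f b - f a| <= B * (b - a).
Proof.
rewrite le_eqVlt => /orP[/eqP ->|ab] fd fc fB; first by rewrite !subrr normr0 mulr0.
have fd' x : x \in `]a, b[ -> is_derive x (1 : R) f (df x) by rewrite in_itv; exact: fd.
have [x xab ->] := MVT ab fd' fc.
rewrite normrM [`|b - a|]ger0_norm ?subr_ge0 ?(ltW ab)// ler_wpM2r ?subr_ge0 ?(ltW ab)//.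
by apply: fB; move: xab; rewrite in_itv.
Qed.

Lemma mvt_lip (f df : R -> R) (B : R) : (forall x, is_derive x (1 : R) f (df x)) ->
  (forall x, `|df x| <= B) -> forall a b, `|f a - f b| <= B * `|a - b|.
Proof.
move=> fd fB a b; wlog ab : a b / a <= b.
  by move=> H; case/orP: (le_total a b) => /H //; rewrite distrC (distrC a).
rewrite distrC (distrC a) [`|b - a|]ger0_norm ?subr_ge0//.
apply: (mvt_itv ab (fun x _ => fd x)) => //.
apply: derivable_within_continuous => x _.
by have [] := fd x.
Qed.

Lemma test_facts Om phi : test_function Om phi ->
  exists N B, [/\ continuous phi, bsq phi, forall i, bsq (partial i phi), forall p, phi p != 0 -> Om p &
   [/\ forall i p, partial i phi p != 0 -> Om p,
      forall i p, is_derive (coord i p) (1 : R) (fun s => phi (line i p s)) (partial i phi p),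
      forall i p h, `|phi (shift2 p (axis_vec i h)) - phi p| <= B * `|h| &
      forall p, phi p != 0 -> square N p]].
Proof.
move=> [sm cK KO]; set K := closure _ in cK KO.
have clK : closed K by exact: closed_closure.
have c0 : continuous phi by have [] := sm [::].
have d0 i p : derivable phi p (dir i) by have [_] := sm [::]; exact.
have c1 i : continuous (partial i phi) by have [] := sm [:: i].
have K0 p : phi p != 0 -> K p by move=> h; apply: subset_closure.
have K1 i p : partial i phi p != 0 -> K p.
  move=> h; apply: contrapT => nK; move/eqP: h; apply.
  have : nbhs p (~` K) by apply: open_nbhs_nbhs; split => //; exact: closed_openC.
  move=> nb; rewrite /partial.
  have : \forall q \near p, phi q = cst 0 q.
    by apply: filterS nb => q /= nq; apply/eqP; apply: contra_notT nq => /K0.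
  by move=> /near_eq_derive ->; exact: derive_cst.
have [N KN] : exists N, forall p, K p -> square N p.
  have [M [_ MK]] := compact_bounded cK.
  exists (M + 1) => p Kp.
  have : Num.max `|p.1| `|p.2| <= M + 1 := MK (M + 1) (ltr_pwDr ltr01 (lexx M)) p Kp.
  rewrite ge_max !ler_norml => /andP[h1 h2].
  by split; rewrite /= in_itv.
have bnd f : continuous f -> exists B, forall p, K p -> `|f p| <= B.
  move=> cf; have cfK : compact (f @` K).
    by apply: continuous_compact => //; exact: continuous_subspaceT.
  have [M [_ MK]] := compact_bounded cfK.
  by exists (M + 1) => p Kp; apply: (MK (M + 1) (ltr_pwDr ltr01 (lexx M)) (f p)); exists p.
have bq f : continuous f -> (forall p, f p != 0 -> K p) -> bsq f.
  move=> cf fK; split; first exact: continuous_measurable2.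
  have [B Bf] := bnd f cf; exists N, `|B| => p; rewrite indicE.
  have [f0|/fK fp] := eqVneq (f p) 0; first by rewrite f0 normr0 mulr_ge0.
  by rewrite mem_set ?mulr1; [apply: le_trans (Bf _ fp) _; exact: ler_norm|exact: KN].
have [B0 B0P] := bnd _ (c1 false); have [B1 B1P] := bnd _ (c1 true).
exists N, (`|B0| + `|B1|); split => //; [exact: bq|by move=> i; apply: bq => //; exact: K1|by move=> p /K0 /KO|split].
- by move=> i p /K1 /KO.
- by move=> i p; exact: derive_line.
- move=> i p h; rewrite -line_shift -{3}(line_coord i p).
  have dl s : is_derive s (1 : R) (fun s => phi (line i p s)) (partial i phi (line i p s)).
    have := derive_line (d0 i (line i p s)).
    by rewrite coord_line (_ : (fun s0 => _) = (fun s => phi (line i p s))) //; apply/funext => s'; rewrite line_line.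
  have := @mvt_lip (fun s => phi (line i p s)) _ (`|B0| + `|B1|) dl _ (coord i p + h) (coord i p).
  rewrite (_ : coord i p + h - coord i p = h); last by ring.
  apply=> s.
  have [->|/K1 Kp] := eqVneq (partial i phi (line i p s)) 0; first by rewrite normr0 addr_ge0.
  case: i Kp {dl} => Kp.
    by apply: le_trans (B1P _ Kp) _; apply: le_trans (ler_norm _) _; rewrite lerDr.
  by apply: le_trans (B0P _ Kp) _; apply: le_trans (ler_norm _) _; rewrite lerDl.
- by move=> p /K0 /KN.
Qed.

Lemma RintegralOm Om f : measurable Om -> (forall p, f p != 0 -> Om p) ->
  \int[leb2]_(p in Om) f p = I2 f.
Proof.
move=> mO fO; rewrite /I2; have := @Rintegral_mkcond _ P2 R (@leb2 R) Om f.
move=> ->; congr (Rintegral _ _ _); apply/funext => p; rewrite /restrict.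
case: ifPn => // /negP pO; apply/eqP; rewrite eq_sym; apply/negPn/negP => fp.
by apply: pO; rewrite inE; exact: fO.
Qed.

Lemma Linfty_lt (w : R * R -> R) (Om : set (R * R)) (L : R) : 0 <= L -> (forall p, `|w p| <= L) ->
  (Linfty_norm leb2 Om (EFin \o w) < +oo)%E.
Proof.
move=> L0 wL; rewrite /Linfty_norm unlock; case: ifP => _ //.
apply: (@le_lt_trans _ _ L%:E); last exact: ltry.
apply/ess_supP; apply: aeW => p /=; rewrite /patch.
case: ifP => _ /=; first by rewrite lee_fin; exact: wL.
by rewrite normr0 lee_fin.
Qed.

(** One half of the equivalence between the weak equation and the semi-
    Lagrangian estimate. The quotients of space increments use the step h * a p,
    whence the condition that a does not vanish. *)
Lemma transport_eqI Om (L M : R) u a : open Om ->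
  M_Lipschitz L setT u -> continuous a -> (forall p, `|a p| <= M) -> (forall p, a p != 0) ->
  (forall p, Om p -> exists A h0, 0 < h0 /\ forall h, 0 < h -> h < h0 ->
     `|u p - u (p.1 - h, p.2 - h * a p)| <= A * h ^+ 2) ->
  transport_eq Om a u.
Proof.
move=> oO uL ca aM a0 H; have L0 := lip_ge0 uL.
have mO : measurable Om := open_measurable2 oO.
have [ut [mut utL utd]] := partial_representative false uL.
have [ux [mux uxL uxd]] := partial_representative true uL.
have wp i (w : R * R -> R) : measurable_fun setT w -> (forall p, `|w p| <= L) ->
    (forall p s d, is_derive s (1 : R) (fun s => u (line i p s)) d -> w (line i p s) = d) ->
    weak_partial i Om u w.
  move=> mw wL wd; split.
  - exact: measurable_funS mw.
  - exact: Linfty_lt wL.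
  move=> phi /test_facts[N [B [cphi bphi bd supp [dsupp ds lip sq]]]].
  rewrite !RintegralOm//; last 2 first.
  - by move=> p h; apply: supp; apply: contra_neq h => ->; rewrite mulr0.
  - by move=> p h; apply: (dsupp i); apply: contra_neq h => ->; rewrite mulr0.
  exact: (weak_by_parts uL mw wL wd bphi (bd i) (lip i) (ds i)).
exists ut, ux; split; [exact: wp|exact: wp|].
move=> phi /test_facts[N [B [cphi bphi bd supp [dsupp ds lip sq]]]].
rewrite RintegralOm//; last first.
  by move=> p h; apply: supp; apply: contra_neq h => ->; rewrite mulr0.
apply: (transport_weak uL ca aM a0 mut utL utd mux uxL uxd cphi bphi).
by move=> p /supp; exact: H.
Qed.
End Test.

(** * Smooth bumps *)

Section Bump.
Context {R : realType}.
Implicit Types (P : {poly R}) (k : nat) (x y : R).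

(** A family stable under differentiation, so that smoothness follows by
    induction; exp(-1 / (1 - x^2)) alone would not be. *)
Definition bump P k x : R :=
  if `|x| < 1 then P.[x] * (1 - x ^+ 2) ^- k * expR (- (1 - x ^+ 2)^-1) else 0.
Definition dbump P k : {poly R} :=
  P^`() * (1 - 'X^2) ^+ 2 + (2 * k%:R)%:P * P * 'X * (1 - 'X^2) - 2%:P * P * 'X.

Lemma bump_arg x : `|x| < 1 -> 0 < 1 - x ^+ 2.
Proof. by move=> x1; rewrite subr_gt0 -real_normK ?num_real// expr_lt1. Qed.

Lemma expR_dominates n (s : R) : 0 <= s -> s ^+ n.+1 * expR (- s) <= n.+1%:R ^+ n.+1.
Proof.
move=> s0; rewrite expRN ler_pdivrMr ?expR_gt0//.
have := @expX_le R s n s0; move=> /(le_trans _) H.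
have h1 : s ^+ n.+1 <= n.+1%:R ^+ n.+1 * (1 + s / n.+1%:R) ^+ n.+1.
  rewrite -exprMn lerXn2r ?nnegrE ?mulr_ge0 ?addr_ge0 ?divr_ge0//.
  by rewrite mulrDr mulr1 mulrC divfK ?pnatr_eq0// lerDr.
apply: le_trans h1 _; rewrite ler_wpM2l ?exprn_ge0//; exact: expX_le.
Qed.

(** With s = 1 / (1 - y^2), the factor exp(- s) beats every power of s, and 1 /
    s <= 2 |y - x| whenever |x| >= 1. The quadratic bound gives the derivative 0
    at and outside the end points. *)
Lemma bump_quad P k : exists C, forall x y, 1 <= `|x| -> `|bump P k y| <= C * (y - x) ^+ 2.
Proof.
have [B BP] := poly_itv_bound P (-1) 1.
pose n := k.+1.
exists (`|B| * n.+1%:R ^+ n.+1 * 4) => x y x1; rewrite /bump.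
case: ifP => y1; last by rewrite normr0 mulr_ge0 ?sqr_ge0// mulr_ge0// mulr_ge0// exprn_ge0.
have s0 := bump_arg y1; set s := (1 - y ^+ 2)^-1.
have sp : 0 < s by rewrite invr_gt0.
rewrite -exprVn -/s !normrM [`|expR _|]gtr0_norm ?expR_gt0// [`|s ^+ k|]gtr0_norm ?exprn_gt0//.
have h1 : `|P.[y]| <= `|B|.
  apply: le_trans (BP y _) (ler_norm _); rewrite -ler_norml; exact: ltW.
have h2 : s ^+ k * expR (- s) <= n.+1%:R ^+ n.+1 * (s ^+ 2)^-1.
  rewrite ler_pdivlMr ?exprn_gt0// mulrAC -exprD addn2; exact: expR_dominates (ltW sp).
have h3 : (s ^+ 2)^-1 <= 4 * (y - x) ^+ 2.
  rewrite -exprVn /s invrK (_ : 4 * (y - x) ^+ 2 = (2 * `|y - x|) ^+ 2); last first.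
    by rewrite exprMn real_normK ?num_real//; congr (_ * _); ring.
  rewrite lerXn2r ?nnegrE ?mulr_ge0 ?(ltW s0)//.
  have : 1 - y ^+ 2 = (1 - `|y|) * (1 + `|y|) by rewrite -(real_normK (num_real y)); ring.
  move=> ->; have : (1 - `|y|) * (1 + `|y|) <= (1 - `|y|) * 2 by apply: ler_wpM2l; lra.
  have := ler_distD y x 0; rewrite !subr0 (distrC x y); lra.
have E0 : 0 <= n.+1%:R ^+ n.+1 :> R by exact: exprn_ge0.
move: E0 h2; move: (n.+1%:R ^+ n.+1) => E E0 h2.
have -> : `|P.[y]| * s ^+ k * expR (- s) = `|P.[y]| * (s ^+ k * expR (- s)) by rewrite mulrA.
have -> : `|B| * E * 4 * (y - x) ^+ 2 = `|B| * (E * (4 * (y - x) ^+ 2)) by rewrite !mulrA.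
apply: ler_pM => //; first by rewrite mulr_ge0 ?expR_ge0// exprn_ge0// ltW.
by apply: le_trans h2 _; apply: ler_wpM2l.
Qed.

Lemma bump_bounded P k : exists C, forall x, `|bump P k x| <= C.
Proof.
have [C CP] := bump_quad P k.
exists (`|C| * 4) => y; have [y1|y1] := lerP 1 `|y|.
  by rewrite /bump ltNge y1 /= normr0 mulr_ge0.
apply: le_trans (CP (-1) y _) _; first by rewrite normrN1.
apply: le_trans (ler_wpM2r (sqr_ge0 _) (ler_norm C)) _; rewrite ler_wpM2l//.
have -> : 4 = 2 ^+ 2 :> R by ring.
rewrite -(real_normK (num_real (y - -1))) lerXn2r ?nnegrE//.
move: y1; rewrite opprK ltr_norml ler_norml; lra.
Qed.

Lemma is_derive_bump P k x : is_derive x (1 : R) (bump P k) (bump (dbump P k) k.+2 x).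
Proof.
have [x1|x1] := lerP 1 `|x|; last first.
  have s0 := bump_arg x1.
  pose g y := P.[y] * ((1 - y ^+ 2)^-1) ^+ k * expR (- (1 - y ^+ 2)^-1).
  have gE : \forall y \near x, g y = bump P k y.
    have : \forall y \near x, `|y| < 1.
      have := @cvgr_lt _ _ _ _ (fun y : R => `|y|) `|x| (@norm_continuous _ R x) 1 x1.
      exact.
    by apply: filterS => y y1; rewrite /g /bump y1 exprVn.
  apply: (near_eq_is_derive gE).
  have d1 : is_derive x (1 : R) (fun y => 1 - y ^+ 2) (- (x *+ 2)).
    have d0 : is_derive x (1 : R) (fun y : R => y ^+ 2) (x *+ 2).
      apply: is_derive_eq (@is_deriveX _ _ (id : R -> R) 2 x 1 _ (is_derive_id x 1)) _.
      by rewrite /GRing.scale/= mulr1 expr1 mulr_natl.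
    rewrite -(add0r (- (x *+ 2))); exact: (is_deriveB (is_derive_cst (1 : R) x (1 : R)) d0).
  have d2 : is_derive x (1 : R) (fun y => (1 - y ^+ 2)^-1) (2 * x * ((1 - x ^+ 2)^-1) ^+ 2).
    apply: is_derive_eq (is_deriveV _ d1) _; first by rewrite gt_eqF.
    by rewrite /GRing.scale/= exprVn; ring.
  set s := (1 - x ^+ 2)^-1 in d2.
  have d3 : is_derive x (1 : R) (fun y => expR (- (1 - y ^+ 2)^-1)) (- (2 * x * s ^+ 2) * expR (- s)).
    have dN : is_derive x (1 : R) (fun y => - (1 - y ^+ 2)^-1) (- (2 * x * s ^+ 2)) by exact: is_deriveN.
    have := @is_derive1_comp R expR (fun y => - (1 - y ^+ 2)^-1) x _ _ (is_derive_expR _) dN.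
    by rewrite mulrC.
  have d4 : is_derive x (1 : R) (fun y => ((1 - y ^+ 2)^-1) ^+ k) (k%:R * s ^+ k.-1 * (2 * x * s ^+ 2)).
    have := @is_deriveX _ _ (fun y : R => (1 - y ^+ 2)^-1) k x 1 _ d2.
    rewrite (_ : (fun y : R => (1 - y ^+ 2)^-1) ^+ k = (fun y => ((1 - y ^+ 2)^-1) ^+ k)).
      by rewrite /GRing.scale/= -/s.
    by rewrite exprfctE.
  have d5 := is_derive_poly P x.
  have d6 := @is_deriveM _ _ (fun y => P.[y] * ((1 - y ^+ 2)^-1) ^+ k) (fun y => expR (- (1 - y ^+ 2)^-1)) x 1 _ _ (@is_deriveM _ _ (horner P) (fun y => ((1 - y ^+ 2)^-1) ^+ k) x 1 _ _ d5 d4) d3.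
  apply: is_derive_eq d6 _.
  rewrite /GRing.scale/= /bump x1 -/s -exprVn -/s /dbump !(hornerD, hornerN, hornerM, hornerC, hornerX, hornerXn, horner_exp).
  have sE : 1 - x ^+ 2 = s^-1 by rewrite invrK.
  have sn0 : s != 0 by rewrite invr_neq0// gt_eqF.
  rewrite !sE; case: k {gE g d4} => [|k].
    by rewrite /= expr0 mulr0 !mul0r; field.
  rewrite -[k.+1.-1]/k; have -> : s ^+ k.+3 = s ^+ k * s ^+ 3 by rewrite -exprD addn3.
  have -> : s ^+ k.+1 = s ^+ k * s by rewrite exprSr.
  move: (s ^+ k) (P^`().[x]) (P.[x]) (expR (- s)) => a b d e; by field.
have [C CP] := bump_quad P k.
have f0 : bump P k x = 0 by rewrite /bump ltNge x1.
have -> : bump (dbump P k) k.+2 x = 0 by rewrite /bump ltNge x1.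
have c : h^-1 *: (bump P k (h *: 1 + x) - bump P k x) @[h --> 0^'] --> (0 : R).
  rewrite f0; apply/cvgrPdist_le => e e0.
  have Ce : 0 < e / (`|C| + 1) by rewrite divr_gt0// ltr_pwDr.
  near=> h.
  have h0 : h != 0 by near: h; exact: nbhs_dnbhs_neq.
  rewrite sub0r normrN subr0 /GRing.scale/= mulr1 normrM normfV ler_pdivrMl ?normr_gt0//.
  apply: le_trans (CP x (h + x) x1) _; rewrite addrK -(real_normK (num_real h)) expr2 mulrCA ler_wpM2l//.
  apply: (@le_trans _ _ ((`|C| + 1) * `|h|)).
    by rewrite ler_wpM2r// (le_trans (ler_norm _))// lerDl.
  rewrite mulrC -ler_pdivlMr ?ltr_pwDr//.
  near: h; apply: dnbhs0_le; exact: Ce.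
apply: DeriveDef; first by apply/cvg_ex; exists 0; exact: c.
exact: (cvg_lim _ c).
Unshelve. all: by end_near. Qed.

(** The derivative belongs to the same family, hence is Lipschitz. *)
Lemma bump_taylor P k : exists C, forall x d,
  `|bump P k (x + d) - bump P k x - d * bump (dbump P k) k.+2 x| <= C * d ^+ 2.
Proof.
have [C CP] := bump_bounded (dbump (dbump P k) k.+2) k.+4.
exists C => x d.
have lip := mvt_lip (is_derive_bump (dbump P k) k.+2) CP.
have C0 : 0 <= C by apply: le_trans (CP 0).
set f' := bump (dbump P k) k.+2 in lip *.
pose g s := bump P k (x + s) - s * f' x.
have dg s : is_derive s (1 : R) g (f' (x + s) - f' x).
  have d1 : is_derive s (1 : R) (fun s => x + s) 1.
    rewrite -[X in is_derive _ _ _ X]add0r.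
    exact: (is_deriveD (is_derive_cst (x : R) s (1 : R)) (is_derive_id s (1 : R))).
  have d2 := @is_derive1_comp R (bump P k) (fun s => x + s) s _ _ (is_derive_bump P k (x + s)) d1.
  have d3 : is_derive s (1 : R) (fun s => s * f' x) (f' x).
    rewrite (_ : (fun s => s * f' x) = f' x \*: id); last first.
      by apply/funext => z; rewrite /GRing.scale/= mulrC.
    by apply: is_derive_eq (is_deriveZ _ (is_derive_id s (1 : R))) _; rewrite /GRing.scale/= mulr1.
  by apply: is_derive_eq (is_deriveB d2 d3) _; rewrite mulr1.
have gc (a b : R) : {within `[a, b], continuous g}.
  by apply: derivable_within_continuous => s _; case: (dg s).
have gB s : `|s| <= `|d| -> `|f' (x + s) - f' x| <= C * `|d|.
  move=> sd; apply: le_trans (lip _ _) _; rewrite addrAC subrr add0r.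
  by rewrite ler_wpM2l.
have -> : bump P k (x + d) - bump P k x - d * f' x = g d - g 0 by rewrite /g addr0; ring.
rewrite -(real_normK (num_real d)) expr2 mulrA.
have [d0|d0] := lerP 0 d.
  rewrite [X in _ <= _ * X](ger0_norm d0) -[X in _ <= _ * X]subr0.
  apply: (mvt_itv d0 (fun s _ => dg s) (gc _ _)) => s /andP[s0 s1]; apply: gB.
  by rewrite (gtr0_norm s0) (ger0_norm d0) ltW.
rewrite [X in _ <= _ * X](ltr0_norm d0) -[X in _ <= _ * X]sub0r distrC.
apply: (mvt_itv (ltW d0) (fun s _ => dg s) (gc _ _)) => s /andP[s0 s1]; apply: gB.
by rewrite (ltr0_norm s1) (ltr0_norm d0) lerN2 ltW.
Qed.
End Bump.

Section ProductBump.
Context {R : realType}.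
Implicit Types (f g u phi : R * R -> R) (p q z : R * R) (P : {poly R}).
Local Notation P2 := (measurableTypeR R * measurableTypeR R)%type.

Lemma bumpZ (k : R) P n x : bump (k *: P) n x = k * bump P n x.
Proof. by rewrite /bump; case: ifP => _; rewrite ?mulr0// hornerZ -!mulrA. Qed.

Lemma bump_continuous P k : continuous (bump P k : R -> R).
Proof.
move=> x; apply/differentiable_continuous/derivable1_diffP.
by case: (is_derive_bump P k x).
Qed.

Definition bump2 P k P' k' (e : R) z q : R := bump P k ((z.1 - q.1) / e) * bump P' k' ((z.2 - q.2) / e).

Lemma is_derive_bump_aff P k (al e s : R) :
  is_derive s (1 : R) (fun s => bump P k ((al - s) / e)) (bump (- e^-1 *: dbump P k) k.+2 ((al - s) / e)).
Proof.
have d1 : is_derive s (1 : R) (fun s => (al - s) / e) (- e^-1).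
  rewrite (_ : (fun s => (al - s) / e) = e^-1 \*: (fun s => al - s)); last first.
    by apply/funext => z; rewrite /GRing.scale/= mulrC.
  apply: is_derive_eq (is_deriveZ _ (is_deriveB (is_derive_cst (al : R) s (1 : R)) (is_derive_id s (1 : R)))) _.
  by rewrite /GRing.scale/= sub0r mulrN1.
apply: is_derive_eq (@is_derive1_comp R (bump P k) (fun s => (al - s) / e) s _ _ (is_derive_bump P k _) d1) _.
by rewrite bumpZ mulrC.
Qed.

Lemma bump2_derive P k P' k' e z i q :
  derivable (bump2 P k P' k' e z) q (dir i) /\
  partial i (bump2 P k P' k' e z) q =
    (if i then bump2 P k (- e^-1 *: dbump P' k') k'.+2 e z q
     else bump2 (- e^-1 *: dbump P k) k.+2 P' k' e z q).
Proof.
apply: line_derive; case: i; rewrite /bump2 /line /coord /=.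
  exact: (is_deriveZ (bump P k ((z.1 - q.1) / e)) (is_derive_bump_aff P' k' z.2 e q.2)).
rewrite [X in is_derive _ _ _ X]mulrC.
rewrite (_ : (fun s : R => _) = (bump P' k' ((z.2 - q.2) / e)) \*: (fun s => bump P k ((z.1 - s) / e))); last first.
  by apply/funext => s; rewrite /GRing.scale/= mulrC.
exact: (is_deriveZ (bump P' k' ((z.2 - q.2) / e)) (is_derive_bump_aff P k z.1 e q.1)).
Qed.

Lemma bump2_continuous P k P' k' e z : continuous (bump2 P k P' k' e z).
Proof.
move=> q; apply: cvgM.
  apply: (@continuous_comp _ _ _ (fun q : R * R => (z.1 - q.1) / e) (bump P k)); last exact: bump_continuous.
  apply: cvgM; last exact: cvg_cst.
  by apply: cvgB; [exact: cvg_cst|exact: cvg_fst].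
apply: (@continuous_comp _ _ _ (fun q : R * R => (z.2 - q.2) / e) (bump P' k')); last exact: bump_continuous.
apply: cvgM; last exact: cvg_cst.
by apply: cvgB; [exact: cvg_cst|exact: cvg_snd].
Qed.

(** A partial derivative of a product of bumps is a product of bumps. *)
Lemma bump2_smooth P k P' k' e z : smooth (bump2 P k P' k' e z).
Proof.
move=> s.
have [Q [n [Q' [n' ->]]]] : exists Q n Q' n', foldr partial (bump2 P k P' k' e z) s = bump2 Q n Q' n' e z.
  elim: s => [|i s [Q [n [Q' [n' IH]]]]]; first by exists P, k, P', k'.
  rewrite /= IH; case: i.
    exists Q, n, (- e^-1 *: dbump Q' n'), n'.+2.
    by apply/funext => q; case: (bump2_derive Q n Q' n' e z true q).
  exists (- e^-1 *: dbump Q n), n.+2, Q', n'.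
  by apply/funext => q; case: (bump2_derive Q n Q' n' e z false q).
split; first exact: bump2_continuous.
by move=> i q; case: (bump2_derive Q n Q' n' e z i q).
Qed.

Definition cube z (e : R) : set (R * R) := `[z.1 - e, z.1 + e]%classic `*` `[z.2 - e, z.2 + e]%classic.

Lemma bump_supp P k x : bump P k x != 0 -> `|x| < 1.
Proof. by rewrite /bump; case: ifP => //; rewrite eqxx. Qed.

Lemma bump2_supp P k P' k' e z q : 0 < e -> bump2 P k P' k' e z q != 0 -> cube z e q.
Proof.
move=> e0; rewrite /bump2 mulf_eq0 negb_or => /andP[/bump_supp h1 /bump_supp h2].
move: h1 h2; rewrite !normrM normfV (gtr0_norm e0) !ltr_pdivrMr// !mul1r !ltr_norml => /andP[? ?] /andP[? ?].
by split; rewrite /= in_itv/=; lra.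
Qed.

Lemma bump2_test P k P' k' e z Om : 0 < e -> cube z e `<=` Om -> test_function Om (bump2 P k P' k' e z).
Proof.
move=> e0 cO.
have cc : compact (cube z e) by apply: compact_setX; exact: segment_compact.
have clc : closed (cube z e) by apply: compact_closed cc; exact: norm_hausdorff.
have sub : closure [set p | bump2 P k P' k' e z p != 0] `<=` cube z e.
  rewrite [X in _ `<=` X](closure_id _).1//; apply: closure_subset => q; exact: bump2_supp.
split; first exact: bump2_smooth.
- by apply: (subclosed_compact _ cc) => //; exact: closed_closure.
- by move=> q /sub /cO.
Qed.

Lemma int_ae Om f g : measurable Om -> measurable_fun Om f -> measurable_fun Om g ->
  {ae (@leb2 R), forall p, Om p -> f p = g p} ->
  \int[leb2]_(p in Om) f p = \int[leb2]_(p in Om) g p.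
Proof.
move=> mO mf mg fg; rewrite /Rintegral; congr fine.
apply: (@ae_eq_integral _ P2 R (@leb2 R) Om (EFin \o g) (EFin \o f)) => //.
- exact/measurable_EFinP.
- exact/measurable_EFinP.
- by apply: aeS fg => p h Op /=; rewrite h.
Qed.

Lemma leb2_gt0 : (0 < @leb2 R setT)%E.
Proof.
have h : (@leb2 R (square 1) <= @leb2 R setT)%E by rewrite le_measure ?inE//; exact: measurable_square.
apply: lt_le_trans h; rewrite /leb2 product_measure1E; [|exact: measurable_itv|exact: measurable_itv].
have h : (0 < @lebesgue_measure R `[(- 1)%R, 1%R]%classic)%E.
  rewrite lebesgue_measure_itv/= lte_fin (_ : (- 1 < 1 :> R)%R); last by lra.
  by rewrite -EFinB lte_fin; lra.
exact: mule_gt0.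
Qed.

(** Redefinition on a null set makes a function of finite essential supremum
    bounded and measurable everywhere. *)
Lemma weak_rep Om (w : R * R -> R) : measurable Om -> measurable_fun Om w ->
  (Linfty_norm leb2 Om (EFin \o w) < +oo)%E ->
  exists (w' : R * R -> R) (C : R), [/\ measurable_fun setT w', forall p, `|w' p| <= C &
     {ae (@leb2 R), forall p, Om p -> w' p = w p}].
Proof.
move=> mO mw; rewrite /Linfty_norm unlock leb2_gt0.
set es := ess_sup _ _ => esoo.
have [C [C0 esC]] : exists C : R, 0 <= C /\ (es <= C%:E)%E.
  exists `|fine es|; split => //; move: esoo; case: es => [r| |] //= _; first by rewrite lee_fin ler_norm.
  exact: leNye.
move/ess_supP : esC => aeC.
(* The representative is w where it obeys its essential bound, and 0
   elsewhere. *)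
pose S := Om `&` [set p | `|w p| <= C].
have mS : measurable S.
  have -> : S = Om `&` w @^-1` `[- C, C]%classic.
    by apply/seteqP; split => p [Op] /=; rewrite in_itv/= -ler_norml.
  by apply: mw => //; exact: measurable_itv.
exists (w \_ S), C; split.
- have mwS : measurable_fun S w := measurable_funS mO (@subIsetl _ _ _) mw.
  exact: ((measurable_restrictT w mS).1 mwS).
- move=> p; rewrite /patch; case: ifPn => [|_]; last by rewrite normr0.
  by rewrite inE => -[].
- apply: aeS aeC => p /= + Op; rewrite /patch (mem_set Op) /= lee_fin => wC.
  by rewrite mem_set.
Qed.

Lemma transport_eq_rep (Om : set (R * R)) (a : R * R -> R) u : open Om -> measurable_fun Om a -> transport_eq Om a u ->
  exists (wt wx : R * R -> R) (C : R), [/\ measurable_fun setT wt, measurable_fun setT wx,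
    forall p, `|wt p| <= C, forall p, `|wx p| <= C &
    forall phi, test_function Om phi ->
      [/\ I2 (fun p => u p * partial false phi p) = - I2 (fun p => wt p * phi p),
          I2 (fun p => u p * partial true phi p) = - I2 (fun p => wx p * phi p) &
          \int[leb2]_(p in Om) ((wt p + a p * wx p) * phi p) = 0]].
Proof.
move=> oO ma [ut [ux [[mut Lut wput] [mux Lux wpux] eq0]]].
have mO := open_measurable2 oO.
have [wt [Ct [mwt wtC wtae]]] := weak_rep mO mut Lut.
have [wx [Cx [mwx wxC wxae]]] := weak_rep mO mux Lux.
exists wt, wx, (Num.max Ct Cx); split => //.
- by move=> p; rewrite le_max wtC.
- by move=> p; rewrite le_max wxC orbT.
move=> phi tphi; have [N [B [cphi bphi bd supp [dsupp ds lip sq]]]] := test_facts tphi.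
have mphi : measurable_fun Om phi by apply: measurable_funTS; case: bphi.
have aux i (w w' : R * R -> R) : measurable_fun Om w -> measurable_fun setT w' ->
   {ae (@leb2 R), forall p, Om p -> w' p = w p} ->
   \int[leb2]_(p in Om) (u p * partial i phi p) = - (\int[leb2]_(p in Om) (w p * phi p)) ->
   I2 (fun p => u p * partial i phi p) = - I2 (fun p => w' p * phi p).
  move=> mw mw' ae; rewrite RintegralOm//; last first.
    by move=> p h; apply: (dsupp i); apply: contra_neq h => ->; rewrite mulr0.
  have <- : \int[leb2]_(p in Om) (w' p * phi p) = I2 (fun p => w' p * phi p).
    apply: RintegralOm => // p h.
    by apply: supp; apply: contra_neq h => ->; rewrite mulr0.
  move=> ->; congr (- _).
  apply: int_ae => //.
  - exact: measurable_funM.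
  - by apply: measurable_funM => //; exact: measurable_funTS.
  - by apply: aeS ae => p h Op; rewrite h.
split.
- by apply: (aux false ut wt) => //; exact: wput.
- by apply: (aux true ux wx) => //; exact: wpux.
rewrite -(eq0 phi tphi); apply: int_ae => //.
- apply: measurable_funM => //; apply: measurable_funD; first exact: measurable_funTS.
  by apply: measurable_funM => //; exact: measurable_funTS.
- by apply: measurable_funM => //; apply: measurable_funD => //; exact: measurable_funM.
- by apply: aeS2 wtae wxae => p h1 h2 Op; rewrite h1// h2.
Qed.
End ProductBump.

(** * From the weak equation to the semi-Lagrangian estimate *)

Section Interior.
Context {R : realType}.
Implicit Types (f g u phi : R * R -> R) (p q z : R * R).
Local Notation P2 := (measurableTypeR R * measurableTypeR R)%type.

(** An estimate up to a quadratic error becomes exact by subdivision: over n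
    steps the errors add up to C h^2 / n. *)
Lemma subdivide (f : R -> R) (h kap C : R) : 0 <= h ->
  (forall s s', 0 <= s <= h -> 0 <= s' <= h -> `|f s' - f s| <= kap * `|s' - s| + C * (s' - s) ^+ 2) ->
  `|f h - f 0| <= kap * h.
Proof.
move=> h0 H; apply: (@le_archi _ _ _ (C * h ^+ 2)) => n.
pose d := h / n.+1%:R.
have d0 : 0 <= d by rewrite divr_ge0.
have nd : n.+1%:R * d = h by rewrite mulrC divfK// pnatr_eq0.
have key k : (k <= n.+1)%N -> `|f (k%:R * d) - f 0| <= k%:R * (kap * d + C * d ^+ 2).
  elim: k => [|k IH] kn; first by rewrite !mul0r subrr normr0.
  have kd j : (j <= n.+1)%N -> 0 <= j%:R * d <= h.
    by move=> jn; rewrite mulr_ge0//= -nd ler_wpM2r// ler_nat.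
  have := H _ _ (kd k (ltnW kn)) (kd k.+1 kn).
  rewrite (_ : k.+1%:R * d - k%:R * d = d); last by rewrite -(natr1 k); ring.
  rewrite (ger0_norm d0) => h1.
  apply: le_trans (ler_distD (f (k%:R * d)) _ _) _.
  rewrite (_ : k.+1%:R * (kap * d + C * d ^+ 2) = (kap * d + C * d ^+ 2) + k%:R * (kap * d + C * d ^+ 2)); last first.
    by rewrite -(natr1 k); ring.
  by apply: lerD => //; exact: IH (ltnW kn).
have := key n.+1 (leqnn _); rewrite nd => /le_trans; apply.
rewrite le_eqVlt; apply/orP; left; apply/eqP.
have -> : n.+1%:R * (kap * d + C * d ^+ 2) = kap * (n.+1%:R * d) + C * ((n.+1%:R * d) * d) by ring.
by rewrite nd /d; ring.
Qed.

(** A nonnegative mollifier. It is not normalised: its mass cancels out in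
    [average_combine]. *)
Definition eta (e : R) p := bump2 1 0 1 0 e p.
Implicit Types (e : R).

Lemma bump10_ge0 (x : R) : 0 <= bump 1 0 x.
Proof. by rewrite /bump; case: ifP => // _; rewrite expr0 invr1 hornerC !mul1r expR_ge0. Qed.
Lemma eta_ge0 e p q : 0 <= eta e p q.
Proof. by rewrite /eta /bump2 mulr_ge0 ?bump10_ge0. Qed.

Lemma eta_test e p : 0 < e -> test_function setT (eta e p).
Proof. by move=> e0; exact: bump2_test. Qed.
Lemma eta_bsq e p : 0 < e -> bsq (eta e p).
Proof. by move=> /(@eta_test _ p) /test_facts [N [B []]]. Qed.
Lemma deta_bsq e p i : 0 < e -> bsq (partial i (eta e p)).
Proof. by move=> /(@eta_test _ p) /test_facts [N [B []]]. Qed.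

Definition eta_mass e := I2 (eta e (0, 0)).
Lemma eta_massE e p : 0 < e -> I2 (eta e p) = eta_mass e.
Proof.
move=> e0; rewrite /eta_mass -(I2_shift (- p.1, - p.2) (eta_bsq (0, 0) e0)).
congr I2; apply/funext => q; rewrite /eta /bump2 /=.
by congr (bump _ _ (_ / _) * bump _ _ (_ / _)); ring.
Qed.

Lemma I2_indic (N : R) : 0 < N -> 0 < I2 (\1_(square N) : R * R -> R).
Proof.
move=> N0; rewrite /I2 /Rintegral.
have -> : (\int[leb2]_x (\1_(square N) x)%:E)%E = (@leb2 R (square N)).
  have := @integral_indic _ P2 R (@leb2 R) setT measurableT (square N) (measurable_square N).
  by rewrite setIT.
have h : (0 < @lebesgue_measure R `[(- N)%R, N%R]%classic)%E.
  by rewrite lebesgue_measure_itv/= lte_fin (_ : (- N < N)%R); [rewrite -EFinB lte_fin|]; lra.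
apply: fine_gt0; apply/andP; split; last exact: leb2_square.
rewrite /leb2 product_measure1E; [|exact: measurable_itv|exact: measurable_itv].
exact: mule_gt0.
Qed.

Lemma bsq_indic (k N : R) : bsq (fun p => k * \1_(square N) p).
Proof.
split; first by apply: measurable_funM => //; apply: measurable_indic; exact: measurable_square.
by exists N, `|k| => p; rewrite normrM [X in _ * X]ger0_norm.
Qed.

Lemma eta_mass_gt0 e : 0 < e -> 0 < eta_mass e.
Proof.
(* The mollifier is at least exp(-2)^2 on the square of half the radius. *)
move=> e0; pose k : R := expR (- 2) ^+ 2.
have k0 : 0 < k by rewrite exprn_gt0// expR_gt0.
have half (x : R) : `|x| <= 1 / 2 -> expR (- 2) <= bump 1 0 x.
  move=> x1; have xl1 : `|x| < 1 by lra.
  rewrite /bump xl1 expr0 invr1 hornerC !mul1r ler_expR lerN2 invf_ple ?posrE ?bump_arg//.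
  have : `|x| ^+ 2 <= (1 / 2) ^+ 2 by rewrite lerXn2r// nnegrE.
  rewrite real_normK ?num_real//; lra.
have h1 : I2 (fun p => k * \1_(square (e / 2)) p) <= eta_mass e.
  apply: I2_le; [exact: bsq_indic|exact: eta_bsq|move=> p].
  rewrite indicE; case: (boolP (p \in _)) => [|_]; last by rewrite mulr0 eta_ge0.
  rewrite inE mulr1 /k expr2 => -[] /=; rewrite !in_itv/= -!ler_norml => h1 h2.
  by rewrite /eta /bump2 /= !sub0r; apply: ler_pM; rewrite ?expR_ge0//; apply: half;
   rewrite normrM normrN normfV (gtr0_norm e0) ler_pdivrMr//; lra.
apply: lt_le_trans h1; have b1 := bsq_indic 1 (e / 2).
have -> : (fun p => k * \1_(square (e / 2)) p) = (fun p => k * (1 * \1_(square (e / 2)) p)).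
  by apply/funext => p; rewrite mul1r.
rewrite I2Z//; apply: mulr_gt0 => //.
have -> : (fun p => 1 * \1_(square (e / 2)) p) = (\1_(square (e / 2)) : R * R -> R).
  by apply/funext => p; rewrite mul1r.
by apply: I2_indic; rewrite divr_gt0.
Qed.

Lemma eta_supp e p q : 0 < e -> eta e p q != 0 -> cube p e q.
Proof. by move=> e0; exact: bump2_supp. Qed.

Lemma eta_average (L : R) u e p : M_Lipschitz L setT u -> 0 < e ->
  `|I2 (fun q => u q * eta e p q) - u p * eta_mass e| <= 2 * L * e * eta_mass e.
Proof.
move=> uL e0; have L0 := lip_ge0 uL; have be := eta_bsq p e0.
rewrite -(eta_massE p e0).
have -> : - (u p * I2 (eta e p)) = I2 (fun q => (- u p) * eta e p q) by rewrite I2Z// mulNr.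
rewrite -I2D; [|exact: bsq_loc uL be|exact: bsqZ].
rewrite -I2Z//; apply: I2_norm; [apply: bsqD; [exact: bsq_loc uL be|exact: bsqZ]|exact: bsqZ|].
move=> q /=; rewrite -mulrDl normrM (ger0_norm (eta_ge0 _ _ _)).
have [->|h] := eqVneq (eta e p q) 0; first by rewrite !mulr0.
apply: ler_wpM2r; first exact: eta_ge0.
have [] := eta_supp e0 h; rewrite /= !in_itv/= => /andP[h1 h2] /andP[h3 h4].
apply: le_trans (uL q p I I) _; rewrite (_ : 2 * L * e = L * (e + e)); last by ring.
by rewrite ler_wpM2l// lerD// ler_norml; lra.
Qed.

Lemma eta_taylor e (b : R) : 0 < e -> exists C, forall p q d,
  `|eta e p (q.1 + d, q.2 + d * b) - eta e p q - d * (partial false (eta e p) q + b * partial true (eta e p) q)| <= C * d ^+ 2.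
Proof.
move=> e0.
have [C0 C0P] := bump_bounded (1 : {poly R}) 0.
have [C1 C1P] := bump_bounded (dbump (1 : {poly R}) 0) 2.
have [C2 C2P] := bump_taylor (1 : {poly R}) 0.
have C00 : 0 <= C0 by apply: le_trans (C0P 0).
have C10 : 0 <= C1 by apply: le_trans (C1P 0).
have C20 : 0 <= C2 by have := C2P 0 1; rewrite expr1n mulr1; exact: le_trans.
have lip := mvt_lip (is_derive_bump (1 : {poly R}) 0) C1P.
exists ((C1 ^+ 2 * `|b| + C0 * C2 * b ^+ 2 + C0 * C2) / e ^+ 2) => p q d.
rewrite /eta.
have [_ ->] := bump2_derive (1 : {poly R}) 0 1 0 e p false q.
have [_ ->] := bump2_derive (1 : {poly R}) 0 1 0 e p true q.
rewrite /bump2 !bumpZ /=.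
set s1 := (p.1 - q.1) / e; set s2 := (p.2 - q.2) / e.
have -> : (p.1 - (q.1 + d)) / e = s1 + (- (d / e)) by rewrite /s1; field; rewrite gt_eqF.
have -> : (p.2 - (q.2 + d * b)) / e = s2 + (- (d * b / e)) by rewrite /s2; field; rewrite gt_eqF.
have := lip (s1 + - (d / e)) s1; have := lip (s2 + - (d * b / e)) s2.
have := C2P s1 (- (d / e)); have := C2P s2 (- (d * b / e)).
have := C0P s1; have := C0P s2.
have -> : s1 + - (d / e) - s1 = - (d / e) by ring.
have -> : s2 + - (d * b / e) - s2 = - (d * b / e) by ring.
rewrite !normrN.
set A := bump _ _ s1; set A' := bump _ _ (s1 + _); set D := bump _ _ s1.
set B := bump _ _ s2; set B' := bump _ _ (s2 + _); set E := bump _ _ s2.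
move=> hB hA rB rA lB lA.
have -> : A' * B' - A * B - d * (- e^-1 * D * B + b * (A * (- e^-1 * E))) =
  (A' - A) * (B' - B) + A * (B' - B - - (d * b / e) * E) + B * (A' - A - - (d / e) * D) by ring.
have t1 : `|(A' - A) * (B' - B)| <= C1 * `|d / e| * (C1 * `|d * b / e|) by rewrite normrM ler_pM.
have t2 : `|A * (B' - B - - (d * b / e) * E)| <= C0 * (C2 * (- (d * b / e)) ^+ 2) by rewrite normrM ler_pM.
have t3 : `|B * (A' - A - - (d / e) * D)| <= C0 * (C2 * (- (d / e)) ^+ 2) by rewrite normrM ler_pM.
have -> : (C1 ^+ 2 * `|b| + C0 * C2 * b ^+ 2 + C0 * C2) / e ^+ 2 * d ^+ 2 =
  C1 * `|d / e| * (C1 * `|d * b / e|) + C0 * (C2 * (- (d * b / e)) ^+ 2) + C0 * (C2 * (- (d / e)) ^+ 2).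
  rewrite !normrM normfV (gtr0_norm e0) -(real_normK (num_real d)).
  rewrite (_ : (- (d * b / e)) ^+ 2 = `|d| ^+ 2 * b ^+ 2 / e ^+ 2); last first.
    by rewrite real_normK ?num_real//; field; rewrite gt_eqF.
  rewrite (_ : (- (d / e)) ^+ 2 = `|d| ^+ 2 / e ^+ 2); last first.
    by rewrite real_normK ?num_real//; field; rewrite gt_eqF.
  by field; rewrite gt_eqF.
apply: le_trans (ler_normD _ _) _; apply: lerD => //.
by apply: le_trans (ler_normD _ _) _; apply: lerD.
Qed.

Definition back p (b s : R) : R * R := (p.1 - s, p.2 - s * b).

Lemma eta_shift e p (b d : R) q : eta e (back p b d) q = eta e p (q.1 + d, q.2 + d * b).
Proof. by rewrite /eta /bump2 /=; congr (bump _ _ (_ / _) * bump _ _ (_ / _)); ring. Qed.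

Lemma I2_comb (f0 f1 f2 f3 : R * R -> R) (d b F' F0 W1 W2 : R) : bsq f0 -> bsq f1 -> bsq f2 -> bsq f3 ->
  F' = I2 (f0 \+ ((fun q => d * f1 q) \+ ((fun q => d * b * f2 q) \+ f3))) ->
  I2 f0 = F0 -> I2 f1 = - W1 -> I2 f2 = - W2 -> F' - F0 = - d * (W1 + b * W2) + I2 f3.
Proof.
move=> b0 b1 b2 b3 -> <- w1 w2; have b1' := bsqZ d b1; have b2' := bsqZ (d * b) b2.
rewrite I2D ?I2D ?I2Z//; last 2 first.
- exact: bsqD.
- by do ! apply: bsqD.
by rewrite w1 w2; ring.
Qed.

Section Estimate.
Variables (Om : set (R * R)) (L La C : R) (u a wt wx : R * R -> R).
Hypothesis oO : open Om.
Hypothesis uL : M_Lipschitz L setT u.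
Hypothesis aL : M_Lipschitz La setT a.
Hypothesis mwt : measurable_fun setT wt.
Hypothesis mwx : measurable_fun setT wx.
Hypothesis wtC : forall p, `|wt p| <= C.
Hypothesis wxC : forall p, `|wx p| <= C.
Hypothesis rep : forall phi, test_function Om phi ->
      [/\ I2 (fun p => u p * partial false phi p) = - I2 (fun p => wt p * phi p),
          I2 (fun p => u p * partial true phi p) = - I2 (fun p => wx p * phi p) &
          \int[leb2]_(p in Om) ((wt p + a p * wx p) * phi p) = 0].

Let C0 : 0 <= C. Proof. exact: le_trans (wxC (0, 0)). Qed.
Let mO : measurable Om := open_measurable2 oO.
Let bwt e p : 0 < e -> bsq (fun q => wt q * eta e p q).
Proof.
move=> e0; have be := eta_bsq p e0; apply: (bsqS be).
  by apply: measurable_funM => //; case: be.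
by exists C => q; rewrite normrM ler_wpM2r.
Qed.
Let bwx e p : 0 < e -> bsq (fun q => wx q * eta e p q).
Proof.
move=> e0; have be := eta_bsq p e0; apply: (bsqS be).
  by apply: measurable_funM => //; case: be.
by exists C => q; rewrite normrM ler_wpM2r.
Qed.

(** Since u_t = - a u_x, the average of u_t + b u_x is that of (b - a) u_x. *)
Lemma directional_small e p (b : R) : 0 < e -> cube p e `<=` Om ->
  `|I2 (fun q => wt q * eta e p q) + b * I2 (fun q => wx q * eta e p q)| <= C * (`|b - a p| + 2 * La * e) * eta_mass e.
Proof.
move=> e0 pO; have be := eta_bsq p e0; have La0 := lip_ge0 aL.
have tf : test_function Om (eta e p) by exact: bump2_test.
have supp q : eta e p q != 0 -> Om q by move=> /(eta_supp e0) /pO.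
have [_ _] := rep tf; rewrite RintegralOm//; last first.
  by move=> q h; apply: supp; apply: contra_neq h => ->; rewrite mulr0.
move=> eq0.
have bax : bsq (fun q => a q * (wx q * eta e p q)) := bsq_loc aL (bwx p e0).
have eq1 : I2 (fun q => wt q * eta e p q) + I2 (fun q => a q * (wx q * eta e p q)) = 0.
  rewrite -eq0 -I2D//; last exact: bwt.
  by congr I2; apply/funext => q /=; ring.
have -> : I2 (fun q => wt q * eta e p q) = -1 * I2 (fun q => a q * (wx q * eta e p q)).
  by rewrite mulN1r; apply/eqP; rewrite -addr_eq0 eq1.
have bw := bwx p e0.
rewrite -(I2Z (-1) bax) -(I2Z b bw) -I2D; [|exact: bsqZ|exact: bsqZ].
rewrite -(eta_massE p e0) -I2Z//; apply: I2_norm; [|exact: bsqZ|move=> q /=].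
  by apply: bsqD; exact: bsqZ.
rewrite (_ : -1 * _ + _ = (b - a q) * wx q * eta e p q); last by ring.
rewrite normrM (ger0_norm (eta_ge0 _ _ _)).
have [->|h] := eqVneq (eta e p q) 0; first by rewrite !mulr0.
apply: ler_wpM2r; first exact: eta_ge0.
rewrite normrM mulrC; apply: ler_pM => //.
have [] := eta_supp e0 h; rewrite /= !in_itv/= => /andP[h1 h2] /andP[h3 h4].
have := @aL p q I I; have := ler_distD (a p) b (a q).
have : La * (`|p.1 - q.1| + `|p.2 - q.2|) <= La * (e + e).
  by rewrite ler_wpM2l// lerD// ler_norml; lra.
lra.
Qed.

Lemma square_back p (b h s e : R) q : 0 < e -> 0 <= s <= h -> cube (back p b s) e q ->
  square (`|p.1| + `|p.2| + h * (1 + `|b|) + e) q.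
Proof.
move=> e0 /andP[s0 sh] []; rewrite /= !in_itv/= => /andP[h1 h2] /andP[h3 h4].
have hb : `|s * b| <= h * `|b| by rewrite normrM (ger0_norm s0) ler_wpM2r.
have h0 : 0 <= h by exact: le_trans sh.
have hb0 : 0 <= h * `|b| by rewrite mulr_ge0.
move: hb; rewrite ler_norml => /andP[hb1 hb2].
have n1 := ler_norm p.1; have n2 := ler_norm p.2.
have n3 := ler_norm (- p.1); have n4 := ler_norm (- p.2); rewrite !normrN in n3 n4.
have n5 := normr_ge0 p.1; have n6 := normr_ge0 p.2.
by split; rewrite /= in_itv/=; lra.
Qed.

Lemma coef_back p (b h s : R) : 0 <= s <= h -> `|b - a (back p b s)| <= `|b - a p| + La * (1 + `|b|) * h.
Proof.
move=> /andP[s0 s1]; have La0 := lip_ge0 aL.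
have := @aL p (back p b s) I I; have := ler_distD (a p) b (a (back p b s)).
have : La * (`|p.1 - (back p b s).1| + `|p.2 - (back p b s).2|) <= La * (h + h * `|b|).
  rewrite ler_wpM2l// /back /=.
  rewrite (_ : p.1 - (p.1 - s) = s); last by ring.
  rewrite (_ : p.2 - (p.2 - s * b) = s * b); last by ring.
  by rewrite normrM (ger0_norm s0) lerD// ler_wpM2r.
lra.
Qed.

Lemma average_combine (U U' F0 Fh j k D : R) : 0 < j ->
  `|F0 - U * j| <= D * j -> `|Fh - U' * j| <= D * j -> `|Fh - F0| <= k * j -> `|U - U'| <= 2 * D + k.
Proof.
move=> j0 h0 h1 h2; rewrite -(ler_pM2r j0).
have <- : `|(U - U') * j| = `|U - U'| * j by rewrite normrM (gtr0_norm j0).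
have -> : (U - U') * j = (U * j - F0) + (F0 - Fh) + (Fh - U' * j) by ring.
have := ler_normD (U * j - F0 + (F0 - Fh)) (Fh - U' * j).
have := ler_normD (U * j - F0) (F0 - Fh).
rewrite (distrC _ F0) (distrC F0 Fh); lra.
Qed.

(** Let F s be the average of u around p - s (1, b). A Taylor expansion of the
    mollifier expresses the increments of F through the weak derivatives of u
    tested against the mollifier, hence through [directional_small], up to a
    quadratic error that [subdivide] removes. *)
Lemma mollified_semilag p (b h e : R) : 0 < e -> 0 <= h ->
  (forall s, 0 <= s <= h -> cube (back p b s) e `<=` Om) ->
  `|u p - u (back p b h)| <= 4 * L * e + h * (C * (`|b - a p| + La * (1 + `|b|) * h + 2 * La * e)).
Proof.
move=> e0 h0 sO; have L0 := lip_ge0 uL; have La0 := lip_ge0 aL.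
have J0 := eta_mass_gt0 e0.
pose F s := I2 (fun q => u q * eta e (back p b s) q).
pose kap := C * (`|b - a p| + La * (1 + `|b|) * h + 2 * La * e) * eta_mass e.
pose N := `|p.1| + `|p.2| + h * (1 + `|b|) + e.
have N0 : 0 <= N by rewrite !addr_ge0 ?mulr_ge0 ?addr_ge0// ltW.
have [Ct CtP] := eta_taylor b e0.
pose V := I2 (fun q => 1 * \1_(square N) q).
pose Cu := `|u (0, 0)| + L * (N + N).
have Cu0 : 0 <= Cu by rewrite addr_ge0// mulr_ge0// addr_ge0.
have key : `|F h - F 0| <= kap * h.
  apply: (@subdivide F h kap (Cu * Ct * V) h0) => s s' sh sh'.
  set d := s' - s; set ps := back p b s.
  have bs : back p b s' = back ps b d by rewrite /back /ps /d /=; congr pair; ring.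
  pose r q := eta e ps (q.1 + d, q.2 + d * b) - eta e ps q - d * (partial false (eta e ps) q + b * partial true (eta e ps) q).
  have be := eta_bsq ps e0; have be' := eta_bsq (back p b s') e0.
  have bd0 := deta_bsq ps false e0; have bd1 := deta_bsq ps true e0.
  have bue : bsq (fun q => u q * eta e ps q) := bsq_loc uL be.
  have bue' : bsq (fun q => u q * eta e (back p b s') q) := bsq_loc uL be'.
  have bu0 : bsq (fun q => u q * partial false (eta e ps) q) := bsq_loc uL bd0.
  have bu1 : bsq (fun q => u q * partial true (eta e ps) q) := bsq_loc uL bd1.
  have gen1 (U X Y Z W D B : R) : U * (X - Y - D * (Z + B * W)) = U * X + -1 * (U * Y) + (- D * (U * Z) + - D * B * (U * W)) by ring.
  have gen2 (U X Y Z W D B : R) : U * X = U * Y + (D * (U * Z) + (D * B * (U * W) + U * (X - Y - D * (Z + B * W)))) by ring.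
  have gen3 (X Y Z r0 D B : R) : X + (D * - Y + (D * B * - Z + r0)) - X = - D * (Y + B * Z) + r0 by ring.
  have bur : bsq (fun q => u q * r q).
    have -> : (fun q => u q * r q) = ((fun q => u q * eta e (back p b s') q) \+ (fun q => -1 * (u q * eta e ps q)))
       \+ ((fun q => - d * (u q * partial false (eta e ps) q)) \+ (fun q => (- d * b) * (u q * partial true (eta e ps) q))).
      by apply/funext => q; rewrite /r /= bs eta_shift; exact: gen1.
    by do ! apply: bsqD => //; exact: bsqZ.
  have [w1 w2 _] : [/\ I2 (fun p => u p * partial false (eta e ps) p) = - I2 (fun p => wt p * eta e ps p),
          I2 (fun p => u p * partial true (eta e ps) p) = - I2 (fun p => wx p * eta e ps p) &
          \int[leb2]_(p in Om) ((wt p + a p * wx p) * eta e ps p) = 0].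
    by apply: rep; apply: bump2_test => //; exact: sO.
  have FE : F s' - F s = - d * (I2 (fun q => wt q * eta e ps q) + b * I2 (fun q => wx q * eta e ps q)) + I2 (fun q => u q * r q).
    have H : F s' = I2 ((fun q => u q * eta e ps q) \+ ((fun q => d * (u q * partial false (eta e ps) q)) \+ ((fun q => (d * b) * (u q * partial true (eta e ps) q)) \+ (fun q => u q * r q)))).
      by congr I2; apply/funext => q; rewrite /r /= bs eta_shift; exact: gen2.
    exact (I2_comb bue bu0 bu1 bur H (erefl (F s)) w1 w2).
  rewrite FE; apply: le_trans (ler_normD _ _) _; apply: lerD.
    rewrite normrM normrN mulrC ler_wpM2r//.
    apply: le_trans (directional_small b e0 (sO s sh)) _.
    apply: ler_wpM2r; first exact: ltW.
    by apply: ler_wpM2l => //; rewrite lerD2r; exact: coef_back.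
  have -> : Cu * Ct * V * d ^+ 2 = (Cu * Ct * d ^+ 2) * V by ring.
  rewrite /V -I2Z; last exact: bsq_indic.
  apply: I2_norm => //; first by apply: bsqZ; exact: bsq_indic.
  move=> q; rewrite mul1r indicE; case: (boolP (q \in square N)); last first.
    move=> /negP qN; suff -> : r q = 0 by rewrite !mulr0 normr0.
    have no ss : 0 <= ss <= h -> eta e (back p b ss) q = 0.
      move=> ssh; apply/eqP/negPn/negP => /(eta_supp e0) /(square_back e0 ssh) sq.
      by apply: qN; rewrite inE.
    have nod i : partial i (eta e ps) q = 0.
      have [_ ->] := bump2_derive (1 : {poly R}) 0 1 0 e ps i q.
      apply/eqP/negPn/negP; case: i => /(bump2_supp e0) /(square_back e0 sh) sq; apply: qN; by rewrite inE.
    by rewrite /r -eta_shift -bs !no// !nod !mulr0 addr0 mulr0 !subr0.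
  rewrite inE => qN; rewrite mulr1 normrM -mulrA; apply: ler_pM => //.
    exact: lip_square uL qN.
  exact: CtP.
have a0 := eta_average (back p b 0) uL e0; have ah := eta_average (back p b h) uL e0.
have b00 : back p b 0 = p by rewrite /back mul0r !subr0; case: (p).
rewrite -/(F 0) b00 in a0; rewrite -/(F h) in ah.
have kE : kap * h = (h * (C * (`|b - a p| + La * (1 + `|b|) * h + 2 * La * e))) * eta_mass e.
  by rewrite /kap mulrAC; congr (_ * _); rewrite mulrC.
rewrite kE in key.
have := average_combine J0 a0 ah key.
by rewrite (_ : 2 * (2 * L * e) = 4 * L * e); last by ring.
Qed.

(** The radius of the average tends to 0. *)
Lemma interior_semilag p (b h e0 : R) : 0 < e0 -> 0 <= h ->
  (forall s, 0 <= s <= h -> cube (back p b s) e0 `<=` Om) ->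
  `|u p - u (back p b h)| <= h * (C * (`|b - a p| + La * (1 + `|b|) * h)).
Proof.
move=> e00 h0 sO.
apply: (@le_archi _ _ _ (4 * L * e0 + h * C * 2 * La * e0)) => n.
pose e := e0 / n.+1%:R.
have e1 : 0 < e by rewrite divr_gt0.
have ee : e <= e0 by rewrite ler_pdivrMr// ler_peMr ?ler1n// ltW.
apply: le_trans (mollified_semilag e1 h0 _) _.
  move=> s sh; apply: subset_trans (sO s sh) => q [] /=; rewrite !in_itv/= => /andP[? ?] /andP[? ?].
  by split; rewrite /= in_itv/=; lra.
rewrite /e; move: (n.+1%:R^-1) => r; lra.
Qed.
End Estimate.
End Interior.

Section Strip.
Context {R : realType}.
Implicit Types (f g u a phi : R * R -> R) (p q z : R * R).

Lemma open_strip_open (T : \bar R) : open (open_strip T).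
Proof.
have -> : open_strip T = (fst @^-1` [set t : R | 0 < t]) `&` (fst @^-1` [set t : R | (t%:E < T)%E]) `&`
   ((snd @^-1` [set x : R | 0 < x]) `&` (snd @^-1` [set x : R | x < 1])).
  by apply/seteqP; split => p /=; [move=> [? ? ? ?]|move=> [[? ?] [? ?]]].
have cf : continuous (fst : R * R -> R) by move=> p; exact: cvg_fst.
have cs : continuous (snd : R * R -> R) by move=> p; exact: cvg_snd.
apply: openI; apply: openI.
- by move/continuousP : cf; apply; exact: open_gt.
- move/continuousP : cf; apply; case: T => [r| |].
  + rewrite (_ : [set t | _] = [set t : R | t < r]); first exact: open_lt.
    by apply/seteqP; split => t /=; rewrite lte_fin.
  + rewrite (_ : [set t | _] = setT); first exact: openT.
    by apply/seteqP; split => t //= _; exact: ltry.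
  + rewrite (_ : [set t | _] = set0); first exact: open0.
    by apply/seteqP; split => t //=.
- by move/continuousP : cs; apply; exact: open_gt.
- by move/continuousP : cs; apply; exact: open_lt.
Qed.

(** The weak equation is local, and only involves the values of u and a on the
    open set. *)
Lemma transport_eq_sub (Om Om' : set (R * R)) a a' u u' : open Om -> open Om' -> Om' `<=` Om ->
  (forall p, Om' p -> u p = u' p) -> (forall p, Om' p -> a p = a' p) ->
  transport_eq Om a u -> transport_eq Om' a' u'.
Proof.
move=> oO oO' OO uu aa [ut [ux [wt wx eq0]]].
have mO := open_measurable2 oO; have mO' := open_measurable2 oO'.
have tt phi : test_function Om' phi -> test_function Om phi.
  by move=> [h1 h2 h3]; split => //; exact: subset_trans OO.
have wp i w : weak_partial i Om u w -> weak_partial i Om' u' w.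
  move=> [mw Lw H]; split.
  - exact: (measurable_funS mO OO mw).
  - apply: le_lt_trans Lw; rewrite /Linfty_norm unlock leb2_gt0.
    apply: le_ess_sup; apply: aeW => p /=; rewrite /patch.
    case: ifPn => [|_]; last by rewrite abse0; exact: abse_ge0.
    by rewrite inE => /OO Op; rewrite mem_set.
  move=> phi tphi; have [N [B [cphi bphi bd supp [dsupp ds lip sq]]]] := test_facts tphi.
  have := H phi (tt phi tphi).
  rewrite !RintegralOm//;
    try (by move=> p h; try apply: OO;
      first [apply: supp; apply: contra_neq h => ->; by rewrite mulr0
            |apply: (dsupp i); apply: contra_neq h => ->; by rewrite mulr0]).
  move=> eqI; rewrite -eqI; congr I2; apply/funext => p.
  have [->|/dsupp Op] := eqVneq (partial i phi p) 0; first by rewrite !mulr0.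
  by rewrite uu.
exists ut, ux; split; [exact: wp|exact: wp|].
move=> phi tphi; have [N [B [cphi bphi bd supp [dsupp ds lip sq]]]] := test_facts tphi.
have := eq0 phi (tt phi tphi).
rewrite !RintegralOm//; first last.
- by move=> p h; apply: OO; apply: supp; apply: contra_neq h => ->; rewrite mulr0.
- by move=> p h; apply: supp; apply: contra_neq h => ->; rewrite mulr0.
move=> <-; congr I2; apply/funext => p.
have [->|/supp Op] := eqVneq (phi p) 0; first by rewrite !mulr0.
by rewrite aa.
Qed.

Lemma err_mono (hn h C D D' k m m' : R) : 0 <= hn <= h -> 0 <= C -> 0 <= D <= D' -> 0 <= k -> 0 <= m <= m' ->
  hn * (C * (D + k * m * hn)) <= h * (C * (D' + k * m' * h)).
Proof.
move=> /andP[hn0 hnh] C0 /andP[D0 DD] k0 /andP[m0 mm].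
apply: ler_pM => //; first by rewrite mulr_ge0// addr_ge0// !mulr_ge0.
rewrite ler_wpM2l// lerD//; apply: ler_pM => //; first exact: mulr_ge0.
exact: ler_wpM2l.
Qed.

Lemma err_sum (x y x' y' P h C D k m r N : R) : `|x - x'| <= P * r -> `|x' - y'| <= h * (C * (D + k * r + m)) ->
  `|y' - y| <= P * r -> r <= N -> 0 <= P -> 0 <= h * C * k ->
  `|x - y| <= h * (C * (D + m)) + (2 * P + h * C * k) * N.
Proof.
move=> d1 d2 d3 rN P0 Q0.
have t1 := ler_distD x' x y; have t2 := ler_distD y' x' y.
have k1 : (2 * P + h * C * k) * r <= (2 * P + h * C * k) * N by rewrite ler_wpM2l// addr_ge0// mulr_ge0.
lra.
Qed.

(** The other half of the equivalence. A segment of the closed strip is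
    contracted by the factor 1 - r towards the centre (T / 2, 1 / 2), which
    brings a neighbourhood of it into the open strip; then r tends to 0. *)
Lemma strip_semilag (T L La M : R) u a : 0 < T -> M_Lipschitz L setT u -> M_Lipschitz La setT a ->
  transport_eq (open_strip T%:E) a u ->
  exists2 A, 0 <= A & forall t x h b, 0 <= h -> h <= t -> t <= T -> 0 <= x <= 1 -> 0 <= x - h * b <= 1 -> `|b| <= M ->
    `|u (t, x) - u (t - h, x - h * b)| <= A * h * (h + `|b - a (t, x)|).
Proof.
move=> T0 uL aL tr.
have L0 := lip_ge0 uL; have La0 := lip_ge0 aL.
have oO : open (open_strip T%:E) by exact: open_strip_open.
have ma : measurable_fun (open_strip T%:E) a.
  by apply: measurable_funTS; apply: continuous_measurable2; exact: M_Lipschitz_continuous aL.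
have [wt [wx [C [mwt mwx wtC wxC rep]]]] := transport_eq_rep oO ma tr.
have C0 : 0 <= C by exact: le_trans (wxC (0, 0)).
exists (C * (1 + La * (1 + `|M|))) => [|t x h b h0 ht tT x01 xb01 bM].
  by rewrite mulr_ge0// addr_ge0// mulr_ge0// addr_ge0.
have b1 : `|b| <= `|M| by apply: le_trans bM (ler_norm _).
apply: (@le_trans _ _ (h * (C * (`|b - a (t, x)| + La * (1 + `|M|) * h)))); last first.
  rewrite -subr_ge0.
  have -> : C * (1 + La * (1 + `|M|)) * h * (h + `|b - a (t, x)|) - h * (C * (`|b - a (t, x)| + La * (1 + `|M|) * h))
    = C * h * (h + La * (1 + `|M|) * `|b - a (t, x)|) by ring.
  by rewrite mulr_ge0 ?mulr_ge0// addr_ge0// ?mulr_ge0// addr_ge0.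
apply: (@le_archi _ _ _ (2 * L * (T + 1) + h * C * (La * (T + 1)))) => n.
have [r [r0 r1 rr]] : exists r : R, [/\ 0 < r, r < 1 & r <= n.+1%:R^-1].
  have rS : n.+1%:R^-1 <= 1 :> R by rewrite invf_le1// ler1n.
  have rS0 : 0 < n.+1%:R^-1 :> R by rewrite invr_gt0.
  exists (n.+1%:R^-1 / 2); move: rS rS0; move: (n.+1%:R^-1) => z z1 z0; clear -z1 z0; split; lra.
(* The contracted end point and duration; the slope b is kept. *)
pose tn := t + r * (T / 2 - t); pose xn := x + r * (1 / 2 - x); pose hn := (1 - r) * h.
pose e0 := r * Num.min T 1 / 2.
have mT : 0 < Num.min T 1 by rewrite lt_min T0 ltr01.
have e00 : 0 < e0 by rewrite divr_gt0 ?mulr_gt0.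
have hn0 : 0 <= hn by rewrite mulr_ge0// subr_ge0 ltW.
have mT1 : Num.min T 1 <= 1 by rewrite ge_min lexx orbT.
have mTT : Num.min T 1 <= T by rewrite ge_min lexx.
have eT : e0 <= r * T / 2.
  by rewrite /e0 ler_pM2r ?invr_gt0// ler_pM2l.
have e1 : e0 <= r / 2 by rewrite /e0 ler_pM2r ?invr_gt0// ler_piMr// ltW.
have sub s : 0 <= s <= hn -> cube (back (tn, xn) b s) (e0 / 2) `<=` open_strip T%:E.
  move=> /andP[s0 s1] q [] /=; rewrite !in_itv/= => /andP[q1 q2] /andP[q3 q4].
  pose s' := s / (1 - r).
  have r10 : 0 < 1 - r by rewrite subr_gt0.
  have ss : s = (1 - r) * s' by rewrite /s' mulrC divfK// gt_eqF.
  have s'0 : 0 <= s' by rewrite divr_ge0// ltW.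
  have s'h : s' <= h by rewrite /s' ler_pdivrMr// mulrC.
  have ts0 : 0 <= (1 - r) * (t - s') by rewrite mulr_ge0 ?(ltW r10)// subr_ge0 (le_trans s'h).
  have tsT : (1 - r) * (t - s') <= (1 - r) * T by rewrite ler_pM2l//; clear -s'0 tT; lra.
  have hb01 : 0 <= x - s' * b <= 1.
    have [b0|b0] := lerP 0 b.
      have : s' * b <= h * b by rewrite ler_wpM2r.
      have : 0 <= s' * b by rewrite mulr_ge0.
      by clear -x01 xb01; lra.
    have : h * b <= s' * b by rewrite ler_wnM2r// ltW.
    have : s' * b <= 0 by rewrite mulr_ge0_le0// ltW.
    by clear -x01 xb01; lra.
  have /andP[hb0 hb1] := hb01.
  have xs0 : 0 <= (1 - r) * (x - s' * b) by rewrite mulr_ge0// ltW.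
  have xs1 : (1 - r) * (x - s' * b) <= (1 - r) * 1 by rewrite ler_pM2l.
  have tE : tn - s = (1 - r) * (t - s') + r * T / 2 by rewrite /tn ss; ring.
  have xE : xn - s * b = (1 - r) * (x - s' * b) + r / 2 by rewrite /xn ss; ring.
  move: q1 q2 q3 q4; rewrite tE xE => q1 q2 q3 q4.
  split => /=; rewrite ?lte_fin; clear -q1 q2 q3 q4 ts0 tsT xs0 xs1 eT e1 e00 r0 T0; lra.
have e20 : 0 < e0 / 2 by rewrite divr_gt0.
have := @interior_semilag R _ L La C u a wt wx oO uL aL mwt mwx wtC wxC rep (tn, xn) b hn (e0 / 2) e20 hn0 sub.
rewrite /back /=.
clearbody e0.
have tT2 : `|T / 2 - t| <= T by rewrite ler_norml; clear -h0 ht tT; lra.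
have x12 : `|1 / 2 - x| <= 1 by rewrite ler_norml; clear -x01; lra.
have d1 : `|u (t, x) - u (tn, xn)| <= L * (T + 1) * r.
  apply: le_trans (uL _ _ I I) _ => /=.
  rewrite (_ : t - tn = - (r * (T / 2 - t))); last by rewrite /tn; ring.
  rewrite (_ : x - xn = - (r * (1 / 2 - x))); last by rewrite /xn; ring.
  rewrite !normrN !normrM (gtr0_norm r0) -mulrDr -mulrA (mulrC r); apply: ler_wpM2l => //.
  by rewrite ler_wpM2r ?(ltW r0)// lerD.
have d2 : `|u (t - h, x - h * b) - u (tn - hn, xn - hn * b)| <= L * (T + 1) * r.
  apply: le_trans (uL _ _ I I) _ => /=.
  rewrite (_ : t - h - (tn - hn) = - (r * (T / 2 - (t - h)))); last by rewrite /tn /hn; ring.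
  rewrite (_ : x - h * b - (xn - hn * b) = - (r * (1 / 2 - (x - h * b)))); last by rewrite /xn /hn; ring.
  rewrite !normrN !normrM (gtr0_norm r0) -mulrDr -mulrA (mulrC r); apply: ler_wpM2l => //.
  by rewrite ler_wpM2r ?(ltW r0)// lerD// ler_norml; clear -h0 ht tT xb01; lra.
have d3 : `|b - a (tn, xn)| <= `|b - a (t, x)| + La * (T + 1) * r.
  have := ler_distD (a (t, x)) b (a (tn, xn)).
  have : `|a (t, x) - a (tn, xn)| <= La * (T + 1) * r.
    apply: le_trans (aL _ _ I I) _ => /=.
    rewrite (_ : t - tn = - (r * (T / 2 - t))); last by rewrite /tn; ring.
    rewrite (_ : x - xn = - (r * (1 / 2 - x))); last by rewrite /xn; ring.
    rewrite !normrN !normrM (gtr0_norm r0) -mulrDr -mulrA (mulrC r); apply: ler_wpM2l => //.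
    by rewrite ler_wpM2r ?(ltW r0)// lerD.
  clear; lra.
have hnh : hn <= h by rewrite /hn ler_piMl// gerBl ltW.
have d4 : hn * (C * (`|b - a (tn, xn)| + La * (1 + `|b|) * hn)) <= h * (C * (`|b - a (t, x)| + La * (T + 1) * r + La * (1 + `|M|) * h)).
  have d3' : 0 <= `|b - a (tn, xn)| <= `|b - a (t, x)| + La * (T + 1) * r by rewrite normr_ge0.
  by apply: err_mono; rewrite ?hn0 ?hnh ?addr_ge0 ?lerD2l.
move=> d5; rewrite -(mulrA 2); apply: (err_sum d1 (le_trans d5 d4) _ rr).
- by rewrite distrC.
- by rewrite mulr_ge0// addr_ge0// ltW.
- by rewrite !mulr_ge0// addr_ge0// ltW.
Qed.

End Strip.

(** * Smooth functions on a square *)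

Section Smooth.
Context {R : realType}.
Implicit Types (f : R * R -> R) (p q : R * R).

Lemma smooth_line f (i : bool) p : smooth f -> is_derive (coord i p) (1 : R) (fun s => f (line i p s)) (partial i f p).
Proof. by move=> sf; apply: derive_line; have [_] := sf [::]; exact. Qed.

(** Mean value theorem along the two sides of a rectangle. *)
Lemma smooth_lip f (N B : R) : smooth f -> (forall i p, square N p -> `|partial i f p| <= B) ->
  forall p q, square N p -> square N q -> `|f p - f q| <= B * (`|p.1 - q.1| + `|p.2 - q.2|).
Proof.
move=> sf fB.
have key i p s s' : s <= s' -> square N (line i p s) -> square N (line i p s') ->
    `|f (line i p s') - f (line i p s)| <= B * `|s' - s|.
  move=> ss h1 h2; rewrite [X in _ <= _ * X]ger0_norm ?subr_ge0//.
  have d (z : R) : is_derive z (1 : R) (fun s => f (line i p s)) (partial i f (line i p z)).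
    have := smooth_line i (line i p z) sf.
    by rewrite coord_line (_ : (fun s0 => _) = (fun s => f (line i p s))) //; apply/funext => s0; rewrite line_line.
  apply: (@mvt_itv _ (fun s => f (line i p s)) _ s s' B ss (fun (z : R) _ => d z)).
    by apply: derivable_within_continuous => z _; case: (d z).
  move=> z /andP[z1 z2]; apply: fB; move: h1 h2 => [] /=; rewrite ?in_itv/= => h1 h2 [] /=; rewrite ?in_itv/= => h3 h4.
  by case: i h1 h2 h3 h4 {d} => /= h1 h2 h3 h4; split; rewrite /= in_itv/=; lra.
have key2 i p s s' : square N (line i p s) -> square N (line i p s') ->
    `|f (line i p s) - f (line i p s')| <= B * `|s - s'|.
  move=> h1 h2; case/orP: (le_total s s') => ss; last exact: key.
  by rewrite distrC (distrC s); exact: key.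
move=> [p1 p2] [q1 q2] sp sq.
have sm : square N (q1, p2) by move: sp sq => [? ?] [? ?]; split.
have e1 := key2 false (p1, p2) p1 q1 sp sm.
have e2 := key2 true (q1, p2) p2 q2 sm sq.
by have := ler_distD (f (q1, p2)) (f (p1, p2)) (f (q1, q2)); rewrite /line /= in e1 e2 *; lra.
Qed.

Lemma square_bounded f (N : R) : continuous f -> exists2 B, 0 <= B & forall p, square N p -> `|f p| <= B.
Proof.
move=> cf.
have cK : compact (square N) by apply: compact_setX; exact: segment_compact.
have cfK : compact (f @` square N).
  by apply: continuous_compact => //; exact: continuous_subspaceT.
have [M [_ MK]] := compact_bounded cfK.
exists `|M + 1| => // p Kp; apply: le_trans (ler_norm _).
by apply: (MK (M + 1) (ltr_pwDr ltr01 (lexx M)) (f p)); exists p.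
Qed.

Lemma C0_norm_ge f (N : R) : continuous f -> forall p, square N p -> `|f p| <= C0_norm N f.
Proof.
move=> cf p sp; have [B B0 fB] := square_bounded N cf.
have h1 : (`|f p|%:E <= sup_norm (square N) f)%E by apply: ereal_sup_ubound; exists p.
have h2 : (sup_norm (square N) f <= B%:E)%E.
  by apply: ge_ereal_sup => _ [q sq <-]; rewrite lee_fin; exact: fB.
rewrite /C0_norm -/(square N) -lee_fin fineK//.
by rewrite fin_numElt (lt_le_trans (ltNyr _) h1) (le_lt_trans h2 (ltry _)).
Qed.

Lemma smooth_loc_lip f (N : R) : smooth f ->
  exists2 B, 0 <= B & forall p q, square N p -> square N q -> `|f p - f q| <= B * (`|p.1 - q.1| + `|p.2 - q.2|).
Proof.
move=> sf.
have c1 i : continuous (partial i f) by have [] := sf [:: i].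
have [B0 B00 B0P] := square_bounded N (c1 false); have [B1 B10 B1P] := square_bounded N (c1 true).
exists (B0 + B1); first exact: addr_ge0.
apply: smooth_lip => // -[] p sp.
  by apply: le_trans (B1P p sp) _; rewrite lerDr.
by apply: le_trans (B0P p sp) _; rewrite lerDl.
Qed.
End Smooth.

(** * The boundary feedback *)

Section Feedback.
Context {R : realType}.
Variables (K gamma : R).
Hypothesis K0 : 0 < K.
Hypothesis g0 : 0 < gamma.
Hypothesis g1 : gamma < 1.

Let q := (1 - gamma)^-1.
Let g1' : 0 < 1 - gamma. Proof. by rewrite subr_gt0. Qed.
Let q0 : 0 < q. Proof. by rewrite invr_gt0. Qed.
Let gq : gamma * q = q - 1. Proof. by rewrite /q; field; rewrite gt_eqF. Qed.
Let gq0 : 0 < gamma * q. Proof. exact: mulr_gt0. Qed.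

Lemma signed_pow_homo (x y : R) : x <= y -> Num.sg x * `|x| `^ gamma <= Num.sg y * `|y| `^ gamma.
Proof.
have mono (a b : R) : 0 <= a -> a <= b -> a `^ gamma <= b `^ gamma.
  by move=> a0 ab; apply: ge0_ler_powR; rewrite ?nnegrE// ?(ltW g0)// (le_trans a0 ab).
move=> xy; case: (ltrgt0P x) => [x0|x0|x0].
- have y0 := lt_le_trans x0 xy.
  by rewrite !gtr0_sg// !mul1r !gtr0_norm//; apply: mono => //; exact: ltW.
- have [y0|y0] := lerP 0 y.
    apply: (@le_trans _ _ 0); first by rewrite ltr0_sg// mulN1r oppr_le0 powR_ge0.
    by rewrite mulr_ge0 ?powR_ge0 ?sgr_ge0.
  rewrite !ltr0_sg// !mulN1r lerN2 !ltr0_norm//; apply: mono; first by rewrite oppr_ge0 ltW.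
  by rewrite lerN2.
- by rewrite x0 sgr0 mul0r mulr_ge0 ?powR_ge0// sgr_ge0 -x0.
Qed.

Lemma feedback_nonincreasing (x y : R) : x <= y -> feedback K gamma y <= feedback K gamma x.
Proof. by move=> xy; rewrite /feedback !mulNr lerN2 -!mulrA ler_pM2l// signed_pow_homo. Qed.

(** The feedback is not Lipschitz at 0, but it is nonincreasing, so that the
    squared distance of two solutions does not increase. *)
Lemma feedback_unique (T : R) (y1 y2 : R -> R) :
  {within `[0, T], continuous y1} -> {within `[0, T], continuous y2} ->
  (forall t, 0 < t < T -> is_derive t (1 : R) y1 (feedback K gamma (y1 t))) ->
  (forall t, 0 < t < T -> is_derive t (1 : R) y2 (feedback K gamma (y2 t))) ->
  y1 0 = y2 0 -> forall t, 0 <= t <= T -> y1 t = y2 t.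
Proof.
move=> c1 c2 d1 d2 y0 t /andP[t0 tT].
move: t0; rewrite le_eqVlt => /predU1P[<-//|t0].
pose f s := (y1 s - y2 s) ^+ 2.
pose df s := 2 * (y1 s - y2 s) * (feedback K gamma (y1 s) - feedback K gamma (y2 s)).
have sub : `[0, t] `<=` `[0, T].
  by move=> s /=; rewrite !in_itv/= => /andP[-> st]; exact: le_trans tT.
have df_ (s : R) : s \in `]0, t[ -> is_derive s (1 : R) f (df s).
  rewrite in_itv/= => /andP[s0 st]; have sT : 0 < s < T by rewrite s0 (lt_le_trans st).
  have e1 := d1 s sT; have e2 := d2 s sT.
  rewrite /f; apply: is_derive_eq; rewrite /df /GRing.scale/=; ring.
have cf : {within `[0, t], continuous f}.
  have c1' := continuous_subspaceW sub c1; have c2' := continuous_subspaceW sub c2.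
  have -> : f = (fun s => (y1 s - y2 s) * (y1 s - y2 s)) by apply/funext => s; rewrite /f expr2.
  by move=> s; have cd := cvgB (c1' s) (c2' s); exact: (cvgM (cd _) (cd _)).
have [s _ fE] := MVT t0 df_ cf.
have dfle : df s <= 0.
  rewrite /df -mulrA pmulr_rle0//.
  have [h|h] := lerP (y1 s) (y2 s).
    by apply: mulr_le0_ge0; [rewrite subr_le0|rewrite subr_ge0 feedback_nonincreasing].
  by apply: mulr_ge0_le0; [rewrite subr_ge0 ltW|rewrite subr_le0 feedback_nonincreasing// ltW].
have f0 : f 0 = 0 by rewrite /f y0 subrr expr0n.
have : f t - f 0 <= 0 by rewrite fE subr0 mulr_le0_ge0// ltW.
rewrite f0 subr0 /f => h; apply/eqP; rewrite -subr_eq0 -sqrf_eq0; apply/eqP/le_anti.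
by rewrite h sqr_ge0.
Qed.

Let P (s : R) := (Num.max 0 s) `^ q.

Let P0 s : s <= 0 -> P s = 0.
Proof. by move=> s0; rewrite /P max_l// powR0// gt_eqF. Qed.

Let PE s : P s `^ gamma = (Num.max 0 s) `^ (gamma * q).
Proof. by rewrite /P -powRrM mulrC. Qed.

(** The exponent q = 1 / (1 - gamma) exceeds 1, hence differentiability at 0. *)
Let is_derive_P (s : R) : is_derive s (1 : R) P (q * P s `^ gamma).
Proof.
case: (ltrgtP s 0) => s0.
- rewrite P0 ?ltW// powR0 ?gt_eqF// mulr0.
  apply: (@near_eq_is_derive _ R R (cst (0 : R))).
  near=> r; rewrite P0//=; apply: ltW; near: r; exact: lt_nbhsl.
- apply: (@near_eq_is_derive _ R R (fun r : R => r `^ q)).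
    by near=> r; rewrite /P max_r//; apply: ltW; near: r; exact: lt_nbhsr.
  by rewrite PE max_r ?ltW// gq; exact: is_derive1_powR.
rewrite s0 P0// powR0 ?gt_eqF// mulr0.
have C : (fun h : R => h^-1 *: (P (h *: (1 : R) + 0) - P 0)) @ 0^' --> (0 : R).
  apply/cvgrPdist_le => e e0.
  pose d := e `^ (gamma * q)^-1.
  have d0 : 0 < d by exact: powR_gt0.
  near=> h.
  have hn0 : h != 0 by near: h; exact: nbhs_dnbhs_neq.
  have hd : `|h| < d by near: h; apply: dnbhs0_lt.
  rewrite sub0r normrN (P0 (lexx 0)) subr0 addr0 /GRing.scale/= mulr1.
  have [h0|h0] := lerP h 0; first by rewrite P0// mulr0 normr0 ltW.
  have -> : P h = h * h `^ (gamma * q).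
    rewrite /P max_r ?ltW// gq -[X in X * _](powRr1 (ltW h0)) -powRD; last by rewrite (gt_eqF h0) implybT.
    by rewrite addrC subrK.
  rewrite mulrA mulVf// mul1r ger0_norm ?powR_ge0//.
  rewrite (_ : e = d `^ (gamma * q)); last by rewrite /d -powRrM mulVf ?gt_eqF// powRr1// ltW.
  by apply: ge0_ler_powR; rewrite ?nnegrE ?(ltW gq0) ?(ltW d0) ?(ltW h0)//; move: hd; rewrite gtr0_norm// => /ltW.
apply: DeriveDef; first by apply/cvg_ex; exists 0.
exact: cvg_lim C.
Unshelve. all: by end_near.
Qed.

(** Separation of variables: |y|^(1 - gamma) decreases at the constant rate (1 -
    gamma) K until it vanishes. *)
Definition feedback_flow (y0 t : R) := Num.sg y0 * P (`|y0| `^ (1 - gamma) - (1 - gamma) * K * t).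

Lemma feedback_flow0 y0 : feedback_flow y0 0 = y0.
Proof.
rewrite /feedback_flow mulr0 subr0 /P max_r ?powR_ge0// -powRrM divff ?gt_eqF// powRr1//.
by rewrite -numEsg.
Qed.

Lemma is_derive_flow y0 (t : R) : is_derive t (1 : R) (feedback_flow y0) (feedback K gamma (feedback_flow y0 t)).
Proof.
set z0 := `|y0| `^ (1 - gamma).
have dz : is_derive t (1 : R) (fun s => z0 - (1 - gamma) * K * s) (- ((1 - gamma) * K)).
  by apply: is_derive_eq; rewrite /GRing.scale/=; ring.
have dP := is_derive_P (z0 - (1 - gamma) * K * t).
have dc := @is_derive1_comp R P (fun s => z0 - (1 - gamma) * K * s) t _ _ dP dz.
have dd : is_derive t (1 : R) (feedback_flow y0) (Num.sg y0 * (q * P (z0 - (1 - gamma) * K * t) `^ gamma * - ((1 - gamma) * K))).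
  exact: (is_deriveZ (Num.sg y0) dc).
apply: is_derive_eq dd _.
rewrite /feedback_flow -/z0; set p := P _.
rewrite /feedback sgrM normrM.
have p0 : 0 <= p by exact: powR_ge0.
have -> : q * p `^ gamma * - ((1 - gamma) * K) = - (K * p `^ gamma).
  by rewrite /q; field; rewrite gt_eqF.
rewrite sgr_id; have [pp|pp] := eqVneq p 0.
  by rewrite pp normr0 mulr0 powR0 ?gt_eqF// !mulr0 oppr0 mulr0.
have ppos : 0 < p by rewrite lt_def pp.
have [->|y00] := eqVneq y0 0; first by rewrite sgr0 !mul0r !mulr0 mul0r.
rewrite normr_sg y00 mul1r (gtr0_sg ppos) mulr1 ger0_norm//; ring.
Qed.

Lemma flow_le y0 t : 0 <= t -> `|feedback_flow y0 t| <= `|y0|.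
Proof.
move=> t0; rewrite -[in leRHS](feedback_flow0 y0) /feedback_flow !normrM mulr0 subr0.
have Pge z : 0 <= P z by exact: powR_ge0.
apply: ler_wpM2l => //; rewrite !(ger0_norm (Pge _)).
have m0 (z : R) : 0 <= Num.max 0 z by rewrite le_max lexx.
apply: (ge0_ler_powR (ltW q0)); rewrite ?nnegrE//.
rewrite ge_max m0 le_max; apply/orP; right.
by rewrite gerBl; apply: mulr_ge0 => //; apply: mulr_ge0; exact: ltW.
Qed.

Lemma flow_lip y0 t t' : 0 <= t -> 0 <= t' -> `|feedback_flow y0 t - feedback_flow y0 t'| <= K * `|y0| `^ gamma * `|t - t'|.
Proof.
wlog tt : t t' / t' <= t.
  move=> H t0 t'0; case/orP: (le_total t' t) => h; first exact: H.
  by rewrite distrC (distrC t); exact: H.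
move=> t0 t'0; rewrite (ger0_norm (x := t - t')) ?subr_ge0//.
apply: (@mvt_itv _ _ (fun s => feedback K gamma (feedback_flow y0 s)) t' t) => //.
- by move=> x _; exact: is_derive_flow.
- by apply: derivable_within_continuous => x _; case: (is_derive_flow y0 x).
move=> x /andP[x1 _]; rewrite /feedback (normrM (_ * _)) (normrM (- K)) normrN (gtr0_norm K0) -mulrA.
apply: ler_wpM2l; first exact: ltW.
have x0 : 0 <= x by apply: ltW; exact: le_lt_trans x1.
rewrite (ger0_norm (powR_ge0 _ _)) normr_sg -[leRHS]mul1r; apply: ler_pM => //.
- by case: (_ != 0).
- by apply: (ge0_ler_powR (ltW g0)); rewrite ?nnegrE ?normr_ge0 ?flow_le.
Qed.

Lemma flow_extinct y0 t : `|y0| `^ (1 - gamma) / ((1 - gamma) * K) <= t -> feedback_flow y0 t = 0.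
Proof.
have h : 0 < (1 - gamma) * K by rewrite mulr_gt0.
move=> tt; rewrite /feedback_flow P0 ?mulr0// subr_le0 mulrC -ler_pdivrMr//.
Qed.

End Feedback.

(** * Norms of Lipschitz functions *)

Section Norms.
Context {R : realType}.
Local Notation mu := (@lebesgue_measure R).

Lemma sup_normP (T : Type) (A : set T) (f : T -> R) (C : R) :
  (sup_norm A f <= C%:E)%E <-> forall x, A x -> `|f x| <= C.
Proof.
split=> [h x Ax|h]; last by apply: ge_ereal_sup => _ [x Ax <-]; rewrite lee_fin; exact: h.
by rewrite -lee_fin; apply: le_trans h; apply: ereal_sup_ubound; exists x.
Qed.

Lemma leb_setT_gt0 : (0 < mu setT)%E.
Proof.
apply: (@lt_le_trans _ _ (mu `]0, 1[)); first by rewrite lebesgue_measure_itv/= lte_fin ltr01 oppr0 adde0 lte_fin.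
by apply: le_measure; rewrite ?inE.
Qed.

Lemma Linfty_normP (A : set R) (f : R -> \bar R) (C : R) : 0 <= C ->
  (Linfty_norm mu A f <= C%:E)%E <-> {ae mu, forall x, A x -> (`|f x| <= C%:E)%E}.
Proof.
move=> C0; rewrite /Linfty_norm unlock leb_setT_gt0; split => [/ess_supP|h].
  by apply: aeS => x /= + Ax; rewrite /patch mem_set.
apply/ess_supP; apply: aeS h => x /= h; rewrite /patch.
by case: ifPn => [/[!inE] /h//|_]; rewrite abse0 lee_fin.
Qed.

Lemma lipschitz01 (u : R -> R) : is_Lip01 u -> exists2 M, 0 <= M &
  forall x y, 0 <= x <= 1 -> 0 <= y <= 1 -> `|u x - u y| <= M * `|x - y|.
Proof.
move=> [M [_ h]]; exists (`|M| + 1); first exact: addr_ge0.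
have /h {}h : M < `|M| + 1 by rewrite (le_lt_trans (ler_norm M))// ltrDl.
by move=> x y x01 y01; apply: (h (x, y)) => /=; rewrite ?in_itv.
Qed.

Lemma clamp_lipschitz (u : R -> R) (M : R) : 0 <= M ->
  (forall x y, 0 <= x <= 1 -> 0 <= y <= 1 -> `|u x - u y| <= M * `|x - y|) ->
  forall x y, `|u (clamp x) - u (clamp y)| <= M * `|x - y|.
Proof.
move=> M0 uM x y; apply: le_trans (uM _ _ (clamp01 x) (clamp01 y)) _.
by rewrite ler_wpM2l// clamp_lip.
Qed.

Lemma derive_clamp (u : R -> R) (x : R) : 0 < x < 1 -> derive1 (fun x => u (clamp x)) x = derive1 u x.
Proof.
move=> /andP[x0 x1]; rewrite !derive1E; apply: near_eq_derive.
have x01 : x \in `]0, 1[ by rewrite in_itv/= x0 x1.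
near=> z; rewrite clamp_id//.
  by apply: ltW; near: z; exact: lt_nbhsr.
by apply: ltW; near: z; exact: lt_nbhsl.
Unshelve. all: by end_near.
Qed.

Lemma deriv_norm_lip (u : R -> R) (C : R) : is_Lip01 u -> 0 <= C -> (deriv_norm u <= C%:E)%E ->
  forall x y, 0 <= x <= 1 -> 0 <= y <= 1 -> `|u x - u y| <= C * `|x - y|.
Proof.
move=> /lipschitz01[M M0 uM] C0 /(Linfty_normP _ _ C0) aeC.
have key a b : 0 <= a -> a <= b -> b <= 1 -> `|u b - u a| <= C * (b - a).
  move=> a0 ab b1.
  have := lip_le_ae_derive (clamp_lipschitz M0 uM) C0 ab; rewrite !clamp_id ?(le_trans a0)// ?(le_trans ab)//; apply.
  apply: aeS aeC => x h /andP[ax xb]; rewrite derive_clamp; last by rewrite (le_lt_trans a0)// (lt_le_trans xb).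
  by rewrite -lee_fin; apply: h; rewrite /= in_itv/= (le_lt_trans a0)// (lt_le_trans xb).
move=> x y /andP[x0 x1] /andP[y0 y1]; have [xy|/ltW xy] := lerP x y.
  by rewrite (distrC (u x)); exact: key.
exact: key.
Qed.

Lemma lip_deriv_norm (u : R -> R) (L : R) : 0 <= L ->
  (forall x y, 0 <= x <= 1 -> 0 <= y <= 1 -> `|u x - u y| <= L * `|x - y|) -> (deriv_norm u <= L%:E)%E.
Proof.
move=> L0 uL; have fL := clamp_lipschitz L0 uL.
apply/Linfty_normP => //; apply: aeS (lip_derivable fL) => x dx.
rewrite /= in_itv/= lee_fin => x01; rewrite -(derive_clamp _ x01) derive1E.
have cvx : (fun h : R => `|h^-1 *: (u (clamp (h *: (1 : R) + x)) - u (clamp x))|) @ 0^' --> `|'D_1 (fun x => u (clamp x)) x|.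
  exact: (cvg_norm dx).
apply: (@cvgr_to_le _ _ _ _ _ _ _ cvx).
near=> h; have h0 : h != 0 by near: h; exact: nbhs_dnbhs_neq.
rewrite normrZ normfV ler_pdivrMl ?normr_gt0// mulrC.
by apply: le_trans (fL _ _) _; rewrite addrK /GRing.scale/= mulr1.
Unshelve. all: by end_near.
Qed.

Lemma Lip_parts_ge0 (w : R -> R) : (0 <= sup_norm `[0%R, 1%R] w)%E /\ (0 <= deriv_norm w)%E.
Proof.
split; last exact: Lnorm_ge0.
apply: (@le_trans _ _ (`|w 0|%:E)); first by rewrite lee_fin.
by apply: ereal_sup_ubound; exists 0 => //=; rewrite in_itv/= lexx ler01.
Qed.

Lemma Linfty_Lip2_le (u v : R * R -> R) (E : R) : 0 <= E ->
  (forall t, 0 <= t -> (Lip2_norm (fun x => u (t, x)) (fun x => v (t, x)) <= E%:E)%E) ->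
  (Linfty_Lip2_norm u v <= E%:E)%E.
Proof.
move=> E0 h; apply/Linfty_normP => //; apply: aeW => t; rewrite /= in_itv/= andbT => t0.
have [su du] := Lip_parts_ge0 (fun x => u (t, x)); have [sv dv] := Lip_parts_ge0 (fun x => v (t, x)).
by rewrite gee0_abs ?h// /Lip2_norm /Lip_norm !adde_ge0.
Qed.

Lemma Lip2_norm_bounds (u v : R -> R) (d : R) : (Lip2_norm u v <= d%:E)%E ->
  ((sup_norm `[0%R, 1%R] u <= d%:E) /\ (deriv_norm u <= d%:E) /\
   (sup_norm `[0%R, 1%R] v <= d%:E) /\ (deriv_norm v <= d%:E))%E.
Proof.
have [[su du] [sv dv]] := (Lip_parts_ge0 u, Lip_parts_ge0 v).
rewrite /Lip2_norm /Lip_norm => h; repeat split; apply: le_trans h.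
- by rewrite -addeA leeDl// !adde_ge0.
- by rewrite (addeC (sup_norm _ u)) -addeA leeDl// !adde_ge0.
- by rewrite addeC -addeA leeDl// !adde_ge0.
- by rewrite addeC (addeC (sup_norm _ v)) -addeA leeDl// !adde_ge0.
Qed.

Lemma Lip2_norm_le (u v : R -> R) (a b : R) : (sup_norm `[0%R, 1%R] u <= a%:E)%E -> (deriv_norm u <= b%:E)%E ->
  (sup_norm `[0%R, 1%R] v <= a%:E)%E -> (deriv_norm v <= b%:E)%E -> (Lip2_norm u v <= (2 * (a + b))%:E)%E.
Proof.
move=> h1 h2 h3 h4; rewrite mulr2n mulrDl mul1r /Lip2_norm /Lip_norm.
by rewrite !EFinD; do ! apply: leeD.
Qed.
End Norms.

(** * Solutions as transported pairs *)

Section Clip.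
Context {R : realType}.
Implicit Types (u v f : R * R -> R).

Lemma ext_lip (L T : R) u : 0 <= T -> M_Lipschitz L (closed_strip T%:E) u ->
  M_Lipschitz `|L| setT (fun p => u (clip 0 T p.1, clamp p.2)).
Proof.
move=> T0 uL p q _ _.
have cs (r : R * R) : closed_strip T%:E (clip 0 T r.1, clamp r.2).
  by have /andP[h1 h2] := clip_itv r.1 T0; have /andP[h3 h4] := clamp01 r.2; split; rewrite //= lee_fin.
apply: le_trans (uL _ _ (cs p) (cs q)) _ => /=.
apply: (@le_trans _ _ (`|L| * (`|clip 0 T p.1 - clip 0 T q.1| + `|clamp p.2 - clamp q.2|))).
  by rewrite ler_wpM2r ?addr_ge0 ?ler_norm.
by rewrite ler_wpM2l// lerD ?clip_lip ?clamp_lip.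
Qed.

Lemma coef_lip f u v (N B L : R) : 0 <= B ->
  (forall p q, square N p -> square N q -> `|f p - f q| <= B * (`|p.1 - q.1| + `|p.2 - q.2|)) ->
  M_Lipschitz L setT u -> M_Lipschitz L setT v -> (forall p, square N (u p, v p)) ->
  M_Lipschitz (B * (L + L)) setT (fun p => f (u p, v p)).
Proof.
move=> B0 fB uL vL sq p q _ _; apply: le_trans (fB _ _ (sq p) (sq q)) _ => /=.
by rewrite -mulrA ler_wpM2l// mulrDl lerD ?(uL p q I I) ?(vL p q I I).
Qed.

(** The pair with its second component reflected. *)
Definition both u v (b : bool) (t x : R) := if b then u (t, x) else v (t, 1 - x).

(** The speeds of the reflected pair. The state is clipped to [-N, N], which
    makes them bounded and Lipschitz and has no effect on solutions bounded by
    N. *)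
Definition clip_speed (lambda mu : R * R -> R) N (b : bool) (p q : R) :=
  if b then lambda (clip (- N) N p, clip (- N) N q) else - mu (clip (- N) N q, clip (- N) N p).
End Clip.

Section Solutions.
Context {R : realType}.
Variables (lambda mu : R * R -> R) (c K gamma : R).
Hypothesis lambda_smooth : smooth lambda.
Hypothesis mu_smooth : smooth mu.
Hypothesis c0 : 0 < c.
Hypothesis speeds : forall p : R * R, mu p <= - c /\ c <= lambda p.
Hypothesis K0 : 0 < K.
Hypothesis g0 : 0 < gamma.
Hypothesis g1 : gamma < 1.

Lemma clip_square (N p q : R) : 0 <= N -> square N (clip (- N) N p, clip (- N) N q).
Proof. by move=> N0; split; rewrite /= in_itv/=; apply: clip_itv; lra. Qed.

Lemma clip_speed_ge (N : R) b p q : c <= clip_speed lambda mu N b p q.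
Proof.
rewrite /clip_speed; case: b; first by have [] := speeds (clip (- N) N p, clip (- N) N q).
by rewrite lerNr; have [] := speeds (clip (- N) N q, clip (- N) N p).
Qed.

Lemma clip_speed_le (N M : R) b p q : 0 <= N ->
  (forall r, square N r -> `|lambda r| <= M /\ `|mu r| <= M) -> clip_speed lambda mu N b p q <= M.
Proof.
move=> N0 sM; rewrite /clip_speed; case: b.
  by have [h _] := sM _ (clip_square p q N0); apply: le_trans h; exact: ler_norm.
by have [_ h] := sM _ (clip_square q p N0); apply: le_trans h; rewrite -normrN; exact: ler_norm.
Qed.

Lemma clip_speed_lip (N B : R) b p q p' q' : 0 <= N -> 0 <= B ->
  (forall r s, square N r -> square N s -> `|lambda r - lambda s| <= B * (`|r.1 - s.1| + `|r.2 - s.2|)) ->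
  (forall r s, square N r -> square N s -> `|mu r - mu s| <= B * (`|r.1 - s.1| + `|r.2 - s.2|)) ->
  `|clip_speed lambda mu N b p q - clip_speed lambda mu N b p' q'| <= B * (`|p - p'| + `|q - q'|).
Proof.
move=> N0 B0 lB mB; rewrite /clip_speed; case: b.
  apply: le_trans (lB _ _ (clip_square p q N0) (clip_square p' q' N0)) _ => /=.
  by rewrite ler_wpM2l// lerD ?clip_lip.
rewrite -opprD normrN; apply: le_trans (mB _ _ (clip_square q p N0) (clip_square q' p' N0)) _ => /=.
by rewrite ler_wpM2l// addrC lerD ?clip_lip.
Qed.

Lemma speed_both (N : R) u v b t x : `|u (t, if b then x else 1 - x)| <= N -> `|v (t, if b then x else 1 - x)| <= N ->
  speed (clip_speed lambda mu N) (both u v) b t x =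
  if b then lambda (u (t, x), v (t, x)) else - mu (u (t, 1 - x), v (t, 1 - x)).
Proof.
rewrite /speed /clip_speed /both; case: b => /= h1 h2.
  by rewrite subKr !clip_id// -ler_norml.
by rewrite !clip_id// -ler_norml.
Qed.

(** The solution is extended to the plane by clamping its arguments, which makes
    [strip_semilag] applicable. Segments of slope be of the reflected component
    are segments of slope - be of v. *)
Lemma solution_transported (N M Tp : R) (S : \bar R) u0 v0 u v : 0 < Tp -> (Tp%:E <= S)%E ->
  is_solution lambda mu K gamma S u0 v0 u v ->
  (forall p, closed_strip Tp%:E p -> `|u p| <= N /\ `|v p| <= N) ->
  exists A Lt Lx, [/\ 0 <= A, 0 <= Lt, forall b, lip2 Tp Lt Lx (both u v b) &
    forall b, transported c M Tp A 0 (speed (clip_speed lambda mu N) (both u v) b) (both u v b)].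
Proof.
move=> T0 TS [[L [uL vL]] [tu tv] _ _] uvN.
have sub : closed_strip Tp%:E `<=` closed_strip S.
  by move=> p [h1 h2 h3 h4]; split => //; exact: le_trans TS.
have osub : open_strip Tp%:E `<=` open_strip S.
  by move=> p [h1 h2 h3 h4]; split => //; exact: lt_le_trans TS.
have oc : open_strip Tp%:E `<=` closed_strip Tp%:E.
  by move=> p [h1 h2 h3 h4]; split => //; exact: ltW.
have uL' : M_Lipschitz L (closed_strip Tp%:E) u by move=> p q /sub + /sub; exact: uL.
have vL' : M_Lipschitz L (closed_strip Tp%:E) v by move=> p q /sub + /sub; exact: vL.
(* Globally Lipschitz extensions of u and v. *)
pose U p := u (clip 0 Tp p.1, clamp p.2); pose V p := v (clip 0 Tp p.1, clamp p.2).
have eU p : closed_strip Tp%:E p -> u p = U p /\ v p = V p.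
  by case: p => t x [/= h1 h2 h3 h4]; rewrite /U /V /= clip_id ?clamp_id// h1 -lee_fin h2.
have UL := ext_lip (ltW T0) uL'; have VL := ext_lip (ltW T0) vL'.
rewrite -/U in UL; rewrite -/V in VL.
have cs (r : R * R) : closed_strip Tp%:E (clip 0 Tp r.1, clamp r.2).
  by have /andP[h1 h2] := clip_itv r.1 (ltW T0); have /andP[h3 h4] := clamp01 r.2; split; rewrite //= lee_fin.
have sq p : square N (U p, V p).
  by have [h1 h2] := uvN _ (cs p); split; rewrite /= in_itv/= -ler_norml.
have [Bl Bl0 BlP] := smooth_loc_lip N lambda_smooth; have [Bm Bm0 BmP] := smooth_loc_lip N mu_smooth.
have al := coef_lip Bl0 BlP UL VL sq; have am := coef_lip Bm0 BmP UL VL sq.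
have oS : open (open_strip S) by exact: open_strip_open.
have oT : open (open_strip Tp%:E) by exact: open_strip_open.
have tU : transport_eq (open_strip Tp%:E) (fun p => lambda (U p, V p)) U.
  apply: (transport_eq_sub oS oT osub _ _ tu) => p /oc /eU[h1 h2] //.
  by rewrite h1 h2.
have tV : transport_eq (open_strip Tp%:E) (fun p => mu (U p, V p)) V.
  apply: (transport_eq_sub oS oT osub _ _ tv) => p /oc /eU[h1 h2] //.
  by rewrite h1 h2.
have [A A0 AP] := @strip_semilag R Tp _ _ M U _ T0 UL al tU.
have [A' A'0 A'P] := @strip_semilag R Tp _ _ M V _ T0 VL am tV.
have cl t x : 0 <= t <= Tp -> 0 <= x <= 1 -> closed_strip Tp%:E (t, x).
  by move=> /andP[h1 h2] /andP[h3 h4]; split; rewrite //= lee_fin.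
have rf (x : R) : 0 <= x <= 1 -> 0 <= 1 - x <= 1 := @reflect01 R x.
exists (A + A'), `|L|, `|L|; split => //; first exact: addr_ge0.
  move=> b t t' x x' h1 h2 h3 h4; rewrite -mulrDr /both; case: b.
    have [-> _] := eU _ (cl _ _ h1 h3); have [-> _] := eU _ (cl _ _ h2 h4).
    exact: UL.
  have [_ ->] := eU _ (cl _ _ h1 (rf _ h3)); have [_ ->] := eU _ (cl _ _ h2 (rf _ h4)).
  apply: le_trans (VL _ _ I I) _ => /=.
  by rewrite (_ : 1 - x - (1 - x') = - (x - x')) ?normrN//; ring.
move=> b t x h be h0 ht tT x1 xb cb.
have /andP[cb1 cb2] := cb; have be0 := lt_le_trans c0 cb1.
have hb : 0 <= h * be by rewrite mulr_ge0// ltW.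
have [t01 t01'] : 0 <= t <= Tp /\ 0 <= t - h <= Tp by apply: segment_itv; rewrite ?subr_ge0.
have [x01 x01'] := segment_itv hb xb x1.
have xr01 := rf _ x01; have xr01' := rf _ x01'.
have xi : 0 <= (if b then x else 1 - x) <= 1 by case: b.
have [uN vN] := uvN _ (cl _ _ t01 xi).
rewrite (speed_both uN vN) addr0 /both.
have up B B' d : 0 <= B -> 0 <= B' -> 0 <= d -> B * h * (h + d) <= (B + B') * h * (h + d).
  by move=> B0 B'0 d0; rewrite ler_wpM2r ?addr_ge0// ler_wpM2r// lerDl.
case: b {xi uN vN}.
  have [e1 e2] := eU _ (cl _ _ t01 x01); have [e3 _] := eU _ (cl _ _ t01' x01').
  rewrite e1 e2 e3; apply: le_trans (AP t x h be h0 ht tT x01 x01' _) (up _ _ _ A0 A'0 _) => //.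
  by rewrite gtr0_norm.
have [e1 e2] := eU _ (cl _ _ t01 xr01); have [_ e3] := eU _ (cl _ _ t01' xr01').
have eq' : 1 - (x - h * be) = 1 - x - h * - be by ring.
rewrite e1 e2 e3 eq' (addrC A).
have eq2 m : `|be - - m| = `|- be - m| by rewrite -normrN; congr (`| _ |); ring.
rewrite eq2; apply: le_trans (A'P t (1 - x) h (- be) h0 ht tT xr01 _ _) (up _ _ _ A'0 A0 _) => //.
  by rewrite -eq'.
by rewrite normrN gtr0_norm.
Qed.
End Solutions.

(** * Uniqueness of solutions *)

Section Uniqueness.
Context {R : realType}.
Variables (lambda mu : R * R -> R) (c K gamma : R).
Hypothesis lambda_smooth : smooth lambda.
Hypothesis mu_smooth : smooth mu.
Hypothesis c0 : 0 < c.
Hypothesis speeds : forall p : R * R, mu p <= - c /\ c <= lambda p.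
Hypothesis K0 : 0 < K.
Hypothesis g0 : 0 < gamma.
Hypothesis g1 : gamma < 1.

Lemma boundary_flow (w : R * R -> R) (L Tp x : R) (S : \bar R) (y0 : R) : 0 < Tp -> (Tp%:E <= S)%E -> 0 <= x <= 1 ->
  M_Lipschitz L (closed_strip S) w ->
  (forall t : R, 0 < t -> (t%:E < S)%E -> is_derive t (1 : R) (fun s : R => w (s, x)) (feedback K gamma (w (t, x)))) ->
  w (0, x) = y0 -> forall t, 0 <= t <= Tp -> w (t, x) = feedback_flow K gamma y0 t.
Proof.
move=> T0 TS /andP[x0 x1] wL wd w0 t t01.
have sub : closed_strip Tp%:E `<=` closed_strip S.
  by move=> p [h1 h2 h3 h4]; split => //; exact: le_trans TS.
have wL' : M_Lipschitz L (closed_strip Tp%:E) w by move=> p q /sub + /sub; exact: wL.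
have eL := ext_lip (ltW T0) wL'.
pose y s := w (clip 0 Tp s, x).
have cy : continuous y.
  move=> s; have cW := M_Lipschitz_continuous eL.
  have -> : y = (fun p : R * R => w (clip 0 Tp p.1, clamp p.2)) \o (fun s : R => (s, x)).
    by apply/funext => r; rewrite /y /= clamp_id.
  apply: continuous_comp; last exact: cW.
  have e1 : (fun r : R => r) @ s --> s by exact: cvg_id.
  have e2 : (fun _ : R => x) @ s --> x by exact: cvg_cst.
  exact: (cvg_pair e1 e2).
have dy (s : R) : 0 < s < Tp -> is_derive s (1 : R) y (feedback K gamma (y s)).
  move=> /andP[s0 sT]; rewrite {2}/y clip_id ?(ltW s0) ?(ltW sT)//.
  apply: (@near_eq_is_derive _ R R (fun s : R => w (s, x))); last first.
    by apply: wd => //; apply: lt_le_trans TS; rewrite lte_fin.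
  near=> r; rewrite /y clip_id//; apply/andP; split.
    by apply: ltW; near: r; exact: lt_nbhsr.
  by apply: ltW; near: r; exact: lt_nbhsl.
have y00 : y 0 = feedback_flow K gamma y0 0.
  by rewrite feedback_flow0// /y clip_id ?w0// lexx ltW.
have -> : w (t, x) = y t by rewrite /y clip_id.
apply: (@feedback_unique R K gamma K0 g0 Tp) => //.
- exact: continuous_subspaceT.
- by apply: derivable_within_continuous => r _; case: (is_derive_flow K g0 g1 y0 r).
- by move=> s _; exact: is_derive_flow.
Unshelve. all: by end_near.
Qed.

(** The two reflected pairs have the same initial and boundary values and are
    transported with the same speeds. The bound N is free, so that global
    solutions can be compared on every bounded time interval. *)
Lemma solution_unique (N Tp : R) (S S' : \bar R) u0 v0 u v u' v' : 0 < Tp -> (Tp%:E <= S)%E -> (Tp%:E <= S')%E ->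
  is_solution lambda mu K gamma S u0 v0 u v -> is_solution lambda mu K gamma S' u0 v0 u' v' ->
  (forall p, closed_strip Tp%:E p -> `|u p| <= N /\ `|v p| <= N) ->
  (forall p, closed_strip Tp%:E p -> `|u' p| <= N /\ `|v' p| <= N) ->
  forall p, closed_strip Tp%:E p -> u p = u' p /\ v p = v' p.
Proof.
move=> T0 TS TS' sol sol' uvN uvN'.
have cl t x : 0 <= t <= Tp -> 0 <= x <= 1 -> closed_strip Tp%:E (t, x).
  by move=> /andP[h1 h2] /andP[h3 h4]; split; rewrite //= lee_fin.
have z01 : 0 <= (0 : R) <= 1 by rewrite lexx ler01.
have o01 : 0 <= (1 : R) <= 1 by rewrite lexx ler01.
have N0 : 0 <= N.
  have [|h _] := uvN (0, 0); first by apply: cl => //; rewrite lexx ltW.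
  exact: le_trans h.
have [B B0 BP] := square_bounded N (proj1 (lambda_smooth [::])).
have [B' B'0 B'P] := square_bounded N (proj1 (mu_smooth [::])).
have [D D0 DP] := smooth_loc_lip N lambda_smooth; have [D' D'0 D'P] := smooth_loc_lip N mu_smooth.
pose M := B + B'; pose M2 := D + D'.
have M20 : 0 <= M2 by exact: addr_ge0.
have lM b p q : clip_speed lambda mu N b p q <= M.
  apply: clip_speed_le => // r sr; split.
    by apply: le_trans (BP r sr) _; rewrite lerDl.
  by apply: le_trans (B'P r sr) _; rewrite lerDr.
have lL b p q p' q' : `|clip_speed lambda mu N b p q - clip_speed lambda mu N b p' q'| <= M2 * (`|p - p'| + `|q - q'|).
  apply: clip_speed_lip => // r s sr ss.
    by apply: le_trans (DP r s sr ss) _; rewrite ler_wpM2r ?addr_ge0// lerDl.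
  by apply: le_trans (D'P r s sr ss) _; rewrite ler_wpM2r ?addr_ge0// lerDr.
have [A [Lt [Lx [A0 Lt0 wl wt]]]] := solution_transported lambda_smooth mu_smooth c0 M T0 TS sol uvN.
have [A' [Lt' [Lx' [A'0 Lt'0 wl' wt']]]] := solution_transported lambda_smooth mu_smooth c0 M T0 TS' sol' uvN'.
case: sol => -[L [uL vL]] _ ode ini; case: sol' => -[L' [uL' vL']] _ ode' ini'.
have [i1 i2] := ini 0 z01; have [i3 i4] := ini 1 o01.
have [i1' i2'] := ini' 0 z01; have [i3' i4'] := ini' 1 o01.
have bnd b t : 0 <= t <= Tp -> both u v b t 0 = both u' v' b t 0.
  move=> t01; rewrite /both subr0; case: b.
    rewrite (boundary_flow T0 TS z01 uL (fun s s0 sS => proj1 (ode s s0 sS)) i1 t01).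
    by rewrite (boundary_flow T0 TS' z01 uL' (fun s s0 sS => proj1 (ode' s s0 sS)) i1' t01).
  rewrite (boundary_flow T0 TS o01 vL (fun s s0 sS => proj2 (ode s s0 sS)) i4 t01).
  by rewrite (boundary_flow T0 TS' o01 vL' (fun s s0 sS => proj2 (ode' s s0 sS)) i4' t01).
have inib b x : 0 <= x <= 1 -> both u v b 0 x = both u' v' b 0 x.
  move=> x01; rewrite /both; case: b.
    by have [-> _] := ini x x01; have [-> _] := ini' x x01.
  have r01 : 0 <= 1 - x <= 1 by exact: reflect01.
  by have [_ ->] := ini _ r01; have [_ ->] := ini' _ r01.
have eqw := @transported_unique R (clip_speed lambda mu N) c M M2 c0 (clip_speed_ge speeds N) lM M20 lL Tp A A' Lt Lx Lt' Lx' (both u v) (both u' v') A0 Lt0 Lt'0 wl wl' wt wt' inib bnd.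
move=> [t x] [/= h1 h2 h3 h4].
have t01 : 0 <= t <= Tp by rewrite h1 -lee_fin.
have x01 : 0 <= x <= 1 by rewrite h3.
have r01 : 0 <= 1 - x <= 1 by exact: reflect01.
split; first exact: (eqw true t x t01 x01).
by have := eqw false t (1 - x) t01 r01; rewrite /both subKr.
Qed.
End Uniqueness.

(** * Existence of solutions *)

Section Existence.
Context {R : realType}.
Variables (lambda mu : R * R -> R) (c K gamma N M M2 T : R).
Hypothesis c0 : 0 < c.
Hypothesis speeds : forall p : R * R, mu p <= - c /\ c <= lambda p.
Hypothesis K0 : 0 < K.
Hypothesis g0 : 0 < gamma.
Hypothesis g1 : gamma < 1.
Hypothesis N0 : 0 <= N.
Hypothesis M20 : 0 <= M2.
Hypothesis speedM : forall r, square N r -> `|lambda r| <= M /\ `|mu r| <= M.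
Hypothesis lambda_lip : forall r s, square N r -> square N s ->
  `|lambda r - lambda s| <= M2 * (`|r.1 - s.1| + `|r.2 - s.2|).
Hypothesis mu_lip : forall r s, square N r -> square N s ->
  `|mu r - mu s| <= M2 * (`|r.1 - s.1| + `|r.2 - s.2|).
Hypothesis T_ge : c^-1 + N `^ (1 - gamma) / ((1 - gamma) * K) <= T.

(** The transported pair on [0, T] vanishes at time T, so that freezing it from
    T on extends it by 0. Here m bounds the data, and L0 bounds both the slope
    of the initial data and the slope K m^gamma / c created at the boundary.
    Both are left free: existence uses the constants of the smallness condition,
    stability uses small ones. *)
Lemma solution_exists (L0 m : R) (u0 v0 : R -> R) : 0 <= L0 -> 0 <= m <= N ->
  (forall x, 0 <= x <= 1 -> `|u0 x| <= m /\ `|v0 x| <= m) ->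
  (forall x y, 0 <= x <= 1 -> 0 <= y <= 1 -> `|u0 x - u0 y| <= L0 * `|x - y|) ->
  (forall x y, 0 <= x <= 1 -> 0 <= y <= 1 -> `|v0 x - v0 y| <= L0 * `|x - y|) ->
  K * m `^ gamma <= c * L0 -> 2 * M2 * (expR 1 * L0) <= T^-1 ->
  exists U V : R * R -> R,
  [/\ forall S, (T%:E <= S)%E -> is_solution lambda mu K gamma S u0 v0 U V,
      forall p, `|U p| <= m /\ `|V p| <= m,
      forall p q, `|U p - U q| <= expR 1 * L0 * M * `|p.1 - q.1| + expR 1 * L0 * `|p.2 - q.2| /\
                  `|V p - V q| <= expR 1 * L0 * M * `|p.1 - q.1| + expR 1 * L0 * `|p.2 - q.2| &
      forall t x, T <= t -> U (t, x) = 0 /\ V (t, x) = 0].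
Proof.
move=> L00 /andP[m0 mN] uvm uL vL KL LT.
pose Lam := clip_speed lambda mu N.
have Lamc : forall b p q, c <= Lam b p q by exact: clip_speed_ge.
have LamM b p q : Lam b p q <= M by exact: clip_speed_le.
have Laml b p q p' q' : `|Lam b p q - Lam b p' q'| <= M2 * (`|p - p'| + `|q - q'|) by exact: clip_speed_lip.
have M0 : 0 < M by apply: lt_le_trans (le_trans (Lamc true 0 0) (LamM _ _ _)).
have g10 : 0 < 1 - gamma by rewrite subr_gt0.
have gK0 : 0 < (1 - gamma) * K by rewrite mulr_gt0.
pose ts := N `^ (1 - gamma) / ((1 - gamma) * K).
have ts0 : 0 <= ts by rewrite divr_ge0 ?powR_ge0// ltW.
have ci0 : 0 < c^-1 by rewrite invr_gt0.
have T0 : 0 < T by apply: lt_le_trans T_ge; rewrite -/ts; lra.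
have z01 : 0 <= (0 : R) <= 1 by rewrite lexx ler01.
have o01 : 0 <= (1 : R) <= 1 by rewrite lexx ler01.
pose y0 (b : bool) := if b then u0 0 else v0 1.
pose y b t := feedback_flow K gamma (y0 b) (Num.max 0 t).
pose w0 (b : bool) x := if b then u0 (clamp x) else v0 (1 - clamp x).
have rf (x : R) : 0 <= x <= 1 -> 0 <= 1 - x <= 1 := @reflect01 R x.
have y0m b : `|y0 b| <= m by case: b; [have [] := uvm 0 z01|have [] := uvm 1 o01].
have mx0 (t : R) : 0 <= Num.max 0 t by rewrite le_max lexx.
have yl b t t' : `|y b t - y b t'| <= c * L0 * `|t - t'|.
  apply: le_trans (flow_lip K0 g0 g1 (y0 b) (mx0 t) (mx0 t')) _.
  apply: (@le_trans _ _ (K * m `^ gamma * `|t - t'|)).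
    apply: ler_pM => //; first by rewrite mulr_ge0 ?powR_ge0// ltW.
      by rewrite ler_pM2l// ge0_ler_powR ?nnegrE ?(ltW g0).
    exact: max0_lip.
  by rewrite ler_wpM2r.
have wl b x x' : `|w0 b x - w0 b x'| <= L0 * `|x - x'|.
  have h1 := clamp01 x; have h2 := clamp01 x'.
  apply: (@le_trans _ _ (L0 * `|clamp x - clamp x'|)); last by rewrite ler_wpM2l// clamp_lip.
  rewrite /w0; case: b; first exact: uL.
  apply: le_trans (vL _ _ (rf _ h1) (rf _ h2)) _.
  by rewrite (_ : 1 - clamp x - (1 - clamp x') = - (clamp x - clamp x')) ?normrN//; ring.
have yw b : w0 b 0 = y b 0.
  by rewrite /y /w0 max_l// feedback_flow0// clamp_id// subr0.
have ym b t : `|y b t| <= m by apply: le_trans (y0m b); exact: flow_le.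
have wm b x : `|w0 b x| <= m.
  rewrite /w0; case: b; first by have [] := uvm _ (clamp01 x).
  by have [] := uvm _ (rf _ (clamp01 x)).
have [w [wlip wt' wbm wy ww0]] := transported_existence c0 Lamc LamM M20 Laml T0 L00 LT yl wl yw ym wm.
set L := expR 1 * L0 in wlip *.
have L_0 : 0 <= L by rewrite mulr_ge0// expR_ge0.
pose A := `|scheme_const M M2 T L0|.
have A0 : 0 <= A by exact: normr_ge0.
have wt b : transported c M T A 0 (speed Lam w b) (w b).
  exact: (transportedW (lexx 0) (ler_norm _) (wt' b)).
have ext b t : ts <= t -> t <= T -> w b t 0 = 0.
  move=> tst tT; rewrite wy; last by rewrite tT (le_trans ts0).
  have t0 := le_trans ts0 tst.
  rewrite /y max_r// flow_extinct//; apply: le_trans tst.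
  rewrite ler_pM2r ?invr_gt0//; apply: ge0_ler_powR; rewrite ?nnegrE// ?(ltW g10)//.
  exact: le_trans (y0m b) mN.
have wT b x : 0 <= x <= 1 -> w b T x = 0.
  move=> x01; apply: (extinct c0 A0 ts0 _ (wt b) (ext b) x01 _ (lexx T)).
    by move=> t z; rewrite Lamc LamM.
  apply: le_trans T_ge; rewrite -/ts addrC lerD2r.
  by case/andP: x01 => _ x1; rewrite ler_piMl// ltW.
(* Clipping the time at T extends the pair by its final state, which is 0. *)
pose W b (t x : R) := w b (clip 0 T t) (clamp x).
have cT t : 0 <= clip 0 T t <= T by exact: (clip_itv t (ltW T0)).
have WT b t x : T <= t -> W b t x = 0.
  move=> Tt; rewrite /W (_ : clip 0 T t = T) ?wT ?clamp01//.
  by rewrite /clip min_l// max_r// ltW.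
have WE b t x : 0 <= t <= T -> 0 <= x <= 1 -> W b t x = w b t x.
  by move=> t01 /andP[x0 x1]; rewrite /W clip_id// clamp_id.
have Wm b t x : `|W b t x| <= m by rewrite /W wbm ?cT ?clamp01.
have Wl b t t' x x' : `|W b t x - W b t' x'| <= L * M * `|t - t'| + L * `|x - x'|.
  apply: le_trans (wlip b _ _ _ _ (cT t) (cT t') (clamp01 x) (clamp01 x')) _.
  by rewrite lerD// ler_wpM2l ?clip_lip ?clamp_lip// mulr_ge0// ltW.
have Wt b t x h be : 0 <= h -> h <= t -> x <= 1 -> 0 <= x - h * be -> c <= be <= M ->
    `|W b t x - W b (t - h) (x - h * be)| <= A * h * (h + `|be - speed Lam W b t x|).
  move=> h0 ht x1 xb cb.
  have /andP[cb1 cb2] := cb; have be0 := lt_le_trans c0 cb1.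
  have hb : 0 <= h * be by rewrite mulr_ge0// ltW.
  have [x01 x01'] := segment_itv hb xb x1.
  have [tT|Tt] := lerP t T.
    have [t01 t01'] : 0 <= t <= T /\ 0 <= t - h <= T by apply: segment_itv; rewrite ?subr_ge0.
    rewrite /speed !WE// ?rf//.
    by have := wt b t x h be h0 ht tT x1 xb cb; rewrite addr0.
  rewrite /speed !(WT _ t) ?(ltW Tt)// sub0r normrN.
  have [Th|hT] := lerP T (t - h).
    by rewrite WT// normr0 !mulr_ge0// addr_ge0.
  (* A segment that crosses the time T is cut there: beyond T both ends carry
     0. *)
  pose h' := T - (t - h); pose x' := x - (t - T) * be.
  have h'0 : 0 <= h' by rewrite subr_ge0 ltW.
  have h'h : h' <= h by rewrite /h' lerBlDr addrC subrK ltW.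
  have h'T : h' <= T by rewrite gerBl subr_ge0.
  have e1 : x' - h' * be = x - h * be by rewrite /x' /h'; ring.
  have e2 : T - h' = t - h by rewrite /h'; ring.
  have tb : 0 <= (t - T) * be by rewrite mulr_ge0// ?subr_ge0 ltW.
  have hb' : 0 <= h' * be by rewrite mulr_ge0// ltW.
  have x'01 : 0 <= x' <= 1.
    apply/andP; split; last by apply: le_trans x1; rewrite gerBl.
    by apply: le_trans hb' _; rewrite -subr_ge0 e1.
  have /andP[x'0 x'1] := x'01.
  have t01' : 0 <= t - h <= T by rewrite subr_ge0 ht ltW.
  have := wt b T x' h' be h'0 h'T (lexx T) x'1; rewrite e1 e2 => /(_ xb cb).
  rewrite /speed !wT ?rf// sub0r normrN addr0 WE// => /le_trans; apply.
  by apply: ler_pM; [exact: mulr_ge0|exact: addr_ge0|exact: ler_wpM2l|rewrite lerD2r].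
have LM0 : 0 <= L * M by rewrite mulr_ge0// ltW.
pose U p := W true p.1 p.2; pose V p := W false p.1 (1 - p.2).
have UVl p q : `|U p - U q| <= L * M * `|p.1 - q.1| + L * `|p.2 - q.2| /\
               `|V p - V q| <= L * M * `|p.1 - q.1| + L * `|p.2 - q.2|.
  split; first exact: Wl.
  apply: le_trans (Wl _ _ _ _ _) _.
  by rewrite (_ : 1 - p.2 - (1 - q.2) = - (p.2 - q.2)) ?normrN//; ring.
have UL : M_Lipschitz (L * M + L) setT U.
  move=> p q _ _; have [+ _] := UVl p q; move=> /le_trans; apply.
  by rewrite mulrDr lerD// ler_wpM2r// ?lerDl ?lerDr.
have VL : M_Lipschitz (L * M + L) setT V.
  move=> p q _ _; have [_] := UVl p q; move=> /le_trans; apply.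
  by rewrite mulrDr lerD// ler_wpM2r// ?lerDl ?lerDr.
have sq p : square N (U p, V p).
  by split; rewrite /= in_itv/= -ler_norml; exact: le_trans (Wm _ _ _) mN.
have sU t x : speed Lam W true t x = lambda (U (t, x), V (t, x)).
  by have [/= s1 s2] := sq (t, x); rewrite /speed /Lam /clip_speed /= !clip_id//; move: s1 s2; rewrite !in_itv.
have sV t x : speed Lam W false t (1 - x) = - mu (U (t, x), V (t, x)).
  by have [/= s1 s2] := sq (t, x); rewrite /speed /Lam /clip_speed /= subKr !clip_id//; move: s1 s2; rewrite !in_itv.
exists U, V; split => //.
- move=> S TS; split.
  + by exists (L * M + L); split => p q _ _; [exact: UL|exact: VL].
  + have cont (f : R * R -> R) : (forall r s, square N r -> square N s -> `|f r - f s| <= M2 * (`|r.1 - s.1| + `|r.2 - s.2|)) ->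
        continuous (fun p => f (U p, V p)).
      move=> fL; have h := coef_lip M20 fL UL VL sq.
      exact: (M_Lipschitz_continuous h).
    have oS : open (open_strip S) by exact: open_strip_open.
    split.
      apply: (transport_eqI (M := M) oS UL (cont _ lambda_lip)).
      * by move=> p; have [] := speedM (sq p).
      * by move=> p; rewrite gt_eqF// (lt_le_trans c0)//; have [] := speeds (U p, V p).
      move=> [t x] [/= t0 _ x0 x1]; exists A, (Num.min t (x / M)).
      split; first by rewrite lt_min t0 divr_gt0.
      move=> h h0; rewrite lt_min => /andP[ht hx].
      have cb : c <= lambda (U (t, x), V (t, x)) <= M by rewrite -sU Lamc LamM.
      have /andP[_ cb2] := cb.
      have hM : h * lambda (U (t, x), V (t, x)) <= x.
        apply: (@le_trans _ _ (h * M)); first by rewrite ler_pM2l.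
        by rewrite -ler_pdivlMr// ltW.
      have := Wt true t x h _ (ltW h0) (ltW ht) (ltW x1) _ cb.
      by rewrite subr_ge0 sU subrr normr0 addr0 expr2 mulrA; exact.
    apply: (transport_eqI (M := M) oS VL (cont _ mu_lip)).
    * by move=> p; have [] := speedM (sq p).
    * move=> p; rewrite lt_eqF//; have [h _] := speeds (U p, V p).
      by apply: le_lt_trans h _; rewrite oppr_lt0.
    move=> [t x] [/= t0 _ x0 x1]; exists A, (Num.min t ((1 - x) / M)).
    split; first by rewrite lt_min t0 divr_gt0// subr_gt0.
    move=> h h0; rewrite lt_min => /andP[ht hx].
    have cb : c <= - mu (U (t, x), V (t, x)) <= M by rewrite -sV Lamc LamM.
    have /andP[_ cb2] := cb.
    have hM : h * - mu (U (t, x), V (t, x)) <= 1 - x.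
      apply: (@le_trans _ _ (h * M)); first by rewrite ler_pM2l.
      by rewrite -ler_pdivlMr// ltW.
    have x1' : 1 - x <= 1 by rewrite gerBl ltW.
    have := Wt false t (1 - x) h _ (ltW h0) (ltW ht) x1' _ cb.
    rewrite subr_ge0 sV subrr normr0 addr0 => /(_ hM).
    rewrite /V /= expr2 mulrA.
    by rewrite (_ : 1 - (x - h * _) = 1 - x - h * - mu (U (t, x), V (t, x))) //; ring.
  + have der b (t : R) : 0 < t -> is_derive t (1 : R) (fun s => W b s 0) (feedback K gamma (W b t 0)).
      have WF s : 0 <= s -> W b s 0 = feedback_flow K gamma (y0 b) s.
        move=> s0; have [sT|Ts] := lerP s T; first by rewrite WE ?s0// wy ?s0// /y max_r.
        rewrite WT ?(ltW Ts)// flow_extinct//; apply: ltW; apply: le_lt_trans Ts.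
        apply: le_trans T_ge; rewrite -[leLHS]add0r; apply: lerD; first exact: ltW.
        rewrite ler_pM2r ?invr_gt0//; apply: ge0_ler_powR; rewrite ?nnegrE// ?(ltW g10)//.
        exact: le_trans (y0m b) mN.
      move=> t0; rewrite (WF t (ltW t0)).
      apply: (@near_eq_is_derive _ R R (feedback_flow K gamma (y0 b))); last exact: is_derive_flow.
      near=> s; rewrite WF//; apply: ltW; near: s; exact: lt_nbhsr.
    move=> t t0 _; split; first exact: der.
    by rewrite /V /= subrr; exact: der.
  + move=> x x01; have /andP[x0 x1] := x01; have t01 : 0 <= (0 : R) <= T by rewrite lexx ltW.
    rewrite /U /V /= !WE ?rf// !ww0 ?rf// /w0.
    have /andP[r0 r1] := rf _ x01.
    by rewrite !clamp_id// subKr.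
- by move=> p; split; exact: Wm.
- by move=> t x Tt; rewrite /U /V /= !WT.
Unshelve. all: by end_near.
Qed.
End Existence.

(** * Extinction in finite time and stability *)

Theorem theorem1 (R : realType) (lambda mu : R * R -> R) (c K gamma : R)
    (C1 C2 C3 T M1 M2 : R)
    (lambda_smooth : smooth lambda) (mu_smooth : smooth mu)
    (c_gt0 : 0 < c)
    (speeds : forall p : R * R, mu p <= - c /\ c <= lambda p)
    (K_gt0 : 0 < K) (gamma_gt0 : 0 < gamma) (gamma_lt1 : gamma < 1)
    (C1_gt0 : 0 < C1) (C2_gt0 : 0 < C2)
    (T_def : T = c^-1 + C1 `^ (1 - gamma) / ((1 - gamma) * K))
    (M1_def : M1 = Num.max (C0_norm C1 lambda) (C0_norm C1 mu))
    (M2_def : M2 =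
      Num.max
        (Num.max (C0_norm C1 (partial false mu)) (C0_norm C1 (partial true mu)))
        (Num.max (C0_norm C1 (partial false lambda))
                 (C0_norm C1 (partial true lambda))))
    (M2_gt0 : 0 < M2)
    (smallness :
      T * M2 * Num.max 1 M1 * Num.max (K * C1 `^ gamma / c) C2
        <= (2 * expR 1)^-1)
    (C3_def : C3 = (2 * T * M2)^-1) :
  (forall u0 v0 : R -> R,
     is_Lip01 u0 -> is_Lip01 v0 ->
     (maxe (sup_norm `[0%R, 1%R] u0) (sup_norm `[0%R, 1%R] v0) <= C1%:E)%E ->
     (maxe (deriv_norm u0) (deriv_norm v0) <= C2%:E)%E ->
     exists u v : R * R -> R,
       [/\ class_D T C1 C3 u v /\ is_solution lambda mu K gamma T%:E u0 v0 u v,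
           forall u' v' : R * R -> R,
             class_D T C1 C3 u' v' ->
             is_solution lambda mu K gamma T%:E u0 v0 u' v' ->
             forall p, closed_strip T%:E p -> u' p = u p /\ v' p = v p &
           exists U V : R * R -> R,
             [/\ is_solution lambda mu K gamma +oo%E u0 v0 U V,
                 forall p, closed_strip T%:E p -> U p = u p /\ V p = v p &
                 forall t x : R, T <= t -> 0 <= x <= 1 ->
                   U (t, x) = 0 /\ V (t, x) = 0]])
  /\
  (forall eps : R, 0 < eps ->
     exists2 delta : R, 0 < delta &
       forall (u0 v0 : R -> R) (U V : R * R -> R),
         is_Lip01 u0 -> is_Lip01 v0 ->
         (Lip2_norm u0 v0 < delta%:E)%E ->
         class_D T C1 C3 U V ->
         is_solution lambda mu K gamma +oo%E u0 v0 U V ->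
         (Linfty_Lip2_norm U V < eps%:E)%E).
Proof.
have cl i : continuous (partial i lambda) by have [] := lambda_smooth [:: i].
have cm i : continuous (partial i mu) by have [] := mu_smooth [:: i].
have sM r : square C1 r -> `|lambda r| <= M1 /\ `|mu r| <= M1.
  move=> sr; rewrite M1_def !le_max.
  by rewrite !C0_norm_ge ?orbT//; [exact: (proj1 (mu_smooth [::]))|exact: (proj1 (lambda_smooth [::]))].
have lL r s : square C1 r -> square C1 s -> `|lambda r - lambda s| <= M2 * (`|r.1 - s.1| + `|r.2 - s.2|).
  apply: (smooth_lip lambda_smooth) => -[] p sp; rewrite M2_def !le_max; apply/orP; right; apply/orP.
    by right; exact: C0_norm_ge (cl true) _ sp.
  by left; exact: C0_norm_ge (cl false) _ sp.
have mL r s : square C1 r -> square C1 s -> `|mu r - mu s| <= M2 * (`|r.1 - s.1| + `|r.2 - s.2|).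
  apply: (smooth_lip mu_smooth) => -[] p sp; rewrite M2_def !le_max; apply/orP; left; apply/orP.
    by right; exact: C0_norm_ge (cm true) _ sp.
  by left; exact: C0_norm_ge (cm false) _ sp.
have T0 : 0 < T.
  rewrite T_def ltr_pwDl ?invr_gt0// divr_ge0 ?powR_ge0// mulr_ge0 ?(ltW K_gt0)//.
  by rewrite subr_ge0 ltW.
have T_ge : c^-1 + C1 `^ (1 - gamma) / ((1 - gamma) * K) <= T by rewrite T_def.
have E0 : 0 < expR 1 :> R by exact: expR_gt0.
have exist := solution_exists c_gt0 speeds K_gt0 gamma_gt0 gamma_lt1
  (ltW C1_gt0) (ltW M2_gt0) sM lL mL T_ge.
have bounded u v : class_D T C1 C3 u v -> forall p, closed_strip T%:E p -> `|u p| <= C1 /\ `|v p| <= C1.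
  by rewrite /class_D ge_max => -[/andP[/sup_normP h1 /sup_normP h2] _ _] p sp; split; [exact: h1|exact: h2].
split.
  move=> u0 v0 lu lv; rewrite !ge_max => /andP[/sup_normP su /sup_normP sv] /andP[du dv].
  set X := Num.max 1 M1 in smallness; set L0 := Num.max (K * C1 `^ gamma / c) C2 in smallness.
  have X1 : 1 <= X by rewrite le_max lexx.
  have X2 : M1 <= X by rewrite le_max lexx orbT.
  have LC2 : C2 <= L0 by rewrite le_max lexx orbT.
  have LC1 : K * C1 `^ gamma / c <= L0 by rewrite le_max lexx.
  have L00 : 0 < L0 := lt_le_trans C2_gt0 LC2.
  have key : 2 * T * M2 * (expR 1 * L0 * X) <= 1.
    move: smallness; rewrite -(ler_pM2r (x := 2 * expR 1)) ?mulr_gt0// mulVf ?gt_eqF ?mulr_gt0//.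
    by apply: le_trans; rewrite le_eqVlt; apply/orP; left; apply/eqP; ring.
  have LT : 2 * M2 * (expR 1 * L0) <= T^-1.
    rewrite -[leRHS]mul1r ler_pdivlMr//; apply: le_trans key.
    have -> : 2 * M2 * (expR 1 * L0) * T = 2 * T * M2 * (expR 1 * L0) * 1 by ring.
    have TM0 : 0 < 2 * T * M2 by rewrite !mulr_gt0.
    by rewrite -[leLHS]mulrA (ler_pM2l TM0) ler_pM2l ?mulr_gt0.
  have LC3 : expR 1 * L0 * X <= C3.
    by rewrite C3_def -[leRHS]mul1r ler_pdivlMr ?mulr_gt0// mulrC.
  have uvm x : 0 <= x <= 1 -> `|u0 x| <= C1 /\ `|v0 x| <= C1.
    by move=> x01; split; [apply: su|apply: sv]; rewrite /= in_itv.
  have lip f : is_Lip01 f -> (deriv_norm f <= C2%:E)%E ->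
      forall x y, 0 <= x <= 1 -> 0 <= y <= 1 -> `|f x - f y| <= L0 * `|x - y|.
    move=> lf df x y x01 y01; apply: le_trans (deriv_norm_lip lf (ltW C2_gt0) df x01 y01) _.
    exact: ler_wpM2r.
  have KL : K * C1 `^ gamma <= c * L0 by rewrite (mulrC c) -ler_pdivrMr.
  have m01 : 0 <= C1 <= C1 by rewrite lexx ltW.
  have [U [V [sol UVm UVl UV0]]] := exist L0 C1 u0 v0 (ltW L00) m01 uvm (lip _ lu du) (lip _ lv dv) KL LT.
  have UVD : class_D T C1 C3 U V.
    have C3lip a b : 0 <= a -> 0 <= b -> expR 1 * L0 * M1 * a + expR 1 * L0 * b <= C3 * (a + b).
      move=> a0 b0; apply: (@le_trans _ _ (expR 1 * L0 * X * (a + b))).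
        rewrite mulrDr lerD// ler_wpM2r//; first by rewrite ler_pM2l ?mulr_gt0.
        by rewrite ler_peMr// ltW ?mulr_gt0.
      by rewrite ler_wpM2r ?addr_ge0.
    split.
    - by rewrite ge_max; apply/andP; split; apply/sup_normP => p _; have [] := UVm p.
    - by move=> p q _ _; have [h _] := UVl p q; apply: le_trans h _; exact: C3lip.
    - by move=> p q _ _; have [_ h] := UVl p q; apply: le_trans h _; exact: C3lip.
  exists U, V; split; first by split => //; exact: sol.
    move=> u' v' D' sol' p sp.
    exact: (solution_unique lambda_smooth mu_smooth c_gt0 speeds K_gt0 gamma_gt0 gamma_lt1 T0 (lexx _) (lexx _)
      sol' (sol _ (lexx _)) (bounded _ _ D') (bounded _ _ UVD)).
  exists U, V; split => //; first by apply: sol; exact: leey.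
  by move=> t x Tt _; exact: UV0.
move=> eps eps0.
(* This kap serves as L0: the solution then has slope at most e kap, and a
   norm at most 2 (del + e kap), which is at most eps / 2. *)
pose kap := Num.min (eps / (4 * (1 + expR 1))) (Num.min C1 (2 * M2 * expR 1 * T)^-1).
have E10 : 0 < 4 * (1 + expR 1) :> R by rewrite mulr_gt0// addr_gt0.
have kap0 : 0 < kap by rewrite !lt_min C1_gt0 invr_gt0 divr_gt0 ?mulr_gt0.
have kapC : kap <= C1 by rewrite /kap !ge_min lexx !orbT.
have kape : kap * (4 * (1 + expR 1)) <= eps by rewrite -ler_pdivlMr// ge_min lexx.
have kapT : 2 * M2 * (expR 1 * kap) <= T^-1.
  have : kap <= (2 * M2 * expR 1 * T)^-1 by rewrite /kap !ge_min lexx !orbT.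
  rewrite -[X in _ <= X -> _]mul1r -[X in _ -> _ <= X]mul1r !ler_pdivlMr ?mulr_gt0// => h.
  by apply: le_trans h; rewrite le_eqVlt; apply/orP; left; apply/eqP; ring.
(* The second bound ensures K del^gamma <= c kap, as boundary data of size del
   create slopes K del^gamma / c. *)
pose del := Num.min kap ((c * kap / K) `^ gamma^-1).
have ck0 : 0 < c * kap / K by rewrite divr_gt0// mulr_gt0.
have del0 : 0 < del by rewrite lt_min kap0 powR_gt0.
have delk : del <= kap by rewrite ge_min lexx.
have Kdel : K * del `^ gamma <= c * kap.
  rewrite mulrC -ler_pdivlMr//.
  have -> : c * kap / K = ((c * kap / K) `^ gamma^-1) `^ gamma by rewrite -powRrM mulVf ?gt_eqF// powRr1// ltW.
  by apply: (ge0_ler_powR (ltW gamma_gt0)); rewrite ?nnegrE ?powR_ge0 ?(ltW del0)// ge_min lexx orbT.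
exists del => // u0 v0 U V lu lv small _ sol.
have [/sup_normP su [du [/sup_normP sv dv]]] := Lip2_norm_bounds (ltW small).
have uvm x : 0 <= x <= 1 -> `|u0 x| <= del /\ `|v0 x| <= del.
  by move=> x01; split; [apply: su|apply: sv]; rewrite /= in_itv.
have lip f : is_Lip01 f -> (deriv_norm f <= del%:E)%E ->
    forall x y, 0 <= x <= 1 -> 0 <= y <= 1 -> `|f x - f y| <= kap * `|x - y|.
  move=> lf df x y x01 y01; apply: le_trans (deriv_norm_lip lf (ltW del0) df x01 y01) _.
  exact: ler_wpM2r.
have m01 : 0 <= del <= C1 by rewrite (ltW del0) (le_trans delk).
have [U' [V' [sol' UVm UVl _]]] := exist kap del u0 v0 (ltW kap0) m01 uvm (lip _ lu du) (lip _ lv dv) Kdel kapT.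
have eqUV t x : 0 <= t -> 0 <= x <= 1 -> U (t, x) = U' (t, x) /\ V (t, x) = V' (t, x).
  move=> t0 /andP[x0 x1].
  have [L [UL VL]] : exists M, M_Lipschitz M (closed_strip +oo) U /\ M_Lipschitz M (closed_strip +oo) V by case: sol.
  pose Tp := t + T; have Tp0 : 0 < Tp by rewrite /Tp ltr_wpDl.
  have z0 : closed_strip +oo%E ((0, 0) : R * R) by split => //=; exact: leey.
  have bd f : M_Lipschitz L (closed_strip +oo) f -> forall p, closed_strip Tp%:E p -> `|f p| <= `|f (0, 0)| + `|L| * (Tp + 1).
    move=> fL p [p1 p2 p3 p4]; have sp : closed_strip +oo%E p by split => //; exact: leey.
    have h1 := ler_normD (f p - f (0, 0)) (f (0, 0)); rewrite subrK in h1.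
    apply: le_trans h1 _; rewrite [leLHS]addrC lerD2l.
    have h2 := fL _ _ sp z0; rewrite /= !subr0 (ger0_norm p1) (ger0_norm p3) in h2.
    apply: le_trans h2 _.
    apply: (@le_trans _ _ (`|L| * (p.1 + p.2))); first by rewrite ler_wpM2r ?addr_ge0 ?ler_norm.
    by rewrite ler_wpM2l// lerD.
  (* A common bound of the two solutions on [0, Tp]. *)
  pose N := `|U (0, 0)| + `|L| * (Tp + 1) + (`|V (0, 0)| + `|L| * (Tp + 1)) + del.
  have k0 : 0 <= `|L| * (Tp + 1) by rewrite mulr_ge0// addr_ge0// ltW.
  have uvN p : closed_strip Tp%:E p -> `|U p| <= N /\ `|V p| <= N.
    move=> sp; have := bd _ UL p sp; have := bd _ VL p sp.
    have := normr_ge0 (U (0, 0)); have := normr_ge0 (V (0, 0)); rewrite /N; move: k0 (ltW del0).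
    by clear; move=> *; split; lra.
  have uvN' p : closed_strip Tp%:E p -> `|U' p| <= N /\ `|V' p| <= N.
    move=> _; have [h1 h2] := UVm p.
    have := normr_ge0 (U (0, 0)); have := normr_ge0 (V (0, 0)); rewrite /N; move: k0 h1 h2.
    by clear; move=> *; split; lra.
  apply: (solution_unique lambda_smooth mu_smooth c_gt0 speeds K_gt0 gamma_gt0 gamma_lt1 Tp0 (leey _) (leey _)
    sol (sol' _ (leey _)) uvN uvN').
  by split => //=; rewrite lee_fin /Tp lerDl ltW.
have e0 : 0 <= 2 * (del + expR 1 * kap) by rewrite mulr_ge0// addr_ge0 ?mulr_ge0// ltW.
apply: (@le_lt_trans _ _ (2 * (del + expR 1 * kap))%:E); last first.
  rewrite lte_fin; move: kape delk eps0 kap0 (mulr_gt0 E0 kap0); clear; move: (expR 1) => E *; lra.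
apply: Linfty_Lip2_le => // t t0.
apply: Lip2_norm_le.
- by apply/sup_normP => x /=; rewrite in_itv/= => x01; have [-> _] := eqUV t x t0 x01; have [] := UVm (t, x).
- apply: lip_deriv_norm; first by rewrite mulr_ge0 ?ltW.
  move=> x y x01 y01; have [-> _] := eqUV t x t0 x01; have [-> _] := eqUV t y t0 y01.
  by have [/= h _] := UVl (t, x) (t, y); move: h; rewrite subrr normr0 mulr0 add0r.
- by apply/sup_normP => x /=; rewrite in_itv/= => x01; have [_ ->] := eqUV t x t0 x01; have [] := UVm (t, x).
- apply: lip_deriv_norm; first by rewrite mulr_ge0 ?ltW.
  move=> x y x01 y01; have [_ ->] := eqUV t x t0 x01; have [_ ->] := eqUV t y t0 y01.
  by have [/= _ h] := UVl (t, x) (t, y); move: h; rewrite subrr normr0 mulr0 add0r.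
Qed.
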